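(* Let $\mathbb{P}$ be an ergodic, $T$-invariant environment measure on $\Omega$ of finite range $M$, and let $\ell\in\mathbb{R}^d\setminus\{0\}$. Assume the weak ellipticity condition $$\mathbb{P}\big(\forall j\in\mathbb{Z}^d\text{ with }j\cdot\ell\ge0\text{ and }|j|=1:\ \pi_{0j}>0\big)=1$$ and that $P_0\big(\lim_{n\to\infty}X_n\cdot\ell=\infty\big)=1$. For $k\in\mathbb{Z}$ let $\mathfrak{S}_k=\sigma(\omega_x:\ x\cdot\ell\ge k)$. Suppose that there exists a probability measure $\mathbb{P}_\infty$ on $\Omega$ that is invariant for the process $(T^{X_n}\omega)_{n\ge0}$ and such that $\mathbb{P}_\infty|_{\mathfrak{S}_k}\ll\mathbb{P}|_{\mathfrak{S}_k}$ for every integer $k\le0$. Then: 1. For every integer $k\le0$, $\mathbb{P}|_{\mathfrak{S}_k}$ and $\mathbb{P}_\infty|_{\mathfrak{S}_k}$ are mutually absolutely continuous. 2. The Markov process $(T^{X_n}\omega)_{n\ge0}$ with initial distribution $\mathbb{P}_\infty$ is ergodic. 3. There is at most one probability measure $\mathbb{P}_\infty$ with these properties (invariant, and absolutely continuous with respect to $\mathbb{P}$ on $\mathfrak{S}_k$ for every $k\le0$), and if $\tilde{\mathbb{P}}_n(A)=n^{-1}\sum_{m=1}^nP_0(T^{X_m}\omega\in A)$, then $\tilde{\mathbb{P}}_n$ converges weakly to $\mathbb{P}_\infty$. 4. The following law of large numbers holds: $$P_0\Big(\lim_{n\to\infty}\frac{X_n}{n}=\mathbb{E}^{\mathbb{P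}_\infty}(D)\Big)=1.$$
   Context: Let $d\ge1$ and let $|\cdot|$ be the Euclidean norm. An environment is $\omega=(\omega_{ij})_{i,j\in\mathbb{Z}^d}\in[0,1]^{\mathbb{Z}^d\times\mathbb{Z}^d}$ with $\sum_j\omega_{ij}=1$ for all $i$; write $\pi_{ij}(\omega)=\omega_{ij}$ and $\omega_i=(\omega_{ij})_{j}$. $\Omega$ is the space of all environments, with product topology and product $\sigma$-field $\mathfrak{S}$, and shifts $(T^k\omega)_{ij}=\omega_{k+i,k+j}$, $k\in\mathbb{Z}^d$. An environment measure $\mathbb{P}$ is a probability measure on $(\Omega,\mathfrak{S})$; it is $T$-invariant and ergodic if it is so under the group $(T^k)_{k\in\mathbb{Z}^d}$; it has finite range $M$ ($1\le M<\infty$) if $\mathbb{P}(\pi_{ij}=0\text{ when }|i-j|>M)=1$. The quenched law $P_x^\omega$ is the law of the Markov chain $(X_n)_{n\ge0}$ on $\mathbb{Z}^d$ with $X_0=x$ and $P_x^\omega(X_{n+1}=j\mid X_n=i)=\pi_{ij}(\omega)$. The annealed law is $P_x=\int P_x^\omega\,d\mathbb{P}(\omega)$ (also regarded as the joint law of $(\omega,(X_n))$). The drift is $D(\omega)=\sum_i i\,\pi_{0i}(\omega)$. $\mathbb{E}^{\mu}$ denotes expectation under $\mu$. The process $(T^{X_n}\omega)_{n\ge0}$ of the environment seen from the particle is the Markov process on $\Omega$ with transition kernel $\pi(\omega,A)=\sum_{e}\pi_{0e}(\omega)\mathbf 1_A(T^e\omega)$; a probability measure $\mu$ is invariant for it if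 $\int\pi(\omega,A)\,d\mu(\omega)=\mu(A)$ for all $A\in\mathfrak{S}$. *)

(* Defs.v *)
From HB Require Import structures.
From mathcomp Require Import all_boot all_order all_algebra.
From mathcomp Require Import all_classical all_reals all_analysis.
From mathcomp Require Import measurable_realfun.

Set Implicit Arguments.
Unset Strict Implicit.
Unset Printing Implicit Defensive.

Import Order.TTheory GRing.Theory Num.Theory.
Import numFieldNormedType.Exports.

Local Open Scope classical_set_scope.
Local Open Scope ring_scope.

Definition site (d : nat) := 'rV[int]_d.
HB.instance Definition _ d := Countable.on (site d).
HB.instance Definition _ d := GRing.Zmodule.on (site d).
HB.instance Definition _ d := isPointed.Build (site d) 0.
HB.instance Definition _ d := @isMeasurable.Build default_measure_display
  (site d) discrete_measurable discrete_measurable0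
  discrete_measurableC discrete_measurableU.

Section sites.
Context {R : realType} {d : nat}.

Definition site_vec (x : site d) : 'rV[R]_d := \row_k (x 0 k)%:~R.

Definition dot (u v : 'rV[R]_d) : R := \sum_k u 0 k * v 0 k.

(* The norm `|x| of the library on 'rV[R]_d is the sup norm. *)
Definition enorm (u : 'rV[R]_d) : R := Num.sqrt (dot u u).

End sites.

Section trajectories.
Context {dT} (T : measurableType dT).

Definition traj_cylinders : set (set (nat -> T)) :=
  [set A | exists n (B : set T), measurable B /\ A = [set X | B (X n)]].

Definition traj := nat -> T.

Definition traj_display : measure_display -> measure_display.
Proof. by []. Qed.

HB.instance Definition _ := Pointed.on traj.
HB.instance Definition _ := @isMeasurable.Build (traj_display dT) traj
  <<s traj_cylinders >> (@sigma_algebra0 _ setT _) (@sigma_algebraC _ _)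
  (@sigma_algebra_bigcup _ setT _).

End trajectories.
Arguments traj_cylinders {dT} T.

Section environments.
Context (R : realType) (d : nat).

Record env := Env {
  env_prob :> site d -> site d -> R ;
  env_ge0 : forall i j, 0 <= env_prob i j ;
  env_le1 : forall i j, env_prob i j <= 1 ;
  env_sum1 : forall i, (\esum_(j in [set: site d]) (env_prob i j)%:E = 1)%E }.

Definition env_curry (w : env) : {ptws (site d * site d) -> R} :=
  fun ij => w ij.1 ij.2.

Lemma env_eq (w w' : env) : (forall i j, w i j = w' i j) -> w = w'.
Proof.
case: w => p p0 p1 ps; case: w' => q q0 q1 qs /= pq.
have {}pq : p = q by apply/funext => i; apply/funext => j.
by subst q; congr Env; exact: Prop_irrelevance.
Qed.

Let stay (i j : site d) : R := (i == j)%:R.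

Let stay_ge0 i j : 0 <= stay i j. Proof. exact: ler0n. Qed.

Let stay_le1 i j : stay i j <= 1. Proof. by rewrite /stay lern1 leq_b1. Qed.

Let stay_sum1 i : (\esum_(j in [set: site d]) (stay i j)%:E = 1)%E.
Proof.
rewrite (esumID [set i]) //; last by move=> j _; rewrite lee_fin.
rewrite setTI setTI esum_set1 ?lee_fin// /stay eqxx esum1 ?adde0// => j /= ji.
by rewrite eq_sym; case: eqP => // /ji.
Qed.

HB.instance Definition _ := gen_eqMixin env.
HB.instance Definition _ := gen_choiceMixin env.
HB.instance Definition _ := isPointed.Build env (Env stay_ge0 stay_le1 stay_sum1).
HB.instance Definition _ :=
  Topological.copy env (initial_topology env_curry).

Definition env_cylinders (S : set (site d)) : set (set env) :=
  [set A | exists x j (B : set R),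
    [/\ S x, measurable B & A = [set w : env | B (w x j)]]].

Definition env_display : measure_display. Proof. by constructor. Qed.

HB.instance Definition _ := @isMeasurable.Build env_display env
  <<s env_cylinders setT >> (@sigma_algebra0 _ setT _) (@sigma_algebraC _ _)
  (@sigma_algebra_bigcup _ setT _).

Lemma measurable_env_prob i j : measurable_fun [set: env] (fun w : env => w i j).
Proof.
move=> _ B mB; rewrite setTI; apply: sub_sigma_algebra.
by exists i, j, B.
Qed.

End environments.

Lemma measurable_fun_traj dY dT (Y : measurableType dY) (T : measurableType dT)
    (f : Y -> traj T) :
  (forall n, measurable_fun [set: Y] (fun y => f y n)) ->
  measurable_fun [set: Y] f.
Proof.
move=> mf; apply: (@measurability _ _ Y (traj T) setT f (traj_cylinders T)) => //.
by move=> _ [_ [n [B [mB ->]]] <-]; exact: mf.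
Qed.

Lemma measurable_traj_at dT (T : measurableType dT) n :
  measurable_fun [set: traj T] (fun X : traj T => X n).
Proof.
move=> _ B mB; rewrite setTI; apply: sub_sigma_algebra.
by exists n, B.
Qed.

(* Z^d being countable, measurability can be checked on each event {g = x}. *)
Lemma measurable_fun_site dY dZ (Y : measurableType dY) (Z : measurableType dZ)
    d (g : Y -> site d) (f : site d -> Y -> Z) :
  measurable_fun [set: Y] g -> (forall x, measurable_fun [set: Y] (f x)) ->
  measurable_fun [set: Y] (fun y => f (g y) y).
Proof.
move=> mg mf _ B mB; rewrite setTI.
rewrite (_ : _ @^-1` _ = \bigcup_(x in [set: site d])
    (g @^-1` [set x] `&` f x @^-1` B)); last first.
  by apply/seteqP; split=> [y By|y [x _ [<-]]] //; exists (g y).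
apply: countable_bigcupT_measurable => // x; apply: measurableI.
- by rewrite -[X in measurable X]setTI; apply: mg.
- by rewrite -[X in measurable X]setTI; apply: mf.
Qed.

Section markov_chain.
Context (R : realType) (d : nat).
Local Notation site := (site d).
Local Notation env := (env R d).

Definition is_markov_chain_law (w : env) (x : site)
    (Q : set (traj site) -> \bar R) : Prop :=
  forall n (s : nat -> site),
    Q [set X | forall k, (k <= n)%N -> X k = s k] =
    ((s 0%N == x)%:R * \prod_(k < n) w (s k) (s k.+1))%:E.

(* Existence of the chain, by inverse transform sampling: given the current
   site i and a uniform u in [0, 1[, the next site is the j such that u lies in
   the j-th interval of a partition of [0, 1[ in intervals of length w i j, and
   u is then rescaled to a uniform of [0, 1[. *)

Local Definition wt (w : env) i n : R := oapp (w i) 0 (@pickle_inv site n).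

Local Definition cum (w : env) i n : R := \sum_(0 <= k < n) wt w i k.

Local Definition cell (w : env) i j : set R :=
  [set u | cum w i (pickle j) <= u < cum w i (pickle j) + w i j].

Local Definition next (w : env) i u : site := xget i [set j | cell w i j u].

Local Definition step (w : env) (z : site * R) : site * R :=
  let j := next w z.1 z.2 in
  (j, (z.2 - cum w z.1 (pickle j)) / w z.1 j).

Local Definition chain (w : env) x (u : R) : traj site := fun n => (iter n (step w) (x, u)).1.

Local Lemma wt_ge0 w i n : 0 <= wt w i n.
Proof. by rewrite /wt; case: pickle_inv => //= j; exact: env_ge0. Qed.

Local Lemma wt_pickle w i j : wt w i (pickle j) = w i j.
Proof. by rewrite /wt pickleK_inv. Qed.

Local Lemma cumS w i n : cum w i n.+1 = cum w i n + wt w i n.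
Proof. by rewrite /cum big_nat_recr. Qed.

Local Lemma cum_ge0 w i n : 0 <= cum w i n.
Proof. by apply: sumr_ge0 => k _; exact: wt_ge0. Qed.

Local Lemma le_cum w i : {homo cum w i : m n / (m <= n)%N >-> m <= n}.
Proof.
apply: homo_leq; [exact: lexx|exact: le_trans|].
by move=> n; rewrite cumS lerDl wt_ge0.
Qed.

Local Lemma wt_sum1 w i : (\sum_(k <oo) (wt w i k)%:E = 1)%E.
Proof.
rewrite nneseries_esumT; last by move=> n; rewrite lee_fin wt_ge0.
rewrite -(env_sum1 w i) (esumID (range (@pickle site))); last first.
  by move=> n _; rewrite lee_fin wt_ge0.
rewrite !setTI [X in (_ + X)%E]esum1 ?adde0; last first.
  move=> n /= nP; rewrite /wt; case E: (@pickle_inv site n) => [j|]//=.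
  exfalso; apply: nP; exists j => //.
  by have := @pickle_invK site n; rewrite /oapp E.
rewrite esum_image; last by move=> a b _ _; exact: (pcan_inj pickleK).
by apply: eq_esum => j _; rewrite wt_pickle.
Qed.

Local Lemma cum_le1 w i n : cum w i n <= 1.
Proof.
rewrite -lee_fin -(wt_sum1 w i) /cum -sumEFin.
by apply: nneseries_lim_ge => k _; rewrite lee_fin wt_ge0.
Qed.

Local Lemma cum_cvg w i : cum w i n @[n --> \oo] --> (1 : R).
Proof.
suff : (cum w i n)%:E @[n --> \oo] --> 1%E by move/fine_cvgP => [].
rewrite -(wt_sum1 w i).
under eq_fun do rewrite /cum -sumEFin.
by apply: is_cvg_nneseries => k _ _; rewrite lee_fin wt_ge0.
Qed.

Local Lemma cell_ex w i u : 0 <= u < 1 -> exists j, cell w i j u.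
Proof.
move=> /andP[u0 u1].
have ex : exists n, u < cum w i n.
  have [N _ /(_ N (leqnn N)) ?] := cvgr_gt _ (cum_cvg w i) _ u1; by exists N.
case: (ex_minnP ex) => -[|n].
  by rewrite /cum big_geq// ltNge u0.
move=> un min_n.
have nu : cum w i n <= u by rewrite leNgt; apply/negP => /min_n; rewrite ltnn.
have : wt w i n != 0.
  by apply/eqP => wn; move: un; rewrite cumS wn addr0 ltNge nu.
rewrite /wt; case E: (@pickle_inv site n) => [j|]/=; last by rewrite eqxx.
have En : pickle j = n by have := @pickle_invK site n; rewrite /oapp E.
by exists j; rewrite /cell/= En nu -wt_pickle En -cumS.
Qed.

Local Lemma cell_uniq w i u j k : cell w i j u -> cell w i k u -> j = k.
Proof.
wlog jk : j k / (pickle j <= pickle k)%N.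
  move=> h; case/orP: (leq_total (pickle j) (pickle k)) => jk cj ck.
    exact: h.
  by apply/esym/h.
move: jk; rewrite leq_eqVlt => /orP[/eqP/(pcan_inj pickleK)//|jk].
move=> /andP[_ uj] /andP[ku _].
have := le_cum w i jk; rewrite cumS wt_pickle => h.
by have := lt_le_trans uj (le_trans h ku); rewrite ltxx.
Qed.

Local Lemma next_cell w i u j : 0 <= u < 1 -> (next w i u = j) <-> cell w i j u.
Proof.
move=> u01; rewrite /next; case: xgetP => [k _ ck|nc].
  by split=> [<-//|]; exact: cell_uniq ck.
by have [k /nc] := cell_ex w i u01.
Qed.

Local Lemma chain0 w x u : chain w x u 0%N = x. Proof. by []. Qed.

Local Lemma chainS w x u n : chain w x u n.+1 =
  chain w (next w x u) ((u - cum w x (pickle (next w x u))) / w x (next w x u)) n.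
Proof. by rewrite /chain iterSr. Qed.

Local Lemma chain_itv (w : env) n (s : nat -> site) : exists a : R,
  let l := \prod_(k < n) w (s k) (s k.+1) in
  [/\ 0 <= a, a + l <= 1 &
   forall u : R, 0 <= u < 1 ->
     (forall k, (k <= n)%N -> chain w (s 0%N) u k = s k) <-> a <= u < a + l].
Proof.
elim: n s => [|n IH] s /=.
  exists 0; rewrite big_ord0 add0r; split=> // u u01; split=> // _ k.
  by rewrite leqn0 => /eqP->; rewrite chain0.
have [a []] := IH (s \o S); rewrite /=.
set l := \prod_(k < n) _ => a0 al1 Ha.
have l0 : 0 <= l by apply: prodr_ge0 => k _; exact: env_ge0.
set i := s 0%N; set j := s 1%N; set c := cum w i (pickle j); set p := w i j.
have p0 : 0 <= p by exact: env_ge0.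
exists (c + p * a); rewrite big_ord_recl /=.
rewrite [\prod_(_ < n) _](_ : _ = l)//.
rewrite -/i -/j -/p -addrA -mulrDr; split.
- by rewrite addr_ge0 ?cum_ge0 ?mulr_ge0.
- have := cum_le1 w i (pickle j).+1; rewrite cumS wt_pickle; apply: le_trans.
  by rewrite lerD2l ler_piMr.
move=> u u01.
have step1 : cell w i j u ->
    ((forall k, (k <= n.+1)%N -> chain w i u k = s k) <->
     (forall k, (k <= n)%N -> chain w j ((u - c) / p) k = s k.+1)).
  move=> /(next_cell _ _ _ u01) nj; split=> h k kn.
    by have := h k.+1 kn; rewrite chainS nj.
  by case: k kn => [//|k] kn; rewrite chainS nj; exact: h.
have [pz|pn0] := eqVneq p 0.
  rewrite pz !mul0r addr0; split; last by case/andP=> /le_lt_trans h /h; rewrite ltxx.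
  move=> /(_ 1%N isT); rewrite chainS chain0 => /(next_cell _ _ _ u01).
  by rewrite /cell /= -/c -/p pz addr0.
have pp : 0 < p by rewrite lt_def pn0.
split=> h.
  have cj : cell w i j u.
    by apply/(next_cell _ _ _ u01); have := h 1%N isT; rewrite chainS chain0.
  have v01 : 0 <= (u - c) / p < 1.
    move: cj; rewrite /cell/= -/c -/p => /andP[cu up].
    by rewrite divr_ge0 ?subr_ge0//= ltr_pdivrMr// mul1r ltrBlDl.
  have /(Ha _ v01) := (step1 cj).1 h.
  by rewrite ler_pdivlMr// ltr_pdivrMr// lerBrDl ltrBlDl mulrC [_ * p]mulrC.
have /andP[h1 h2] := h.
have cj : cell w i j u.
  rewrite /cell/= -/c -/p (le_trans _ h1) ?lerDl ?mulr_ge0//=.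
  by rewrite (lt_le_trans h2)// lerD2l ler_piMr.
apply/(step1 cj).
have v01 : 0 <= (u - c) / p < 1.
  move: cj; rewrite /cell/= -/c -/p => /andP[cu up].
  by rewrite divr_ge0 ?subr_ge0//= ltr_pdivrMr// mul1r ltrBlDl.
apply/(Ha _ v01).
by rewrite ler_pdivlMr// ltr_pdivrMr// lerBrDl ltrBlDl mulrC [_ * p]mulrC.
Qed.

Local Lemma measurable_inv : measurable_fun [set: R] (@GRing.inv R).
Proof.
rewrite -(setvU [set (0 : R)]); apply/measurable_funU => //.
  exact/measurableC.
split; last exact: measurable_fun_set1.
apply: open_continuous_measurable_fun; first exact: closed_openC.
by move=> x; rewrite inE /= => /eqP x0; exact: inv_continuous.
Qed.

Local Lemma measurable_wt i n : measurable_fun [set: env] (fun w => wt w i n).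
Proof.
rewrite /wt; case: pickle_inv => [j|] /=; last exact: measurable_cst.
exact: measurable_env_prob.
Qed.

Local Lemma measurable_cum i n : measurable_fun [set: env] (fun w => cum w i n).
Proof. by apply: measurable_sum => k; exact: measurable_wt. Qed.

Local Lemma measurable_cell i j : measurable [set wv : env * R | cell wv.1 i j wv.2].
Proof.
have mc : measurable_fun [set: env * R] (fun wv => cum wv.1 i (pickle j)).
  by apply: (measurableT_comp (measurable_cum i (pickle j))).
have mp : measurable_fun [set: env * R] (fun wv => wv.1 i j).
  by apply: (measurableT_comp (measurable_env_prob i j)).
rewrite (_ : [set _ | _] =
    (setT `&` [set wv | cum wv.1 i (pickle j) <= wv.2]) `\`
    (setT `&` [set wv | cum wv.1 i (pickle j) + wv.1 i j <= wv.2])); last first.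
  rewrite !setTI; apply/seteqP; split=> -[w v]; rewrite /cell /=.
    by move=> /andP[-> vlt]; split=> //; rewrite leNgt vlt.
  by move=> [-> /negP]; rewrite -ltNge.
by apply: measurableD; apply: measurable_fun_le => //; exact: measurable_funD.
Qed.

Local Lemma measurable_next i :
  measurable_fun [set: env * R] (fun wv => next wv.1 i wv.2).
Proof.
move=> _ B _; rewrite setTI.
rewrite (_ : _ @^-1` _ = \bigcup_(j in [set: site])
    ([set wv | next wv.1 i wv.2 = j] `&` [set _ | B j])); last first.
  apply/seteqP; split=> [y By|y [x _ []]] /=; last by move=> ->.
  by exists (next y.1 i y.2).
apply: countable_bigcupT_measurable => // j; apply: measurableI; last first.
  by have [Bj|nBj] := pselect (B j);
    [rewrite (_ : [set _ | _] = setT)|rewrite (_ : [set _ | _] = set0)] => //;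
    apply/seteqP; split.
rewrite (_ : [set _ | _] = [set wv | cell wv.1 i j wv.2] `|`
    (~` (\bigcup_(k in [set: site]) [set wv | cell wv.1 i k wv.2]) `&`
     [set _ | j = i])); last first.
  apply/seteqP; split=> -[w v] /=; rewrite /next.
    case: xgetP => [k _ ck <-|nc <-]; first by left.
    by right; split=> // -[k _ /nc].
  case: xgetP => [k _ ck|nc].
    move=> [cj|[]]; first exact: cell_uniq ck cj.
    by move=> h _; case: h; exists k.
  by case=> [/nc|[_ ->]].
apply: measurableU; first exact: measurable_cell.
apply: measurableI.
  apply: measurableC; apply: countable_bigcupT_measurable => // k.
  exact: measurable_cell.
by have [Bj|nBj] := pselect (j = i);
  [rewrite (_ : [set _ | _] = setT)|rewrite (_ : [set _ | _] = set0)] => //;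
  apply/seteqP; split.
Qed.

Local Lemma measurable_step i :
  measurable_fun [set: env * R] (fun wv => step wv.1 (i, wv.2)).
Proof.
apply: measurable_fun_pair => /=; first exact: measurable_next.
pose rest j (wv : env * R) := (wv.2 - cum wv.1 i (pickle j)) / wv.1 i j.
suff mrest j : measurable_fun setT (rest j).
  exact: (measurable_fun_site (measurable_next i) mrest).
apply: measurable_funM.
  apply: measurable_funB => //.
  by apply: (measurableT_comp (measurable_cum i (pickle j))).
apply: (measurableT_comp measurable_inv).
by apply: (measurableT_comp (measurable_env_prob i j)).
Qed.

Local Lemma measurable_chain x :
  measurable_fun [set: env * R] (fun wu => chain wu.1 x wu.2).
Proof.
apply: measurable_fun_traj => n; rewrite /chain.
suff: measurable_fun [set: env * R] (fun wu => iter n (step wu.1) (x, wu.2)).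
  by move=> /measurable_fun_pairP[].
elim: n => [|n IH] /=.
  by apply: measurable_fun_pair => //; exact: measurable_cst.
have [m1 m2] := (measurable_fun_pairP _).1 IH.
pose g i (wu : env * R) := step wu.1 (i, (iter n (step wu.1) (x, wu.2)).2).
suff mg i : measurable_fun setT (g i).
  rewrite (_ : (fun wu => _) =
    fun wu => g (iter n (step wu.1) (x, wu.2)).1 wu); last first.
    by apply/funext => wu; rewrite /g -surjective_pairing.
  exact: (measurable_fun_site m1 mg).
pose h (wu : env * R) := (wu.1, (iter n (step wu.1) (x, wu.2)).2).
have mh : measurable_fun setT h by exact: measurable_fun_pair.
exact: (measurableT_comp (measurable_step i) mh).
Qed.

Local Definition chain_law x (w : env) (A : set (traj site)) : \bar R :=
  lebesgue_measure ([set u : R | A (chain w x u)] `&` `[0, 1[).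

Local Lemma measurable_chain_preimage x w (A : set (traj site)) : measurable A ->
  measurable [set u : R | A (chain w x u)].
Proof.
move=> mA; rewrite -[X in measurable X]setTI.
have mw : measurable_fun [set: R] (fun u : R => (w, u)).
  by apply: measurable_fun_pair => //; exact: measurable_cst.
exact: (measurableT_comp (measurable_chain x) mw measurableT mA).
Qed.

Local Lemma chain_law0 x w : chain_law x w set0 = 0%E.
Proof. by rewrite /chain_law (_ : [set _ | _] = set0)// set0I measure0. Qed.

Local Lemma chain_law_ge0 x w A : (0 <= chain_law x w A)%E.
Proof. exact: measure_ge0. Qed.

Local Lemma chain_law_additive x w : semi_sigma_additive (chain_law x w).
Proof.
move=> F mF tF mUF; rewrite /chain_law.
rewrite (_ : [set u | _] = \bigcup_n [set u | F n (chain w x u)]); last first.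
  by apply/seteqP; split=> u [n _ ?]; exists n.
rewrite setI_bigcupl; apply: measure_semi_sigma_additive.
- by move=> n; apply: measurableI => //; exact: measurable_chain_preimage.
- apply/trivIsetP => i j _ _ ij; apply/seteqP; split=> // u [[ui _] [uj _]].
  by have /trivIsetP/(_ i j I I ij)/seteqP[+ _] := tF; apply; split;
    [exact: ui|exact: uj].
- apply: bigcup_measurable => n _; apply: measurableI => //.
  exact: measurable_chain_preimage.
Qed.

HB.instance Definition _ x w := isMeasure.Build _ _ _ (chain_law x w)
  (chain_law0 x w) (chain_law_ge0 x w) (@chain_law_additive x w).

Local Definition chain_kernel x : env -> {measure set (traj site) -> \bar R} :=
  chain_law x.

Local Lemma measurable_chain_kernel x A : measurable A ->
  measurable_fun [set: env] (chain_kernel x ^~ A).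
Proof.
move=> mA; pose E := [set wu : env * R | A (chain wu.1 x wu.2)] `&`
  (setT `*` `[0, 1[).
have mE : measurable E.
  apply: measurableI; last exact: measurableX.
  by rewrite -[X in measurable X]setTI; exact: measurable_chain.
have := measurable_fun_xsection (@lebesgue_measure R) mE.
congr (measurable_fun _ _); apply/funext => w /=.
rewrite /chain_kernel/= /chain_law; congr lebesgue_measure.
apply/seteqP; split=> u /=; first by move=> /set_mem[? [_ ?]].
by move=> [? ?]; apply/mem_set.
Qed.

HB.instance Definition _ x := isKernel.Build _ _ _ _ R (chain_kernel x)
  (@measurable_chain_kernel x).

Local Lemma chain_kernelT x w : chain_kernel x w [set: traj site] = 1%E.
Proof.
rewrite /chain_kernel /= /chain_law setTI lebesgue_measure_itv /= lte01.
by rewrite oppr0 addr0.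
Qed.

HB.instance Definition _ x := Kernel_isProbability.Build _ _ _ _ R
  (chain_kernel x) (@chain_kernelT x).

Lemma quenched_law_exists x : exists K : R.-pker env ~> traj site,
  forall w, is_markov_chain_law w x (K w).
Proof.
exists (chain_kernel x : R.-pker env ~> traj site) => w n s.
rewrite /chain_kernel /= /chain_law.
have [s0x|s0x] := eqVneq (s 0%N) x; last first.
  rewrite mul0r (_ : _ `&` _ = set0) ?measure0//.
  apply/seteqP; split=> // u [/(_ 0%N isT)].
  by rewrite chain0 => /esym/eqP; rewrite (negbTE s0x).
have [a] := chain_itv w n s; rewrite mul1r.
set l := \prod_(k < n) _; rewrite /= => -[a0 al Ha].
have l0 : 0 <= l by apply: prodr_ge0 => k _; exact: env_ge0.
rewrite (_ : _ `&` _ = `[a, a + l[%classic).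
  rewrite lebesgue_measure_itv /= lte_fin ltrDl; case: ltP => [_|].
    by rewrite -EFinD addrAC subrr add0r.
  by move=> h; congr _%:E; apply/le_anti/andP.
rewrite -s0x; apply/seteqP; split=> u /=.
  by move=> [h]; rewrite !in_itv /= => u01; apply/(Ha _ u01).
rewrite !in_itv /= => /andP[h1 h2].
have u01 : 0 <= u < 1 by rewrite (le_trans a0 h1) (lt_le_trans h2 al).
by split=> //; apply/(Ha _ u01); rewrite h1.
Qed.

(* Its finite-dimensional distributions determine the law of the chain on the
   product sigma-field, so the choice made here is immaterial. *)
Definition quenched_law x : R.-pker env ~> traj site :=
  sval (cid (quenched_law_exists x)).

Lemma quenched_lawP x w : is_markov_chain_law w x (quenched_law x w).
Proof. exact: (svalP (cid (quenched_law_exists x)) w). Qed.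

End markov_chain.
Arguments quenched_law {R d} x.
Arguments is_markov_chain_law {R d} w x Q.

Section shift.
Context {R : realType} {d : nat}.
Variables (k : site d) (w : env R d).

Let shift_prob (i j : site d) : R := w (k + i) (k + j).

Let shift_ge0 i j : 0 <= shift_prob i j. Proof. exact: env_ge0. Qed.

Let shift_le1 i j : shift_prob i j <= 1. Proof. exact: env_le1. Qed.

Let shift_sum1 i : (\esum_(j in [set: site d]) (shift_prob i j)%:E = 1)%E.
Proof.
by rewrite -(env_sum1 w (k + i)); apply/esym/reindex_esum; split.
Qed.

Definition shift : env R d := Env shift_ge0 shift_le1 shift_sum1.

End shift.

Lemma measurable_shift (R : realType) d (k : site d) :
  measurable_fun [set: env R d] (shift k).
Proof.
apply: (@measurability _ _ _ (env R d) setT _ (env_cylinders setT)) => //.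
move=> _ [_ [i [j [B [_ mB ->]]]] <-].
exact: (measurable_env_prob (k + i) (k + j)).
Qed.

Section annealed.
Context {R : realType} {d : nat}.
Local Notation path := (traj (site d)).

Section annealed_law.
Variables (P : probability (env R d) R) (x : site d).
Local Open Scope ereal_scope.

Definition annealed_law (E : set (env R d * path)) : \bar R :=
  \int[P]_w quenched_law x w (xsection E w).

Let annealed_law0 : annealed_law set0 = 0.
Proof. by rewrite /annealed_law integral0_eq// => w _; rewrite xsection0 measure0. Qed.

Let annealed_law_ge0 E : 0 <= annealed_law E.
Proof. exact: integral_ge0. Qed.

Let annealed_law_additive : semi_sigma_additive annealed_law.
Proof.
move=> F mF tF mUF.
have mS n : measurable_fun [set: env R d]
    (fun w => quenched_law x w (xsection (F n) w)).
  by apply: measurable_fun_xsection_finite_kernel; rewrite inE.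
rewrite [X in _ --> X](_ : _ = \sum_(n <oo) annealed_law (F n)).
  by apply: is_cvg_nneseries => n _ _; exact: annealed_law_ge0.
rewrite /annealed_law -integral_nneseries//.
apply: eq_integral => w _; rewrite xsection_bigcup.
rewrite measure_bigcup//; first by apply: eq_eseriesl => n; rewrite in_setT.
- by move=> n _; exact: measurable_xsection.
- exact: trivIset_xsection.
Qed.

HB.instance Definition _ := isMeasure.Build _ _ _ annealed_law
  annealed_law0 annealed_law_ge0 annealed_law_additive.

Let annealed_lawT : annealed_law setT = 1.
Proof.
rewrite /annealed_law -[RHS](@probability_setT _ _ _ P) -[RHS]mul1e.
rewrite -integral_cst//; apply: eq_integral => w _.
rewrite (_ : xsection _ _ = setT) ?prob_kernel//.
by apply/seteqP; split=> // X _; apply/mem_set.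
Qed.

HB.instance Definition _ := Measure_isProbability.Build _ _ _ annealed_law
  annealed_lawT.

End annealed_law.

Definition env_process (wX : env R d * path) : traj (env R d) :=
  fun n => shift (wX.2 n) wX.1.

Lemma measurable_env_process : measurable_fun setT env_process.
Proof.
apply: measurable_fun_traj => n; rewrite /env_process.
pose g (wX : env R d * path) : site d := wX.2 n.
have mg : measurable_fun setT g.
  exact: (measurableT_comp (measurable_traj_at n) measurable_snd).
pose f k (wX : env R d * path) := shift k wX.1.
suff mf k : measurable_fun setT (f k) by exact: (measurable_fun_site mg mf).
exact: (measurableT_comp (measurable_shift k) measurable_fst).
Qed.

End annealed.

Section notions.
Context {R : realType} {d : nat}.
Local Notation env := (env R d).

Definition finite_range (M : R) (P : set env -> \bar R) : Prop :=
  P [set w : env | forall i j, M < enorm (site_vec (i - j)) -> w i j = 0] = 1%E.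

Definition shift_invariant (P : set env -> \bar R) : Prop :=
  forall k A, measurable A -> P (shift k @^-1` A) = P A.

Definition shift_ergodic (P : set env -> \bar R) : Prop :=
  forall A, measurable A -> (forall k, shift k @^-1` A = A) ->
    P A = 0%E \/ P A = 1%E.

Definition sigma_above (l : 'rV[R]_d) (k : int) : set (set env) :=
  <<s @env_cylinders R d [set x | k%:~R <= dot (site_vec x) l] >>.

(* Absolute continuity of mu with respect to nu, restricted to G. *)
Definition ac_on (G : set (set env)) (mu nu : set env -> \bar R) : Prop :=
  forall A, G A -> nu A = 0%E -> mu A = 0%E.

Definition env_kernel (w : env) (A : set env) : \bar R :=
  \esum_(e in [set: site d]) (w 0 e * \1_A (shift e w))%:E.

Definition env_process_invariant (mu : set env -> \bar R) : Prop :=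
  forall A, measurable A -> (\int[mu]_w env_kernel w A = mu A)%E.

(* Law of the environment seen from the particle, started from mu. *)
Definition env_process_law (mu : probability env R) : set (traj env) -> \bar R :=
  pushforward (annealed_law mu 0) env_process.

Definition time_shift_ergodic (Q : set (traj env) -> \bar R) : Prop :=
  forall A : set (traj env), measurable A ->
    [set Y : traj env | A (fun n => Y n.+1)] = A ->
    Q A = 0%E \/ Q A = 1%E.

Definition empirical (P : probability env R) (n : nat) (A : set env) : \bar R :=
  ((n%:R^-1)%:E * \sum_(1 <= m < n.+1)
    annealed_law P 0%R [set wX | A (shift (wX.2 m) wX.1)])%E.

Definition cvg_weakly (mu_ : nat -> set env -> \bar R)
    (mu : set env -> \bar R) : Prop :=
  forall f : env -> R, continuous f -> (exists C, forall w, `|f w| <= C) ->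
    (\int[mu_ n]_w (f w)%:E)%E @[n --> \oo] --> (\int[mu]_w (f w)%:E)%E.

(* The sum of an absolutely summable family; the value is not meaningful
   otherwise. *)
Definition site_sum (f : site d -> R) : R :=
  fine (\esum_(i in [set: site d]) (EFin \o f)^\+ i -
        \esum_(i in [set: site d]) (EFin \o f)^\- i)%E.

Definition drift (w : env) : 'rV[R]_d :=
  \row_k site_sum (fun i => (i 0 k)%:~R * w 0 i).

End notions.

(* Main.v *)
(* Let Theta be the shift on pairs (environment, path), and Q_mu the annealed law
   for mu. An invariant event E has a quenched probability h_E(w) that is harmonic;
   when mu is invariant, comparing h_E at two successive environments in L^2 shows
   that it is constant along the walk, whence h_E is 0 or 1 almost surely.

   Every other argument is a transfer between P and P_oo. The walk is transient
   under both measures (a path from w stays above its initial level with positive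
   P-probability, hence also with positive P_oo-probability, and the 0-1 law turns
   this into boundedness from below). On the paths staying above level -m, an event
   depending on the environment only through the rows above some level has a
   quenched probability which is S_k-measurable, so that the mutual absolute
   continuity on S_k makes such local events null for Q_P and Q_{P_oo} together.

   For a local invariant E this makes h_E equal to 0 or 1 also P-almost surely;
   by harmonicity and ellipticity the set {h_E = 0} is almost shift-invariant,
   hence E is trivial. Applied to the event that the sums of f - c along Theta are
   unbounded above, with the maximal ergodic theorem, this shows that each local f
   is independent of all invariant events; so Theta is ergodic for Q_{P_oo}.
   Birkhoff's theorem for local functions is itself a local statement and therefore
   holds under Q_P; this gives the law of large numbers, the convergence of the
   empirical measures on each S_k, and uniqueness. A nonnegative continuous
   function is an increasing limit of local ones, whence weak convergence. *)
Require Import Defs.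
From HB Require Import structures.
From mathcomp Require Import all_boot all_order all_algebra.
From mathcomp Require Import all_classical all_reals all_analysis.
From mathcomp Require Import measurable_realfun.
From mathcomp Require Import ring lra.
Import Defs.

Set Implicit Arguments.
Unset Strict Implicit.
Unset Printing Implicit Defensive.

Import Order.TTheory GRing.Theory Num.Theory.
Import numFieldNormedType.Exports.

Local Open Scope classical_set_scope.
Local Open Scope ring_scope.

(** * Countable sums and null sets *)

(** The hypotheses compare $P$ and $P_\infty$ only on the sigma-fields $\mathfrak{S}_k$, and $P$
    need not be stationary for the environment process. Ergodic theorems are therefore available
    under $Q_{P_\infty}$ only, and a conclusion reaches $P$ only if it is decided by rows above some
    level. What is transferred is always the vanishing of a probability, never its value; an
    assertion such as $h_E\in\{0,1\}$ must first be rephrased as the nullity of events of this kind.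
    A general invariant event is not local, so its triviality cannot be transferred directly. The
    unboundedness of the sums of a local function is both local and strictly invariant, which is
    what the detour through such events provides. Locality is asked only on paths that stay above a
    given level: the sums along Theta look at the environment from the sites visited, and a path
    without lower bound would bring every row into play. *)

Lemma measurable_preimage d1 d2 (T1 : measurableType d1) (T2 : measurableType d2)
    (f : T1 -> T2) B : measurable_fun setT f -> measurable B -> measurable (f @^-1` B).
Proof. by move=> mf mB; rewrite -[X in measurable X]setTI; exact: mf. Qed.

Lemma nat_upper_bound (R : realType) (x : R) : exists k : nat, x <= k%:R.
Proof.
exists (Num.truncn `|x|).+1; apply: le_trans (ler_norm x) _; exact/ltW/truncnS_gt.
Qed.

Lemma measurable_neq0 (R : realType) : measurable [set x : \bar R | x != 0%E].
Proof.
rewrite (_ : [set x | _] = ~` [set 0%E]); first by apply: measurableC;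
  exact: emeasurable_set1.
by apply/seteqP; split=> x /= /eqP.
Qed.

Section countable_sums.
Context {R : realType}.
Local Open Scope ereal_scope.

(** Sums over a countable type become series, for which countable additivity and measurability are
    stated. *)
Lemma esum_pickle (T : countType) (f : T -> \bar R) : (forall x, 0 <= f x) ->
  \esum_(x in [set: T]) f x = \sum_(n <oo) oapp f 0 (@pickle_inv T n).
Proof.
move=> f0.
have h0 n : 0 <= oapp f 0 (@pickle_inv T n) by case: pickle_inv => //=.
rewrite nneseries_esumT// (esumID (range (@pickle T)))//.
rewrite !setTI [X in _ = (_ + X)%E]esum1 ?adde0; last first.
  move=> n /= nP; case E: (@pickle_inv T n) => [j|]//=.
  exfalso; apply: nP; exists j => //.
  by have := @pickle_invK T n; rewrite /oapp E.
rewrite esum_image; last by move=> a b _ _; exact: (pcan_inj pickleK).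
by apply: eq_esum => j _; rewrite pickleK_inv.
Qed.

Context d (Y : measurableType d) (mu : {measure set Y -> \bar R})
  (T : countType) (g : Y -> T).
Hypothesis mg : forall x, measurable (g @^-1` [set x]).

Let fib n := oapp (fun x => g @^-1` [set x]) set0 (@pickle_inv T n).

Let mfib n : measurable (fib n).
Proof. by rewrite /fib; case: pickle_inv => /=. Qed.

Let tfib : trivIset setT fib.
Proof.
apply/trivIsetP => i j _ _ ij; apply/seteqP; split=> // y []; rewrite /fib.
case Ei : (@pickle_inv T i) => [a|]//=; case Ej : (@pickle_inv T j) => [b|]//=.
move=> ya yb; move: ij; have := @pickle_invK T i; have := @pickle_invK T j.
by rewrite /oapp Ei Ej -ya -yb => <- <-; rewrite eqxx.
Qed.

Let cfib : \bigcup_n fib n = setT.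
Proof.
apply/seteqP; split=> // y _; exists (pickle (g y)) => //.
by rewrite /fib pickleK_inv.
Qed.

Lemma measure_fibers A : measurable A ->
  mu A = \esum_(x in [set: T]) mu (A `&` g @^-1` [set x]).
Proof.
move=> mA; rewrite esum_pickle => [|//].
rewrite -[in LHS](setIT A) -cfib setI_bigcupr measure_semi_bigcup//.
- apply: eq_eseriesr => n _; rewrite /fib; case: pickle_inv => //=.
  by rewrite setI0 measure0.
- by move=> n; exact: measurableI.
- exact: trivIset_setIl.
- by apply: bigcup_measurable => n _; exact: measurableI.
Qed.

Lemma integral_fibers (f : Y -> \bar R) : measurable_fun setT f ->
  (forall y, 0 <= f y) ->
  \int[mu]_y f y = \esum_(x in [set: T]) \int[mu]_(y in g @^-1` [set x]) f y.
Proof.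
move=> mf f0; rewrite esum_pickle; last by move=> x; exact: integral_ge0.
rewrite -cfib ge0_integral_bigcup//; last by rewrite cfib.
apply: eq_eseriesr => n _; rewrite /fib; case: pickle_inv => //=.
by rewrite integral_set0.
Qed.

Lemma measurable_comp_fibers dZ (Z : measurableType dZ) (f : T -> Z) :
  measurable_fun setT (f \o g).
Proof.
move=> _ B mB; rewrite setTI.
rewrite (_ : _ @^-1` _ =
    \bigcup_(x in [set: T]) (g @^-1` [set x] `&` [set _ | B (f x)])); last first.
  by apply/seteqP; split=> [y By|y [x _ [/= <-]]//]; exists (g y).
apply: countable_bigcupT_measurable => // x.
have [Bx|nBx] := pselect (B (f x)).
  by rewrite (_ : [set _ | _] = setT) ?setIT//; apply/seteqP; split.
by rewrite (_ : [set _ | _] = set0) ?setI0//; apply/seteqP; split.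
Qed.

Lemma integral_comp_fibers (f : T -> \bar R) : (forall x, 0 <= f x) ->
  \int[mu]_y f (g y) = \esum_(x in [set: T]) (mu (g @^-1` [set x]) * f x).
Proof.
move=> f0; rewrite integral_fibers//.
  apply: eq_esum => x _; rewrite muleC -integral_cst//.
  by apply: eq_integral => y; rewrite inE/= => ->.
exact: measurable_comp_fibers.
Qed.

End countable_sums.

Section null_sets.
Context d (T : measurableType d) (R : realType).
Implicit Types (mu : {measure set T -> \bar R}) (P : probability T R).
Local Open Scope ereal_scope.

Lemma null_bigcup mu (F : (set T)^nat) : (forall n, measurable (F n)) ->
  (forall n, mu (F n) = 0) -> mu (\bigcup_n F n) = 0.
Proof.
move=> mF F0; have mU : measurable (\bigcup_n F n) by exact: bigcupT_measurable.
apply/(measure_negligible mU)/negligible_bigcup => n.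
exact: (negligibleP mu (mF n)).2 (F0 n).
Qed.

Lemma null_bigcup_count mu (I : countType) (F : I -> set T) :
  (forall i, measurable (F i)) -> (forall i, mu (F i) = 0) ->
  mu (\bigcup_(i in [set: I]) F i) = 0.
Proof.
move=> mF F0.
rewrite (_ : \bigcup_(_ in _) _ = \bigcup_n oapp F set0 (@pickle_inv I n)).
  by apply: null_bigcup => n; case: pickle_inv => //=.
apply/seteqP; split=> [x [i _ Fi]|x [n _]]; last first.
  by case: pickle_inv => //= i Fi; exists i.
by exists (pickle i) => //; rewrite pickleK_inv.
Qed.

Lemma null_subset mu A B : measurable A -> measurable B -> A `<=` B ->
  mu B = 0 -> mu A = 0.
Proof. by move=> mA mB AB; apply: subset_measure0 => //; rewrite inE. Qed.

Lemma probability1P P A : measurable A -> P A = 1 <-> P (~` A) = 0.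
Proof.
move=> mA; rewrite probability_setC//; split=> [->|]; first by rewrite subee.
by move=> h; rewrite -[LHS]add0e -h subeK// fin_num_measure.
Qed.

Lemma measure_eq0U mu A B : measurable A -> measurable B ->
  mu A = 0 -> mu B = 0 -> mu (A `|` B) = 0.
Proof. by move=> mA mB A0 B0; rewrite measureU0. Qed.

End null_sets.

Definition push_measure d d' (T1 : measurableType d) (T2 : measurableType d')
    (R : realType) (m : {measure set T1 -> \bar R}) (f : T1 -> T2)
    (mf : measurable_fun setT f) : {measure set T2 -> \bar R} :=
  measure_function_pushforward__canonical__measure_function_Measure m mf.

(** * Laws of the quenched path *)

Section paths.
Context {R : realType} {d : nat}.
Local Notation site := (site d).
Local Notation path := (traj site).
Local Notation env := (env R d).

Definition path_cyl n (s : nat -> site) : set path :=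
  [set X | forall k, (k <= n)%N -> X k = s k].

Lemma measurable_path_at n (B : set site) : measurable [set X : path | B (X n)].
Proof. by apply: sub_sigma_algebra; exists n, B. Qed.

Lemma measurable_path_cyl n s : measurable (path_cyl n s).
Proof.
rewrite (_ : path_cyl n s = \bigcap_(k in `I_n.+1) [set X | X k = s k]).
  by apply: bigcap_measurableType => k _; exact: measurable_path_at k [set s k].
by apply/seteqP; split=> X h k kn; exact: h.
Qed.

Lemma mkseq_fiber n (t : seq site) :
  [set X : path | mkseq X n.+1 = t] =
  if size t == n.+1 then path_cyl n (nth 0 t) else set0.
Proof.
apply/seteqP; split=> X /=.
  move=> <-; rewrite size_mkseq eqxx => k kn.
  by rewrite nth_mkseq.
case: eqP => //= st h; apply: (@eq_from_nth _ 0); first by rewrite size_mkseq.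
by move=> k; rewrite size_mkseq => kn; rewrite nth_mkseq//; exact: h.
Qed.

Lemma measurable_mkseq_fiber n (t : seq site) :
  measurable [set X : path | mkseq X n.+1 = t].
Proof.
by rewrite mkseq_fiber; case: ifP => _ //; exact: measurable_path_cyl.
Qed.

(** Cylinders along incompatible sequences are disjoint, so [set0] is added to make this a
    pi-system. *)
Let G : set (set path) := [set A | A = set0 \/ exists n s, A = path_cyl n s].

Let G_closed : setI_closed G.
Proof.
have cylI n m s t : (n <= m)%N -> G (path_cyl n s `&` path_cyl m t).
  move=> nm; have [st|nst] := pselect (forall k, (k <= n)%N -> s k = t k).
    right; exists m, t; apply/seteqP; split=> [X []//|X Xt]; split=> // k kn.
    by rewrite st// Xt// (leq_trans kn).
  left; apply/seteqP; split=> // X [Xs Xt]; apply: nst => k kn.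
  by rewrite -Xs// Xt// (leq_trans kn).
move=> A B [->|[n [s ->]]]; first by left; rewrite set0I.
move=> [->|[m [t ->]]]; first by left; rewrite setI0.
have [nm|/ltnW mn] := leqP n m; first exact: cylI.
by rewrite setIC; exact: cylI.
Qed.

Let G_gen : @measurable _ path = <<s G >>.
Proof.
apply/seteqP; split.
  apply: smallest_sub; first exact: smallest_sigma_algebra.
  move=> _ [n [B [_ ->]]].
  rewrite (_ : [set X | _] = \bigcup_(t in [set: seq site])
    (if `[< B (nth 0 t n) >] then path_cyl n (nth 0 t) else set0)).
    apply: (@countable_bigcupT_measurable _ (g_sigma_algebraType G)) => // t.
    apply: sub_sigma_algebra; case: ifP => _; last by left.
    by right; exists n, (nth 0 t).
  apply/seteqP; split=> [X BX|X [t _]].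
    exists (mkseq X n.+1) => //; rewrite nth_mkseq// asboolT// => k kn.
    by rewrite nth_mkseq.
  by case: asboolP => //= Bt /(_ n (leqnn n)) ->.
apply: smallest_sub; first exact: sigma_algebra_measurable.
by move=> _ [->|[n [s ->]]]; [exact: measurable0|exact: measurable_path_cyl].
Qed.

(** Uniqueness on a generating pi-system. The whole space is not assumed to be a cylinder, so the
    cover by finite-measure sets consists of the countably many cylinders that fix [X 0]. *)
Lemma path_law_unique (m1 m2 : {measure set path -> \bar R}) :
  (m1 setT < +oo)%E -> (forall n s, m1 (path_cyl n s) = m2 (path_cyl n s)) ->
  forall A, measurable A -> m1 A = m2 A.
Proof.
move=> m1T m12.
pose g n := oapp (fun x : site => path_cyl 0 (fun=> x)) set0 (@pickle_inv site n).
have Gg n : G (g n).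
  by rewrite /g; case: pickle_inv => [x|]; [right; exists 0%N, (fun=> x)|left].
have mG B : G B -> measurable B.
  by rewrite G_gen; exact: sub_sigma_algebra.
apply: (measure_unique G g) => //.
- apply/seteqP; split=> // X _; exists (pickle (X 0%N)) => //.
  by rewrite /g pickleK_inv => k; rewrite leqn0 => /eqP ->.
- by move=> A [->|[n [s ->]]]; [rewrite !measure0|exact: m12].
- move=> n; apply: le_lt_trans m1T; apply: le_measure => //; rewrite inE.
    exact: mG.
  exact: measurableT.
Qed.

Definition qlaw (w : env) : set path -> \bar R := quenched_law 0 w.

HB.instance Definition _ w := Measure.on (qlaw w).

Lemma qlawT w : qlaw w setT = 1%E.
Proof. exact: prob_kernel. Qed.

HB.instance Definition _ w := Measure_isProbability.Build _ _ _ (qlaw w) (qlawT w).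

Lemma qlaw_cyl w n s : qlaw w (path_cyl n s) =
  ((s 0%N == 0)%:R * \prod_(k < n) w (s k) (s k.+1))%:E.
Proof. exact: quenched_lawP. Qed.

Lemma qlaw_start w : qlaw w [set X : path | X 0%N = 0] = 1%E.
Proof.
rewrite (_ : [set X | _] = path_cyl 0 (fun=> 0)).
  by rewrite qlaw_cyl eqxx big_ord0 mulr1.
apply/seteqP; split=> X /=; last by move=> /(_ 0%N (leqnn _)).
by move=> X0 k; rewrite leqn0 => /eqP ->.
Qed.

(** For [X] started at 0, the path whose first step is [e] and whose continuation seen from [e] is
    [X]. *)
Definition prep (e : site) (X : path) : path := fun n => if n is k.+1 then e + X k else 0.

Lemma measurable_prep e : measurable_fun setT (prep e).
Proof.
apply: measurable_fun_traj => -[|n]; first exact: measurable_cst.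
move=> _ B mB; rewrite setTI.
exact: measurable_path_at n [set x | B (e + x)].
Qed.

(** The Markov property at time 1. Both sides are finite measures in [A], so cylinders suffice;
    there the product of transition probabilities splits off its first factor, and the others are
    those of the translated path in the shifted environment. *)
Lemma qlaw_first_step w (e : site) (A : set path) : measurable A ->
  qlaw w (A `&` [set X : path | X 1%N = e]) =
  ((w 0%R e)%:E * qlaw (shift e w) (prep e @^-1` A))%E.
Proof.
have me : measurable [set X : path | X 1%N = e] := measurable_path_at 1 [set e].
pose m1 := mrestr (qlaw w) me.
pose m2 := mscale (NngNum (env_ge0 w 0 e))
  (push_measure (qlaw (shift e w)) (measurable_prep e)).
move=> mA; apply: (@path_law_unique m1 m2) => //.
  rewrite /m1 /= /mrestr setTI; apply: (@le_lt_trans _ _ 1%E); last exact: ltry.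
  exact: probability_le1.
move=> n s; rewrite /m1 /m2 /= /mrestr /mscale /= /pushforward.
have [s0|s0] := eqVneq (s 0%N) 0; last first.
  rewrite (_ : prep e @^-1` _ = set0).
    rewrite measure0 mule0; apply/eqP; rewrite -measure_le0 -[leRHS](_ : qlaw w
      (path_cyl n s) = 0%E).
      apply: le_measure; rewrite ?inE//; first by apply: measurableI => //;
        exact: measurable_path_cyl.
      exact: measurable_path_cyl.
    by rewrite qlaw_cyl (negbTE s0) mul0r.
  apply/seteqP; split=> // X /(_ 0%N (leq0n _))/= /esym/eqP.
  by rewrite (negbTE s0).
(* A cylinder of length 0 does not see the first step; intersected with [X 1 = e] it becomes a
   cylinder of length 1. *)
case: n => [|n].
  rewrite (_ : _ `&` _ = path_cyl 1 (fun k => if k is 0%N then 0 else e)).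
    rewrite qlaw_cyl eqxx big_ord1 mul1r/=.
    rewrite (_ : prep e @^-1` _ = setT) ?probability_setT ?mule1//.
    by apply/seteqP; split=> // X _ k; rewrite leqn0 => /eqP ->.
  apply/seteqP; split=> X /=.
    by move=> [X0 X1] [|[|//]] _ //; rewrite (X0 0%N).
  move=> X01; split; last exact: (X01 1%N).
  by move=> k; rewrite leqn0 => /eqP ->; rewrite s0 (X01 0%N).
have [s1|s1] := eqVneq (s 1%N) e; last first.
  rewrite [X in qlaw w X](_ : _ = set0) ?measure0; last first.
    by apply/seteqP; split=> // X [/(_ 1%N isT) h1 /=]; rewrite h1 => /eqP; rewrite
      (negbTE s1).
  rewrite (@null_subset _ _ _ _ _ (path_cyl n (fun k => s k.+1 - e))) ?mule0//.
  - by rewrite -[X in measurable X]setTI; apply: measurable_prep => //;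
    exact: measurable_path_cyl.
  - exact: measurable_path_cyl.
  - by move=> X h k kn; rewrite -(h k.+1)//= addrC addKr.
  - by apply: (etrans (qlaw_cyl _ _ _)); rewrite subr_eq0 (negbTE s1) mul0r.
rewrite [X in qlaw w X](_ : _ = path_cyl n.+1 s); last first.
  by apply/seteqP; split=> [X []//|X Xs]; split=> //=; rewrite Xs.
rewrite (_ : prep e @^-1` _ = path_cyl n (fun k => s k.+1 - e)); last first.
  apply/seteqP; split=> X h.
    by move=> k kn; rewrite -(h k.+1)//= addrC addKr.
  by move=> [|k] kn; rewrite /= ?s0// h// addrC subrK.
rewrite !qlaw_cyl s1 subrr !eqxx mul1r s0 eqxx !mul1r big_ord_recl s0 s1 -EFinM.
congr ((_ * _)%:E); apply: eq_bigr => k _ /=.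
by rewrite !(addrC e) !subrK.
Qed.

Lemma measurable_mkseq n (S : set (seq site)) :
  measurable [set X : path | S (mkseq X n.+1)].
Proof.
rewrite (_ : [set X | _] = \bigcup_(t in [set: seq site])
  ([set X : path | mkseq X n.+1 = t] `&` [set _ | S t])); last first.
  by apply/seteqP; split=> [X SX|X [t _ [/= <-]]//]; exists (mkseq X n.+1).
apply: countable_bigcupT_measurable => // t.
apply: measurableI; first exact: measurable_mkseq_fiber.
have [St|nSt] := pselect (S t).
  by rewrite (_ : [set _ | _] = setT)//; apply/seteqP; split.
by rewrite (_ : [set _ | _] = set0)//; apply/seteqP; split.
Qed.

Lemma qlaw_mkseq_eq (w w' : env) n (S : set (seq site)) :
  (forall t, S t -> forall k, (k < n)%N -> forall j, w (nth 0 t k) j = w'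
    (nth 0 t k) j) ->
  qlaw w [set X : path | S (mkseq X n.+1)] = qlaw w' [set X : path | S (mkseq X n.+1)].
Proof.
move=> ww'; have mS := measurable_mkseq n S.
rewrite (measure_fibers _ (measurable_mkseq_fiber n) mS).
rewrite (measure_fibers (qlaw w') (measurable_mkseq_fiber n) mS).
apply: eq_esum => t _.
have [St|nSt] := pselect (S t); last first.
  by rewrite (_ : _ `&` _ = set0) ?measure0//; apply/seteqP; split=> // X [/= + Xt];
    rewrite Xt.
rewrite (_ : _ `&` _ = [set X : path | mkseq X n.+1 = t]); last first.
  by apply/seteqP; split=> [X []//|X /= Xt]; split=> //=; rewrite Xt.
rewrite mkseq_fiber; case: ifP => _; last by rewrite !measure0.
rewrite /= !qlaw_cyl; congr ((_ * _)%:E); apply: eq_bigr => k _.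
exact: ww'.
Qed.

Variable l : 'rV[R]_d.

Definition height (x : site) : R := dot (site_vec x) l.

(** The parameter is a depth, so these events increase with [t]. The start at 0 is included, which
    makes positions and displacements coincide. *)
Definition above (t : R) : set path :=
  [set X | X 0%N = 0 /\ forall n, - t <= height (X n)].

Lemma measurable_above t : measurable (above t).
Proof.
rewrite (_ : above t = [set X | X 0%N = 0] `&`
   \bigcap_(n in [set: nat]) [set X : path | - t <= height (X n)]).
  apply: measurableI; first exact: measurable_path_at 0%N [set 0].
  apply: bigcap_measurableType => n _.
  exact: measurable_path_at n [set x | - t <= height x].
by apply/seteqP; split=> X [X0 h]; split=> // n; [move=> _|]; exact: h.
Qed.

Definition agree_above t (w w' : env) :=
  forall x, - t <= height x -> forall j, w x j = w' x j.

(** On a cylinder, the event [above t] is the decreasing limit of the events [F N] that check the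
    level up to time [n + N] only. Each [F N] has the same probability in both environments, since
    all rows it uses lie above level $-t$. *)
Lemma qlaw_eq_above t w w' A : agree_above t w w' -> measurable A ->
  qlaw w (A `&` above t) = qlaw w' (A `&` above t).
Proof.
move=> ww' mA; pose m v := mrestr (qlaw v) (measurable_above t).
apply: (@path_law_unique (m w) (m w')) => //.
  rewrite /m /= /mrestr setTI; apply: (@le_lt_trans _ _ 1%E); last exact: ltry.
  by apply: probability_le1; exact: measurable_above.
move=> n s; rewrite /m /= /mrestr.
pose S N := [set u : seq site | nth 0 u 0%N = 0 /\
  forall k, (k < N.+1)%N -> ((k <= n)%N -> nth 0 u k = s k) /\ - t <= height (nth 0 u k)].
pose F N := [set X : path | S (n + N)%N (mkseq X (n + N).+1)].
have FE N X : F N X <-> X 0%N = 0 /\ forall k, (k < (n + N).+1)%N ->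
    ((k <= n)%N -> X k = s k) /\ - t <= height (X k).
  split=> -[X0 h]; split=> // k kN.
    by have := h _ kN; rewrite nth_mkseq.
  by rewrite nth_mkseq//; exact: h.
have mF N : measurable (F N) := measurable_mkseq _ _.
have FF : \bigcap_N F N = path_cyl n s `&` above t.
  apply/seteqP; split=> X.
    move=> h; split.
      move=> k kn; have /FE[_ /(_ k)[|+ _]] := h 0%N I; last exact.
      by rewrite addn0.
    split; first by have /FE[] := h 0%N I.
    by move=> k; have /FE[_ /(_ k)[|//]] := h k I; rewrite ltnS leq_addl.
  move=> [Xs [X0 Xa]] N _; apply/FE; split=> // k kN; split; [exact: Xs|exact: Xa].
have cv v : qlaw v \o F @ \oo --> qlaw v (path_cyl n s `&` above t).
  rewrite -FF; apply: nonincreasing_cvg_mu => //.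
  - by apply: (@le_lt_trans _ _ 1%E); [exact: probability_le1 (mF _)|exact: ltry].
  - by apply: bigcapT_measurable.
  - move=> N M NM; apply/subsetPset => X /FE[X0 h]; apply/FE; split=> // k kN.
    by apply: h; rewrite (leq_trans kN)// ltnS leq_add2l.
have : qlaw w \o F = qlaw w' \o F.
  apply/funext => N; apply: qlaw_mkseq_eq => u [_ h] k kN j; apply: ww'.
  by have [|//] := h k; rewrite ltnS ltnW.
move=> E; have := cv w; rewrite E => cw.
exact: (cvg_unique _ cw (cv w')).
Qed.

End paths.

(** * The annealed law *)

Lemma ge0_integral_eq0P d (T : measurableType d) (R : realType)
    (mu : {measure set T -> \bar R}) (f : T -> \bar R) :
  measurable_fun setT f -> (forall x, 0 <= f x)%E ->
  (\int[mu]_x f x = 0)%E <-> mu [set x | f x != 0%E] = 0%E.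
Proof.
move=> mf f0; have mN : measurable [set x | f x != 0%E].
  rewrite (_ : [set x | _] = ~` (f @^-1` [set 0%E])).
    by apply: measurableC; rewrite -[X in measurable X]setTI; apply: mf => //;
      exact: emeasurable_set1.
  by apply/seteqP; split=> x /=; move/eqP.
have E : (\int[mu]_x f x = \int[mu]_x `|f x|)%E.
  by apply: eq_integral => x _; rewrite gee0_abs.
rewrite E; split.
  move/(ae_eq_integral_abs mu measurableT mf) => [N [mN' N0 sN]].
  apply: (null_subset mN mN') => // x /= fx; apply: sN => /= /(_ I) fx0.
  by rewrite fx0 eqxx in fx.
move=> N0; apply/(ae_eq_integral_abs mu measurableT mf).
exists [set x | f x != 0%E]; split=> // x /= h; apply/eqP => fx; exact: h.
Qed.

Section environment_laws.
Context {R : realType} {d : nat}.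
Local Notation site := (site d).
Local Notation path := (traj site).
Local Notation env := (env R d).
Implicit Types (mu : probability env R) (E : set (env * path)).

(** This is $h_E$. *)
Definition qsec E (w : env) : \bar R := qlaw w [set X | E (w, X)].

Lemma xsection_set E w : xsection E w = [set X | E (w, X)].
Proof. by apply/seteqP; split=> X; rewrite /xsection /= inE. Qed.

Lemma measurable_sec E w : measurable E -> measurable [set X | E (w, X)].
Proof. by rewrite -xsection_set; exact: measurable_xsection. Qed.

Lemma measurable_qsec E : measurable E -> measurable_fun setT (qsec E).
Proof.
move=> mE; rewrite (_ : qsec E = fun w => quenched_law 0 w (xsection E w)).
  by apply: measurable_fun_xsection_finite_kernel; rewrite inE.
by apply/funext => w; rewrite xsection_set.
Qed.

Lemma annealedE mu E : (annealed_law mu 0%R E = \int[mu]_w qsec E w)%E.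
Proof. by apply: eq_integral => w _; rewrite xsection_set. Qed.

Lemma qsec_ge0 E w : (0 <= qsec E w)%E. Proof. exact: measure_ge0. Qed.

Lemma qsec_le1 E w : measurable E -> (qsec E w <= 1)%E.
Proof. by move=> mE; apply: probability_le1; exact: measurable_sec. Qed.

Lemma annealed0P mu E : measurable E ->
  annealed_law mu 0 E = 0%E <-> mu [set w | qsec E w != 0%E] = 0%E.
Proof.
move=> mE; rewrite annealedE; apply: ge0_integral_eq0P; first exact: measurable_qsec.
by move=> w; exact: qsec_ge0.
Qed.

Let pair_path (w : env) (X : path) : env * path := (w, X).

Let measurable_pair_path w : measurable_fun setT (pair_path w).
Proof. by apply: measurable_fun_pair => //; exact: measurable_cst. Qed.

(** The annealed law is the composition of the constant kernel [prior] on [unit] with the kernel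
    $w\mapsto\delta_w\otimes$ [qlaw w]. Fubini's theorem for it is then the integral formula for
    composed kernels. *)
Let joint (uw : unit * env) : {measure set (env * path) -> \bar R} :=
  push_measure (qlaw uw.2) (@measurable_pair_path uw.2).

Let measurable_joint U : measurable U -> measurable_fun setT (joint ^~ U).
Proof.
move=> mU; apply: (measurableT_comp (measurable_qsec mU)).
exact: measurable_snd.
Qed.

HB.instance Definition _ := isKernel.Build _ _ _ _ R joint measurable_joint.

Let joint_T uw : joint uw setT = 1%E.
Proof. exact: qlawT. Qed.

HB.instance Definition _ := Kernel_isProbability.Build _ _ _ _ R joint joint_T.

Let prior mu : unit -> {measure set env -> \bar R} := fun=> mu.

Let measurable_prior mu U : measurable U -> measurable_fun setT (prior mu ^~ U).
Proof. by move=> mU; exact: measurable_cst. Qed.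

HB.instance Definition _ mu := isKernel.Build _ _ _ _ R (prior mu) (@measurable_prior mu).

Let prior_T mu u : prior mu u setT = 1%E.
Proof. exact: probability_setT. Qed.

HB.instance Definition _ mu := Kernel_isProbability.Build _ _ _ _ R (prior mu)
  (@prior_T mu).

Lemma annealed_fubini mu (f : env * path -> \bar R) :
  measurable_fun setT f -> (forall z, 0 <= f z)%E ->
  (\int[annealed_law mu 0%R]_z f z = \int[mu]_w \int[qlaw w]_X f (w, X))%E.
Proof.
move=> mf f0.
have := integral_kcomp (prior mu) joint tt f0 mf.
rewrite (_ : kcomp (prior mu) joint tt = annealed_law mu 0); last first.
  by apply/funext => E; rewrite annealedE.
move=> ->; apply: eq_integral => w _.
exact: (ge0_integral_pushforward (@measurable_pair_path w) (qlaw w)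
  measurableT mf (fun y _ => f0 y)).
Qed.

End environment_laws.

(** * The shift on environments and paths *)

Section theta.
Context {R : realType} {d : nat}.
Local Notation site := (site d).
Local Notation path := (traj site).
Local Notation env := (env R d).
Implicit Types (mu : probability env R) (E : set (env * path)).

Lemma env_shiftD (a b : site) (w : env) : shift a (shift b w) = shift (b + a) w.
Proof. by apply: env_eq => i j /=; rewrite !addrA. Qed.

Lemma env_shift0 (w : env) : shift 0 w = w.
Proof. by apply: env_eq => i j /=; rewrite !add0r. Qed.

(* The path is translated so that its starting point does not change. This makes
   the first coordinate of [iter j theta z] equal to [T^(X_j - X_0) w] also for
   [j = 0], see [iter_theta]. *)
Definition theta (z : env * path) : env * path :=
  (shift (z.2 1%N - z.2 0%N) z.1, fun n => z.2 n.+1 - (z.2 1%N - z.2 0%N)).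

Lemma measurable_site_comp dY (Y : measurableType dY) (f : site -> site) (g : Y -> site) :
  measurable_fun setT g -> measurable_fun setT (f \o g).
Proof. by move=> mg _ B mB; rewrite setTI -[X in measurable X]setTI; apply: (mg _
  (f @^-1` B)). Qed.

Lemma measurable_site_comp2 dY (Y : measurableType dY) (f : site -> site -> site)
    (g h : Y -> site) :
  measurable_fun setT g -> measurable_fun setT h ->
  measurable_fun setT (fun y => f (g y) (h y)).
Proof.
move=> mg mh; apply: (measurable_fun_site (f := fun x y => f x (h y)) mg) => x.
exact: measurable_site_comp.
Qed.

Lemma measurable_coord n : measurable_fun setT (fun z : env * path => z.2 n).
Proof. exact: (measurableT_comp (measurable_traj_at n) measurable_snd). Qed.

Lemma measurable_shift_fun dY (Y : measurableType dY) (g : Y -> site) (h : Y -> env) :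
  measurable_fun setT g -> measurable_fun setT h ->
  measurable_fun setT (fun y => shift (g y) (h y)).
Proof.
move=> mg mh; apply: (measurable_fun_site (f := fun x y => shift x (h y)) mg) => x.
exact: (measurableT_comp (measurable_shift x)).
Qed.

Lemma measurable_theta : measurable_fun setT theta.
Proof.
have mB : measurable_fun setT (fun z : env * path => z.2 1%N - z.2 0%N).
  exact: (measurable_site_comp2 (fun a b => a - b) (measurable_coord 1)
    (measurable_coord 0)).
apply: measurable_fun_pair; first exact: measurable_shift_fun.
apply: measurable_fun_traj => n.
exact: (measurable_site_comp2 (fun a b => a - b) (measurable_coord n.+1) mB).
Qed.

Lemma iter_theta j (z : env * path) : iter j theta z =
  (shift (z.2 j - z.2 0%N) z.1, fun n => z.2 (n + j)%N - (z.2 j - z.2 0%N)).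
Proof.
elim: j => [|j IH].
  rewrite subrr env_shift0; case: z => w X; congr pair; apply/funext => n /=.
  by rewrite addn0 subr0.
rewrite iterS IH /theta /= env_shiftD add1n add0n.
set a := z.2 j.+1; set b := z.2 j; set c := z.2 0%N.
have E : a - (b - c) - (b - (b - c)) = a - b.
  by rewrite subKr opprB addrA addrAC addrK.
have E' : a - b + (b - c) = a - c by rewrite addrA subrK.
congr pair; first by rewrite E addrC E'.
by apply/funext => n; rewrite E addSnnS -addrA -opprD [b - c + _]addrC E'.
Qed.

Lemma env_process_theta (z : env * path) n : env_process (theta z) n = env_process z n.+1.
Proof. by rewrite /env_process /theta /= env_shiftD addrC subrK. Qed.

Lemma env_process_iter_theta j (z : env * path) : z.2 0%N = 0 ->
  (iter j theta z).1 = env_process z j.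
Proof. by move=> z0; rewrite iter_theta /= z0 subr0. Qed.

Lemma theta_prep (e : site) (w : env) (X : path) : X 0%N = 0 -> theta (w, prep e X) =
  (shift e w, X).
Proof.
move=> X0; rewrite /theta /= X0 addr0 subr0; congr pair; apply/funext => n.
by rewrite addrC addKr.
Qed.

Lemma qlaw_step (w : env) (e : site) : qlaw w [set X : path | X 1%N = e] = (w 0 e)%:E.
Proof.
rewrite -[X in qlaw w X]setTI qlaw_first_step// preimage_setT.
by rewrite qlawT mule1.
Qed.

Lemma qlaw_eq_start (w : env) (A B : set path) : measurable A -> measurable B ->
  (forall X, X 0%N = 0 -> A X <-> B X) -> qlaw w A = qlaw w B.
Proof.
move=> mA mB AB.
have mS : measurable [set X : path | X 0%N = 0] := measurable_path_at 0 [set 0].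
have S0 := (probability1P (qlaw w) mS).1 (qlaw_start w).
have H (C : set path) : measurable C -> qlaw w C = qlaw w (C `&` [set X | X 0%N = 0]).
  move=> mC; rewrite -[in LHS](setIT C) -(setvU [set X : path | X 0%N = 0]) setIUr.
  rewrite setUC measureU0//; [exact: measurableI|exact: measurableI (measurableC mS)|].
  apply: null_subset S0; [exact: measurableI (measurableC mS)|exact: measurableC|].
  exact: subIsetr.
rewrite H// [RHS]H//; congr (qlaw w _); apply/seteqP; split=> X [ABX X0]; split=> //.
  exact/AB.
exact/AB.
Qed.

Lemma qsec_theta_path (w : env) (e : site) E : measurable E ->
  qlaw w [set X | E (theta (w, X)) /\ X 1%N = e] = ((w 0%R e)%:E * qsec E (shift e w))%E.
Proof.
move=> mE; have mtE := measurable_preimage measurable_theta mE.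
rewrite [X in qlaw w X](_ : _ = [set X | (theta @^-1` E) (w,
  X)] `&` [set X | X 1%N = e])//.
rewrite qlaw_first_step; last exact: (measurable_sec (E := theta @^-1` E)).
congr (_ * _)%E; apply: qlaw_eq_start.
- apply: measurable_preimage; first exact: measurable_prep.
  exact: (measurable_sec (E := theta @^-1` E)).
- exact: measurable_sec.
- by move=> X X0; rewrite /= theta_prep.
Qed.

(** The Markov property summed over the first step. For an invariant event it is the harmonicity of
    $h_E$. *)
Lemma qsec_theta (w : env) E : measurable E ->
  qsec (theta @^-1` E) w = (\int[qlaw w]_X qsec E (shift (X 1%N) w))%E.
Proof.
move=> mE.
have m1 (e : site) : measurable ((fun X : path =>
  X 1%N) @^-1` [set e]) := measurable_path_at 1 [set e].
rewrite (integral_comp_fibers (qlaw w) m1 (f := fun e => qsec E (shift e w))); last first.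
  by move=> e; exact: qsec_ge0.
rewrite /qsec (measure_fibers (qlaw w) m1); last first.
  by apply: (measurable_sec (E := theta @^-1` E));
    exact: measurable_preimage measurable_theta mE.
apply: eq_esum => e _; apply: (etrans (qsec_theta_path w e mE)).
by congr (_ * _)%E; exact: (esym (qlaw_step w e)).
Qed.

Lemma measurable_start_neq0 : measurable [set z : env * path | z.2 0%N <> 0].
Proof.
apply: (measurable_preimage (f := fun z : env * path => z.2 0%N)
  (B := [set x | x <> 0])) => //.
exact: measurable_coord.
Qed.

Lemma annealed_start (mu : probability env R) :
  annealed_law mu 0 [set z : env * path | z.2 0%N <> 0] = 0%E.
Proof.
apply/annealed0P; first exact: measurable_start_neq0.
rewrite (_ : [set w | _] = set0) ?measure0//; apply/seteqP; split=> // w /=.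
rewrite /qsec (_ : [set X | _] = ~` [set X : path | X 0%N = 0])//.
rewrite ((probability1P (qlaw w) (measurable_path_at 0 [set 0])).1 (qlaw_start w)).
by rewrite eqxx.
Qed.

Lemma qsecC E (w : env) : measurable E -> qsec (~` E) w = (1 - qsec E w)%E.
Proof.
move=> mE; rewrite /qsec (_ : [set X | _] = ~` [set X | E (w, X)])//.
rewrite probability_setC//; exact: measurable_sec.
Qed.

Lemma measurable_qsec_neq0 E : measurable E -> measurable [set w | qsec E w != 0%E].
Proof.
by move=> mE; exact: (measurable_preimage (measurable_qsec mE) (@measurable_neq0 R)).
Qed.

Lemma measurable_qsec_neq01 E : measurable E ->
  measurable [set w | qsec E w <> 0%E /\ qsec E w <> 1%E].
Proof.
move=> mE; apply: (measurable_preimage (B := [set x | x <> 0%E /\ x <> 1%E])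
  (measurable_qsec mE)).
by apply: measurableI; apply: measurableC; exact: emeasurable_set1.
Qed.

Variable mu : probability env R.
Hypothesis mu_inv : env_process_invariant mu.

Lemma annealed_step A : measurable A ->
  annealed_law mu 0 [set z | A (env_process z 1%N)] = mu A.
Proof.
move=> mA; rewrite annealedE -mu_inv//; apply: eq_integral => w _.
have m1 (e : site) : measurable ((fun X : path =>
  X 1%N) @^-1` [set e]) := measurable_path_at 1 [set e].
have mX : measurable [set X : path | A (shift (X 1%N) w)].
  exact: (measurable_path_at 1 [set e | A (shift e w)]).
rewrite /env_kernel /qsec (measure_fibers (qlaw w) m1 mX); apply: eq_esum => e _.
rewrite /env_process /= indicE.
have [Ae|nAe] := pselect (A (shift e w)).
  rewrite mem_set// mulr1 -qlaw_step; congr (qlaw w _).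
  by apply/seteqP; split=> [X []//|X /= Xe]; split=> //=; rewrite Xe.
rewrite memNset// mulr0 [X in qlaw w X](_ : _ = set0) ?measure0//.
by apply/seteqP; split=> // X [/=] + Xe; rewrite Xe.
Qed.

Lemma measurable_env_process_at n : measurable_fun setT (fun z : env * path =>
  env_process z n).
Proof. exact: (measurableT_comp (measurable_traj_at n) measurable_env_process). Qed.

Lemma integral_annealed_step (f : env -> \bar R) : measurable_fun setT f ->
  (forall w, 0 <= f w)%E ->
  (\int[annealed_law mu 0%R]_z f (env_process z 1%N) = \int[mu]_w f w)%E.
Proof.
move=> mf f0.
rewrite -(ge0_integral_pushforward (measurable_env_process_at 1) _ measurableT mf)//.
apply: (@eq_measure_integral _ _ _ _ mu
  (push_measure (annealed_law mu 0) (measurable_env_process_at 1))) => A mA _.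
exact: annealed_step.
Qed.

(** By [qsec_theta] the left-hand side is the mean of $h_E$ at the environment seen at time 1, whose
    law is again [mu]. *)
Lemma theta_preserving E : measurable E ->
  annealed_law mu 0 (theta @^-1` E) = annealed_law mu 0 E.
Proof.
move=> mE; rewrite !annealedE.
transitivity (\int[mu]_w \int[qlaw w]_X qsec E (env_process (w, X) 1%N))%E.
  by apply: eq_integral => w _; rewrite qsec_theta.
rewrite -(annealed_fubini mu (f := fun z => qsec E (env_process z 1%N))); last 2 first.
- exact: (measurableT_comp (measurable_qsec mE) (measurable_env_process_at 1)).
- by move=> z; exact: qsec_ge0.
by apply: integral_annealed_step; [exact: measurable_qsec|move=> w; exact: qsec_ge0].
Qed.

End theta.

(** * Invariant events under an invariant measure *)

Section zero_one.
Context {R : realType} {d : nat}.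
Local Notation site := (site d).
Local Notation path := (traj site).
Local Notation env := (env R d).
Variable E : set (env * path).
Hypothesis mE : measurable E.
Hypothesis E_inv : theta @^-1` E = E.

(** The Markov property at time [n]: invariance of [E] makes the event left to the future after [n]
    steps be [E] again. Induction on [n] through the first step. *)
Lemma qsec_cyl n (w : env) (s : nat -> site) :
  qlaw w ([set X | E (w, X)] `&` path_cyl n s) =
  (qlaw w (path_cyl n s) * qsec E (shift (s n) w))%E.
Proof.
have mEw v : measurable [set X | E (v, X)] by exact: measurable_sec.
elim: n w s => [|n IH] w s.
  have [s0|s0] := eqVneq (s 0%N) 0; last first.
    have c0 : qlaw w (path_cyl 0 s) = 0%E by rewrite qlaw_cyl (negbTE s0) mul0r.
    rewrite c0 mul0e; apply: null_subset c0; last exact: subIsetr.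
      by apply: measurableI; [exact: mEw|exact: measurable_path_cyl].
    exact: measurable_path_cyl.
  rewrite qlaw_cyl s0 eqxx big_ord0 mulr1 mul1e env_shift0; apply: qlaw_eq_start => //.
    by apply: measurableI; [exact: mEw|exact: measurable_path_cyl].
  move=> X X0; split=> [[]//|EX]; split=> // k; rewrite leqn0 => /eqP ->.
  by rewrite X0.
have [s0|s0] := eqVneq (s 0%N) 0; last first.
  have c0 : qlaw w (path_cyl n.+1 s) = 0%E by rewrite qlaw_cyl (negbTE s0) mul0r.
  rewrite c0 mul0e; apply: null_subset c0; last exact: subIsetr.
    by apply: measurableI; [exact: mEw|exact: measurable_path_cyl].
  exact: measurable_path_cyl.
(* The cylinder as seen after the first step, translated so as to start at 0. *)
pose t k := s k.+1 - s 1%N.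
pose E' := E `&` [set z | path_cyl n t z.2].
have mE' : measurable E'.
  apply: measurableI => //.
  exact: (measurable_preimage (f := @snd env path) measurable_snd
    (measurable_path_cyl n t)).
transitivity (qlaw w [set X | E' (theta (w, X)) /\ X 1%N = s 1%N]).
  apply: qlaw_eq_start.
  - by apply: measurableI; [exact: mEw|exact: measurable_path_cyl].
  - apply: measurableI; last exact: measurable_path_at 1 [set s 1%N].
    by apply: (measurable_sec (E := theta @^-1` E')); exact:
      (measurable_preimage measurable_theta).
  - move=> X X0; split.
      move=> [EX Xs]; split; last exact: Xs.
      split; first by move: EX; rewrite /= -{1}E_inv.
      by move=> k kn; rewrite /theta/= /t X0 subr0 Xs// Xs.
    move=> [[EX Xt] X1]; split; first by rewrite /= -E_inv.
    move=> [|k] kn; first by rewrite X0.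
    have := Xt k kn; rewrite /theta /= X0 subr0 X1 => /eqP.
    by rewrite -subr_eq0 opprB addrA subrK subr_eq0 => /eqP.
rewrite qsec_theta_path//.
rewrite (_ : qsec E' (shift (s 1%N) w) =
  qlaw (shift (s 1%N) w) ([set X | E (shift (s 1%N) w, X)] `&` path_cyl n t))//.
rewrite IH env_shiftD muleA; congr (_ * _)%E; last first.
  by rewrite /t addrC subrK.
rewrite !qlaw_cyl -EFinM s0 /t subrr eqxx !mul1r big_ord_recl s0.
congr ((_ * _)%:E); apply: eq_bigr => k _ /=.
by rewrite !(addrC (s 1%N)) !subrK.
Qed.

(** By [qsec_cyl], constancy of $h_E$ along the walk makes [E] independent of every cylinder under
    [qlaw w], hence of every event, in particular of its own complement. *)
Lemma qsec01_of_const (w : env) :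
  qlaw w [set X : path | exists j, qsec E (shift (X j - X 0%N) w) <> qsec E w] = 0%E ->
  qsec E w = 0%E \/ qsec E w = 1%E.
Proof.
set N := [set X | _] => N0.
have mEw : measurable [set X | E (w, X)] by exact: measurable_sec.
have mN : measurable N.
  rewrite (_ : N = \bigcup_j [set X : path | qsec E (shift (X j - X 0%N) w) <> qsec E w]).
    apply: bigcupT_measurable => j.
    exact: (measurable_preimage (f := fun X : path => X j - X 0%N)
      (B := [set x | qsec E (shift x w) <> qsec E w])
      (measurable_site_comp2 (fun a b => a - b) (measurable_traj_at j)
        (measurable_traj_at 0))).
  by apply/seteqP; split=> [X [j h]|X [j _ h]]; exists j.
have qf : qsec E w \is a fin_num.
  by apply: fin_num_measure.
pose h : {nonneg R} := NngNum (fine_ge0 (qsec_ge0 E w)).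
pose m1 := mrestr (qlaw w) mEw.
pose m2 := mscale h (qlaw w).
have m12 : forall A, measurable A -> m1 A = m2 A.
  apply: path_law_unique => [|n s].
    rewrite /m1 /= /mrestr setTI; apply: (@le_lt_trans _ _ 1%E); last exact: ltry.
    exact: probability_le1.
  rewrite /m1 /m2 /= /mrestr /mscale /= setIC qsec_cyl fineK// muleC.
  have mc : measurable (path_cyl n s) := measurable_path_cyl n s.
  have [c0|/eqP c0] := eqVneq (qlaw w (path_cyl n s)) 0%E; first by rewrite c0 !mule0.
  have s0 : s 0%N = 0.
    by apply/eqP; apply: contra_notT c0 => s0; rewrite qlaw_cyl (negbTE s0) mul0r.
  have [->//|ne] := pselect (qsec E (shift (s n) w) = qsec E w).
  (* A cylinder at the end of which $h_E$ has changed is contained in the null event [N]. *)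
  exfalso; apply: c0; apply: null_subset N0 => // X Xs; exists n.
  by rewrite !Xs// s0 subr0.
(* At the complement of [E] the independence reads $0=h_E(w)(1-h_E(w))$. *)
have := m12 (~` [set X | E (w, X)]) (measurableC mEw).
rewrite /m1 /m2 /= /mrestr /mscale /= setICl measure0 probability_setC// fineK//.
rewrite -/(qsec E w) => /esym/eqP; rewrite mule_eq0 => /orP[/eqP ->|]; first by left.
by rewrite sube_eq// add0e => /eqP ->; right.
Qed.

Variable mu : probability env R.
Hypothesis mu_inv : env_process_invariant mu.
Local Notation Q := (annealed_law mu 0%R).

Let h (w : env) : R := fine (qsec E w).

Let mh : measurable_fun setT h.
Proof. exact: (measurableT_comp (fine_measurable measurableT) (measurable_qsec mE)). Qed.

Let hE w : (h w)%:E = qsec E w.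
Proof. by rewrite /h fineK//; apply: fin_num_measure; exact: measurable_sec. Qed.

Let h_ge0 w : 0 <= h w. Proof. exact/fine_ge0/qsec_ge0. Qed.

Let h_le1 w : h w <= 1. Proof. by rewrite -lee_fin hE qsec_le1. Qed.

(** With $h_0,h_1$ the values at times 0 and 1, invariance of [mu] gives $E[h_1^2]=E[h_0^2]$ and
    harmonicity gives $E[h_0h_1]=E[h_0^2]$. Hence $E[(h_1-h_0)^2]=0$, all terms being finite because
    $h\le1$. *)
Lemma harmonic_variance : Q [set z | h (env_process z 1%N) <> h z.1] = 0%E.
Proof.
have m0 : measurable_fun setT (fun z : env * path => h z.1).
  exact: (measurableT_comp mh measurable_fst).
have m1 : measurable_fun setT (fun z : env * path => h (env_process z 1%N)).
  exact: (measurableT_comp mh (measurable_env_process_at 1)).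
have mD : measurable_fun setT (fun z : env * path => (h
  (env_process z 1%N) - h z.1) ^+ 2).
  by apply: measurable_funX; exact: measurable_funB.
have msq : measurable_fun setT (fun w => (h w ^+ 2)%:E).
  by apply/measurable_EFinP; exact: measurable_funX.
have sq0 : (\int[Q]_z (h z.1 ^+ 2)%:E = \int[mu]_w (h w ^+ 2)%:E)%E.
  rewrite (annealed_fubini mu (f := fun z => (h z.1 ^+ 2)%:E)).
  - by apply: eq_integral => w _ /=; rewrite integral_cst//= qlawT mule1.
  - by apply/measurable_EFinP; exact: measurable_funX.
  - by move=> z; rewrite lee_fin sqr_ge0.
have sq1 : (\int[Q]_z (h (env_process z 1%N) ^+ 2)%:E = \int[mu]_w (h w ^+ 2)%:E)%E.
  apply: (integral_annealed_step mu_inv (f := fun w => (h w ^+ 2)%:E)) => // w.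
  by rewrite lee_fin sqr_ge0.
have pr : (\int[Q]_z (h z.1 * h (env_process z 1%N))%:E = \int[mu]_w (h w ^+ 2)%:E)%E.
  rewrite (annealed_fubini mu (f := fun z => (h z.1 * h (env_process z 1%N))%:E)).
  - apply: eq_integral => w _ /=.
    under eq_integral do rewrite EFinM.
    rewrite ge0_integralZl//.
    + rewrite expr2 EFinM; congr (_ * _)%E.
      rewrite [RHS]hE -[in RHS]E_inv qsec_theta//.
      by apply: eq_integral => X _; rewrite hE.
    + apply/measurable_EFinP.
      exact: (measurable_comp_fibers (fun e => measurable_path_at 1 [set e]) (fun e =>
        h (shift e w))).
    + by move=> X _; rewrite lee_fin.
    + by rewrite lee_fin.
  - by apply/measurable_EFinP; exact: measurable_funM.
  - by move=> z; rewrite lee_fin mulr_ge0.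
have c_fin : (\int[mu]_w (h w ^+ 2)%:E < +oo)%E.
  apply: (@le_lt_trans _ _ (\int[mu]_w (cst 1%E w))%E); last first.
    by rewrite integral_cst//; move: (probability_setT mu) => /= ->; rewrite mule1 ltry.
  apply: ge0_le_integral => //.
  - by move=> w _; rewrite lee_fin sqr_ge0.
  - by move=> w _; rewrite lee_fin expr2 mulr_ile1.
pose D z := ((h (env_process z 1%N) - h z.1) ^+ 2)%:E.
have D0 z : (0 <= D z)%E by rewrite lee_fin sqr_ge0.
have mDE : measurable_fun setT D by exact/measurable_EFinP.
(* The expanded square is arranged without subtraction, so that only integrals of nonnegative
   functions are added. *)
have DI : (\int[Q]_z D z + (\int[Q]_z (h z.1 * h (env_process z 1%N))%:E +
    \int[Q]_z (h z.1 * h (env_process z 1%N))%:E) =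
    \int[Q]_z (h (env_process z 1%N) ^+ 2)%:E + \int[Q]_z (h z.1 ^+ 2)%:E)%E.
  have mM : measurable_fun setT (fun z : env * path => (h z.1 * h
    (env_process z 1%N))%:E).
    by apply/measurable_EFinP; exact: measurable_funM.
  have M0 z : (0 <= (h z.1 * h (env_process z 1%N))%:E)%E by rewrite lee_fin mulr_ge0.
  rewrite -!ge0_integralD//.
  - apply: eq_integral => z _; rewrite /D -!EFinD; congr (_%:E).
    ring.
  all: try by move=> z _; rewrite ?adde_ge0// lee_fin sqr_ge0.
  all: try by apply/measurable_EFinP; exact: measurable_funX.
  all: try by move=> z _; exact: M0.
  - by move=> z _; exact: (adde_ge0 (M0 z) (M0 z)).
  - exact: (emeasurable_funD mM mM).
set c := (\int[mu]_w (h w ^+ 2)%:E)%E in sq0 sq1 pr c_fin.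
have cf : c \is a fin_num.
  by rewrite ge0_fin_numE//; apply: integral_ge0 => w _; rewrite lee_fin sqr_ge0.
have DQ0 : (\int[Q]_z D z = 0)%E.
  have ccf : (c + c)%E \is a fin_num by rewrite fin_numD cf.
  by move: DI; rewrite pr sq0 sq1 => DI; rewrite -[LHS](addeK _ ccf) DI subee.
have := (ge0_integral_eq0P Q mDE D0).1 DQ0.
congr (Q _ = 0%E); apply/seteqP; split=> z /=.
  by rewrite /D eqe sqrf_eq0 subr_eq0 => /eqP.
by rewrite /D eqe sqrf_eq0 subr_eq0 => /eqP.
Qed.

(** The event that $h_E$ changes at the first step is null, and so are its preimages under the
    iterates of [theta]. For almost every environment the quenched walk thus never sees $h_E$
    change, and [qsec01_of_const] applies. *)
Lemma qsec01 : mu [set w | qsec E w <> 0%E /\ qsec E w <> 1%E] = 0%E.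
Proof.
have m0 : measurable_fun setT (fun z : env * path => h z.1).
  exact: (measurableT_comp mh measurable_fst).
have m1 : measurable_fun setT (fun z : env * path => h (env_process z 1%N)).
  exact: (measurableT_comp mh (measurable_env_process_at 1)).
have mneq (f g : env * path -> R) : measurable_fun setT f -> measurable_fun setT g ->
    measurable [set z | f z <> g z].
  move=> mf mg; rewrite (_ : [set z | _] = (fun z => f z - g z) @^-1` (~` [set 0])).
    apply: measurable_preimage; first exact: measurable_funB.
    by apply: measurableC; exact: measurable_set1.
  apply/seteqP; split=> z /= fg; first by move/eqP; rewrite subr_eq0 => /eqP.
  by move=> fgE; apply: fg; rewrite fgE subrr.
have mS0 := @measurable_start_neq0 R d.
pose N := [set z : env * path | h (theta z).1 <> h z.1].
have mth : measurable_fun setT (fun z : env * path => h (theta z).1).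
  exact: (measurableT_comp m0 measurable_theta).
have mN : measurable N by exact: mneq.
have QS0 := annealed_start mu.
have QN : Q N = 0%E.
  have mU : measurable ([set z | h (env_process z 1%N) <> h z.1] `|`
      [set z : env * path | z.2 0%N <> 0]) by apply: measurableU => //; exact: mneq.
  apply: (null_subset mN mU); last first.
    apply: measure_eq0U => //; first exact: mneq.
    exact: harmonic_variance.
  move=> z; rewrite /N /=; have [z0|z0] := pselect (z.2 0%N = 0); last by right.
  by rewrite -(env_process_iter_theta 1 z0) => ?; left.
pose F j := iter j theta @^-1` N.
have miter j : measurable_fun setT (iter j (@theta R d)).
  elim: j => [|j IH]; first exact: measurable_id.
  exact: (measurableT_comp measurable_theta IH).
have mF j : measurable (F j) by exact: measurable_preimage.
have QF j : Q (F j) = 0%E.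
  elim: j => [//|j <-]; rewrite -(theta_preserving mu_inv (mF j)).
  by congr (Q _); apply/funext => z; rewrite /F /preimage/= -iterSr.
have mW : measurable (\bigcup_j F j) by exact: bigcupT_measurable.
have Q0 := null_bigcup mF QF.
have mu0 := (annealed0P mu mW).1 Q0.
apply: (null_subset (measurable_qsec_neq01 mE) (measurable_qsec_neq0 mW) _ mu0).
move=> w [w0 w1] /=; apply/eqP => qW.
have [//|//] : qsec E w = 0%E \/ qsec E w = 1%E.
apply: qsec01_of_const; apply: null_subset qW.
- rewrite (_ : [set X | _] = \bigcup_j [set X : path | qsec E (shift
  (X j - X 0%N) w) <> qsec E w]).
    apply: bigcupT_measurable => j.
    exact: (measurable_preimage (f := fun X : path => X j - X 0%N)
      (B := [set x | qsec E (shift x w) <> qsec E w])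
      (measurable_site_comp2 (fun a b => a - b) (measurable_traj_at j)
        (measurable_traj_at 0))).
  by apply/seteqP; split=> [X [j ?]|X [j _ ?]]; exists j.
- exact: measurable_sec.
move=> X [j Xj] /=; apply: contrapT => nF; apply: Xj.
have C i : h (iter i theta (w, X)).1 = h w.
  elim: i => [//|i IH]; rewrite -IH; apply: contrapT => hne.
  by apply: nF; exists i.
by have := C j; rewrite iter_theta /= -!hE => ->.
Qed.

End zero_one.

(** * Ergodic theory *)

Section ergodic_theory.
Context {R : realType} dT (T : measurableType dT) (Q : probability T R).

Definition bounded_measurable (f : T -> R) :=
  measurable_fun setT f /\ exists C, forall z, `|f z| <= C.
Local Notation bmeas := bounded_measurable.

Lemma bmeas_integrable f : bmeas f -> Q.-integrable setT (EFin \o f).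
Proof.
move=> [mf [C fC]]; apply: measurable_bounded_integrable => //.
  by apply: (@le_lt_trans _ _ 1%E); [exact: probability_le1|exact: ltry].
exists C; split; first exact: num_real.
by move=> M CM z _; exact: le_trans (fC z) (ltW CM).
Qed.

Lemma bmeas_cst c : bmeas (fun=> c).
Proof. by split; [exact: measurable_cst|exists `|c|]. Qed.

Lemma bmeasD f g : bmeas f -> bmeas g -> bmeas (fun z => f z + g z).
Proof.
move=> [mf [C fC]] [mg [D gD]]; split; first exact: measurable_funD.
by exists (C + D) => z; apply: le_trans (ler_normD _ _) _; exact: lerD.
Qed.

Lemma bmeasN f : bmeas f -> bmeas (fun z => - f z).
Proof.
move=> [mf [C fC]]; split; first exact: measurableT_comp.
by exists C => z; rewrite normrN.
Qed.

Lemma bmeasB f g : bmeas f -> bmeas g -> bmeas (fun z => f z - g z).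
Proof. by move=> mf mg; apply: bmeasD => //; exact: bmeasN. Qed.

Lemma bmeasM f g : bmeas f -> bmeas g -> bmeas (fun z => f z * g z).
Proof.
move=> [mf [C fC]] [mg [D gD]]; split; first exact: measurable_funM.
by exists (C * D) => z; rewrite normrM ler_pM.
Qed.

Lemma bmeas_indic A : measurable A -> bmeas (\1_A : T -> R).
Proof.
move=> mA; split; first exact: measurable_indic.
by exists 1 => z; rewrite indicE; case: (_ \in _); rewrite ?normr1// normr0.
Qed.

Lemma Rintegral_indic A : measurable A -> \int[Q]_z (\1_A z : R) = fine (Q A).
Proof. by move=> mA; rewrite /Rintegral integral_indic// setIT. Qed.

Lemma Rintegral_bounded_cvg (f_ : nat -> T -> R) (f : T -> R) C :
  (forall n, measurable_fun setT (f_ n)) -> (forall n z, `|f_ n z| <= C) ->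
  (forall z, f_ n z @[n --> \oo] --> f z) ->
  \int[Q]_z f_ n z @[n --> \oo] --> \int[Q]_z f z.
Proof.
move=> mf fC cf.
have mlim : measurable_fun setT f.
  by apply: (measurable_fun_cvg mf) => z _; exact: cf.
have iC : Q.-integrable setT (EFin \o cst C) by exact: bmeas_integrable (bmeas_cst C).
have bf : bmeas f.
  split=> //; exists C => z;
    have h : `|f_ n z| @[n --> \oo] --> `|f z| by exact: cvg_norm (cf z).
  rewrite -(cvg_lim _ h)//; apply: limr_le; first exact: (cvgP _ h).
  by apply: nearW => n; exact: fC.
have fi : (\int[Q]_z (f z)%:E)%E \is a fin_num.
  exact: (integrable_fin_num measurableT (bmeas_integrable bf)).
have dc : (\int[Q]_z (f_ n z)%:E)%E @[n --> \oo] --> (\int[Q]_z (f z)%:E)%E.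
  apply: (dominated_cvg measurableT (g := EFin \o cst C)) => //.
  - by move=> n; exact/measurable_EFinP.
  - by move=> z _; apply: cvg_EFin; [exact: nearW|exact: cf].
  - by move=> n z _; rewrite /= lee_fin.
by apply: fine_cvg; rewrite /Rintegral fineK.
Qed.

Lemma Rintegral_ae_eq (f g : T -> R) (N : set T) : bmeas f -> bmeas g ->
  measurable N -> Q N = 0%E -> (forall z, ~ N z -> f z = g z) ->
  \int[Q]_z f z = \int[Q]_z g z.
Proof.
move=> bf bg mN N0 fg; congr fine; apply: ae_eq_integral => //.
- by apply/measurable_EFinP; case: bf.
- by apply/measurable_EFinP; case: bg.
exists N; split => // z /= ne; apply: contrapT => nN; apply: ne => _.
by rewrite fg.
Qed.

Lemma Rintegral_bounded_ae_cvg (f_ : nat -> T -> R) (c C : R) (N : set T) :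
  (forall n, measurable_fun setT (f_ n)) -> (forall n z, `|f_ n z| <= C) ->
  measurable N -> Q N = 0%E ->
  (forall z, ~ N z -> f_ n z @[n --> \oo] --> c) ->
  \int[Q]_z f_ n z @[n --> \oo] --> c.
Proof.
move=> mf fC mN N0 cf.
have mNC := measurableC mN.
have bf n : bmeas (f_ n) by split=> //; exists C.
have bi (f : T -> R) : bmeas f -> bmeas (fun z => f z * \1_(~` N) z).
  by move=> ?; apply: bmeasM => //; exact: bmeas_indic.
have ae (f : T -> R) : bmeas f -> \int[Q]_z (f z * \1_(~` N) z) = \int[Q]_z f z.
  move=> bff; apply: (Rintegral_ae_eq (bi _ bff) bff mN N0) => z nN.
  by rewrite indicE mem_set// mulr1.
have cE : \int[Q]_z (c * \1_(~` N) z) = c.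
  by rewrite (ae (fun=> c)) ?Rintegral_cst//= ?probability_setT ?mulr1//;
    exact: bmeas_cst.
rewrite -[X in _ --> X]cE; under eq_fun do rewrite -ae//.
apply: (@Rintegral_bounded_cvg _ _ C).
- by move=> n; case: (bi _ (bf n)).
- move=> n z; rewrite normrM indicE; case: (_ \in _); first by rewrite normr1 mulr1.
  by rewrite normr0 mulr0 (le_trans _ (fC n z)).
- move=> z; rewrite indicE; have [Nz|nN] := pselect (N z).
    by rewrite memNset/=; [rewrite mulr0; under eq_fun do rewrite mulr0;
      exact: cvg_cst|apply].
  by rewrite mem_set//= mulr1; under eq_fun do rewrite mulr1; exact: cf.
Qed.

Lemma measurable_cvg_set (u : nat -> T -> R) (c : R) :
  (forall n, measurable_fun setT (u n)) ->
  measurable [set z | u n z @[n --> \oo] --> c].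
Proof.
move=> mu.
rewrite (_ : [set z | _] = \bigcap_(k in [set: nat]) \bigcup_N
    \bigcap_(n in [set n | (N <= n)%N]) [set z | `|c - u n z| <= k.+1%:R^-1]).
  apply: bigcap_measurableType => k _; apply: bigcupT_measurable => N.
  apply: bigcap_measurableType => n _.
  rewrite (_ : [set z | _] = (fun z => `|c - u n z|) @^-1` `]-oo, k.+1%:R^-1]%classic).
    apply: (measurable_preimage (f := fun z => `|c - u n z|)); last exact: measurable_itv.
    by apply: measurableT_comp => //; exact: measurable_funB.
  by apply/seteqP; split=> z; rewrite /= in_itv.
apply/seteqP; split=> z.
  move=> /cvgrPdist_le h k _; have [|N _ hN] := h (k.+1%:R^-1); first by rewrite invr_gt0.
  by exists N => // n /hN.
move=> h; apply/cvgrPdist_le => e e0.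
have [k ke] : exists k : nat, k.+1%:R^-1 <= e.
  exists (Num.truncn e^-1); rewrite invf_ple ?posrE//; exact/ltW/truncnS_gt.
by have [N _ hN] := h k I; exists N => // n Nn; apply: le_trans ke; exact: hN.
Qed.

Lemma measurable_cvgy_set (u : nat -> T -> R) : (forall n, measurable_fun setT (u n)) ->
  measurable [set z | u n z @[n --> \oo] --> +oo].
Proof.
move=> mu.
rewrite (_ : [set z | _] = \bigcap_(k in [set: nat]) \bigcup_N
    \bigcap_(n in [set n | (N <= n)%N]) [set z | k%:R <= u n z]).
  apply: bigcap_measurableType => k _; apply: bigcupT_measurable => N.
  apply: bigcap_measurableType => n _.
  rewrite (_ : [set z | _] = u n @^-1` `[k%:R, +oo[%classic).
    by apply: measurable_preimage => //; exact: measurable_itv.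
  by apply/seteqP; split=> z; rewrite /= in_itv /= andbT.
apply/seteqP; split=> z.
  move=> /cvgryPge h k _; have [N _ hN] := h k%:R.
  by exists N => // n /hN.
move=> h; apply/cvgryPge => A.
have [K AK] := nat_upper_bound A; have [N _ hN] := h K I; exists N => // n Nn.
exact: le_trans AK (hN n Nn).
Qed.

(** * Maximal inequality and invariant sets of a measure-preserving map *)

Variable theta : T -> T.
Hypothesis mtheta : measurable_fun setT theta.
Hypothesis theta_pres : forall A, measurable A -> Q (theta @^-1` A) = Q A.

Lemma bmeas_theta f : bmeas f -> bmeas (f \o theta).
Proof.
by move=> [mf [C fC]]; split; [exact: measurableT_comp|exists C => z; exact: fC].
Qed.

Lemma Rintegral_theta f : bmeas f -> \int[Q]_z f (theta z) = \int[Q]_z f z.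
Proof.
move=> bf; congr fine.
transitivity (\int[pushforward Q theta]_z (f z)%:E)%E.
  rewrite (integral_pushforward mtheta (mu := Q) (f := EFin \o f) (D := setT))//.
    by apply/measurable_EFinP; case: bf.
  exact: bmeas_integrable (bmeas_theta bf).
apply: (@eq_measure_integral _ _ _ _ Q (push_measure Q mtheta)) => A mA _.
exact: theta_pres.
Qed.

Definition birkhoff_sum (f : T -> R) n z : R := \sum_(j < n) f (iter j theta z).
Local Notation bsum := birkhoff_sum.

Lemma birkhoff_sumS f n z : bsum f n.+1 z = f z + bsum f n (theta z).
Proof.
by rewrite /bsum big_ord_recl; congr (_ + _); apply: eq_bigr => j _; rewrite -iterSr.
Qed.

Lemma measurable_iter j : measurable_fun setT (iter j theta).
Proof.
elim: j => [|j IH]; first exact: measurable_id.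
exact: (measurableT_comp mtheta IH).
Qed.

Lemma measurable_birkhoff_sum f n : measurable_fun setT f -> measurable_fun setT
  (bsum f n).
Proof.
move=> mf; apply: measurable_sum => j; exact: (measurableT_comp mf (measurable_iter j)).
Qed.

(* The maximum of [0, S_1, ..., S_n], which satisfies this recursion. *)
Fixpoint running_max (f : T -> R) n z : R :=
  if n is m.+1 then Num.max 0 (f z + running_max f m (theta z)) else 0.

Lemma running_max_ge0 f n z : 0 <= running_max f n z.
Proof. by case: n => [|n] //=; rewrite le_max lexx. Qed.

Lemma running_maxS f n z : running_max f n z <= running_max f n.+1 z.
Proof.
elim: n z => [|n IH] z; first exact: running_max_ge0.
by rewrite [leLHS]/= [leRHS]/=; rewrite ge_max !le_max lexx /= lerD2l IH orbT.
Qed.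

Lemma le_running_max f n z : bsum f n z <= running_max f n z.
Proof.
elim: n z => [|n IH] z; first by rewrite /bsum big_ord0.
by rewrite birkhoff_sumS /= le_max lerD2l IH orbT.
Qed.

Lemma bmeas_running_max f n : bmeas f -> bmeas (running_max f n).
Proof.
move=> bf; elim: n => [|n IH]; first exact: bmeas_cst.
have [mg [C gC]] := bmeasD bf (bmeas_theta IH).
split; first exact: measurable_maxr.
exists C => z; rewrite /= ger0_norm ?le_max ?lexx// ge_max.
by rewrite (le_trans _ (gC z)) ?normr_ge0// (le_trans _ (gC z)) ?ler_norm.
Qed.

(* Garsia: [running_max (n+1) <= f * 1_(running_max (n+1) > 0) + running_max n \o theta],
   and the running maxima have the same integral as their translates. *)
Lemma maximal_ergodic f : bmeas f ->
  (forall z, f z != 0 -> exists n, 0 < bsum f n z) -> 0 <= \int[Q]_z f z.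
Proof.
move=> bf fpos.
pose p n := [set z | 0 < running_max f n z].
have mp n : measurable (p n).
  have [mr _] := bmeas_running_max n bf.
  rewrite /p (_ : [set z | _] = running_max f n @^-1` `]0, +oo[%classic).
    by rewrite -[X in measurable X]setTI; apply: mr => //; exact: measurable_itv.
  by apply/seteqP; split=> z; rewrite /= in_itv /= andbT.
pose g n z : R := f z * \1_(p n.+1) z.
have bg n : bmeas (g n) by apply: bmeasM => //; exact: bmeas_indic.
have g0 n : 0 <= \int[Q]_z g n z.
  have br m := bmeas_running_max m bf.
  rewrite -(lerD2r (\int[Q]_z running_max f n z)) add0r.
  rewrite -[in leRHS](Rintegral_theta (br n)).
  rewrite -RintegralD//; [|exact: bmeas_integrable|exact: bmeas_integrable
    (bmeas_theta (br n))].
  apply: (@le_trans _ _ (\int[Q]_z running_max f n.+1 z)).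
    apply: le_Rintegral => //; [exact: bmeas_integrable|exact: bmeas_integrable|].
    by move=> z _; exact: running_maxS.
  apply: le_Rintegral => //; [exact: bmeas_integrable| |].
    by apply: bmeas_integrable; apply: bmeasD => //; exact: bmeas_theta.
  move=> z _; rewrite /g indicE; have [zp|zp] := pselect (p n.+1 z).
    rewrite mem_set// mulr1; move: zp; rewrite /p /= /Num.max; case: ifP => //.
    by rewrite ltxx.
  rewrite memNset// mulr0 add0r; apply: le_trans (running_max_ge0 f n (theta z)).
  by rewrite leNgt; apply/negP.
have cg : \int[Q]_z g n z @[n --> \oo] --> \int[Q]_z f z.
  have [mf [C fC]] := bf.
  apply: (@Rintegral_bounded_cvg _ _ C).
  - by move=> n; case: (bg n).
  - move=> n z; rewrite /g normrM indicE; case: (_ \in _); first by rewrite normr1 mulr1.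
    by rewrite normr0 mulr0 (le_trans _ (fC z)).
  (* The sequence is eventually constant at each point: where $f\ne0$ some sum is positive and the
     running maxima increase, so the indicator is 1 from then on. *)
  - move=> z; apply: cvg_near_cst.
    have [fz|/fpos[m zm]] := eqVneq (f z) 0.
      by apply: nearW => n; rewrite /g fz mul0r.
    exists m => // n /= mn; rewrite /g indicE mem_set ?mulr1//.
    rewrite /p /=; apply: (lt_le_trans zm); apply: (le_trans (le_running_max _ _ _)).
    have hom : {homo (fun k => running_max f k z) : a b / (a <= b)%N >-> a <= b}.
      apply: homo_leq; [exact: lexx|exact: le_trans|].
      by move=> k; exact: running_maxS.
    exact: (hom m n.+1 (leqW mn)).
rewrite -(cvg_lim _ cg)//; apply: limr_ge; first exact: (cvgP _ cg).
by apply: nearW => n; exact: g0.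
Qed.

(* Plays the role of the event [limsup S_n / n > 0]; no limit is involved, which
   makes its invariance under [theta] immediate. *)
Definition unbounded_sums (f : T -> R) : set T :=
  [set z | forall K : nat, exists n, K%:R <= bsum f n z].

Lemma measurable_unbounded_sums f : measurable_fun setT f -> measurable
  (unbounded_sums f).
Proof.
move=> mf; rewrite (_ : unbounded_sums f =
  \bigcap_(K in [set: nat]) \bigcup_n [set z | K%:R <= bsum f n z]).
  apply: bigcap_measurableType => K _; apply: bigcupT_measurable => n.
  rewrite (_ : [set z | _] = bsum f n @^-1` `[K%:R, +oo[%classic).
    rewrite -[X in measurable X]setTI.
    by apply: (measurable_birkhoff_sum n mf) => //; exact: measurable_itv.
  by apply/seteqP; split=> z; rewrite /= in_itv /= andbT.
apply/seteqP; split=> z h K => [_|]; first by have [n] := h K; exists n.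
by have [n _] := h K I; exists n.
Qed.

Lemma unbounded_sums_theta f : theta @^-1` unbounded_sums f = unbounded_sums f.
Proof.
have le_abs (x : R) := nat_upper_bound `|x|.
apply/seteqP; split=> z h K.
  have [k kz] := le_abs (f z); have [n nz] := h (K + k)%N.
  exists n.+1; rewrite birkhoff_sumS; move: nz kz; rewrite natrD ler_norml.
  by move: (bsum _ _ _) => b h1 /andP[h2 h3]; lra.
(* The additional 1 excludes the empty sum, so that a first term can be removed. *)
have [k kz] := le_abs (f z); have [[|n] nz] := h (K + k).+1.
  by move: nz; rewrite /bsum big_ord0 lern0.
exists n; move: nz kz; rewrite birkhoff_sumS -natr1 natrD ler_norml.
by move: (bsum _ _ _) => b h1 /andP[h2 h3]; lra.
Qed.

Lemma unbounded_sums_gt0 f z : unbounded_sums f z -> exists n, 0 < bsum f n z.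
Proof. by move=> /(_ 1%N)[n h]; exists n; exact: lt_le_trans h. Qed.

Lemma birkhoff_sum_indic f A n z : theta @^-1` A = A ->
  bsum (fun z => f z * \1_A z) n z = bsum f n z * \1_A z.
Proof.
move=> A_inv; rewrite /bsum big_distrl /=; apply: eq_bigr => j _; congr (_ * _).
case: j => j _ /=; elim: j => [//|j IH] /=; rewrite -IH !indicE; congr (nat_of_bool _)%:R.
by rewrite -[in RHS]A_inv; apply/idP/idP; rewrite !inE.
Qed.

(** With $U$ the unbounded-sums event, $f 1_{U\cap A}$ vanishes off $U\cap A$, and on this invariant
    set its sums are those of $f$, which become positive. The maximal ergodic theorem applies to it,
    and $U$ has full measure. *)
Lemma maximal_ergodic_on f A : bmeas f -> measurable A -> theta @^-1` A = A ->
  Q (~` unbounded_sums f) = 0%E -> 0 <= \int[Q]_z (f z * \1_A z).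
Proof.
move=> bf mA A_inv U1.
have mU : measurable (unbounded_sums f) by apply: measurable_unbounded_sums; case: bf.
set U := unbounded_sums f in mU U1 *.
have UA_inv : theta @^-1` (U `&` A) = U `&` A.
  by rewrite preimage_setI A_inv unbounded_sums_theta.
have mUA : measurable (U `&` A) by exact: measurableI.
have h : 0 <= \int[Q]_z (f z * \1_(U `&` A) z).
  apply: maximal_ergodic; first by apply: bmeasM => //; exact: bmeas_indic.
  move=> z; have [zUA|zUA] := pselect ((U `&` A) z); last first.
    by rewrite indicE memNset// mulr0 eqxx.
  have [n nz] := unbounded_sums_gt0 zUA.1; move=> _; exists n.
  by rewrite birkhoff_sum_indic// indicE mem_set// mulr1.
suff -> : \int[Q]_z (f z * \1_A z) = \int[Q]_z (f z * \1_(U `&` A) z) by [].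
congr fine; apply: ae_eq_integral => //.
- by apply/measurable_EFinP; case: (bmeasM bf (bmeas_indic mA)).
- by apply/measurable_EFinP; case: (bmeasM bf (bmeas_indic mUA)).
exists (~` U); split => //; first exact: measurableC.
move=> z /= ne Uz; apply: ne => _; congr ((_ * _)%:E).
rewrite !indicE; congr (nat_of_bool _)%:R.
apply/idP/idP => /set_mem zA; apply/mem_set; first by split.
by case: zA.
Qed.

(* According to whether the sums of [f - c] are almost surely unbounded above or
   not, the mean of [f] over any invariant set [A] is at least or at most
   [c * Q A]. *)
Lemma zero_one_mean_indep f : bmeas f ->
  (forall c, Q (unbounded_sums (fun z => f z - c)) = 0%E \/
             Q (~` unbounded_sums (fun z => f z - c)) = 0%E) ->
  forall A, measurable A -> theta @^-1` A = A ->
  \int[Q]_z (f z * \1_A z) = \int[Q]_z f z * fine (Q A).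
Proof.
move=> bf f01 A mA A_inv.
have bfc c : bmeas (fun z => f z - c) by apply: bmeasB => //; exact: bmeas_cst.
have bcf c : bmeas (fun z => c - f z) by apply: bmeasB => //; exact: bmeas_cst.
have I1 : \int[Q]_z ((fun z => f z * \1_setT z) z) = \int[Q]_z f z.
  by apply: eq_Rintegral => z _; rewrite indicT mulr1.
have sub B c : measurable B -> \int[Q]_z ((f z - c) * \1_B z) =
    \int[Q]_z (f z * \1_B z) - c * fine (Q B).
  move=> mB; rewrite -(Rintegral_indic mB) -RintegralZl//; last first.
    exact: bmeas_integrable (bmeas_indic mB).
  rewrite -RintegralB//; last 2 first.
  - exact: bmeas_integrable (bmeasM bf (bmeas_indic mB)).
  - exact: bmeas_integrable (bmeasM (bmeas_cst c) (bmeas_indic mB)).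
  by apply: eq_Rintegral => z _; rewrite mulrBl.
have bus c B : measurable B -> \int[Q]_z ((c - f z) * \1_B z) =
    c * fine (Q B) - \int[Q]_z (f z * \1_B z).
  move=> mB; rewrite -[RHS]opprB -sub// -mulN1r -RintegralZl//; last first.
    exact: bmeas_integrable (bmeasM (bfc c) (bmeas_indic mB)).
  by apply: eq_Rintegral => z _; rewrite mulN1r -mulNr opprB.
have QT : fine (Q setT) = 1 by rewrite probability_setT.
set m := \int[Q]_z f z.
have alt c : (forall B, measurable B -> theta @^-1` B = B ->
      c * fine (Q B) <= \int[Q]_z (f z * \1_B z)) \/
    (forall B c', c < c' -> measurable B -> theta @^-1` B = B ->
      \int[Q]_z (f z * \1_B z) <= c' * fine (Q B)).
  have [U0|U1] := f01 c; last first.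
    left => B mB B_inv; rewrite -subr_ge0 -sub//.
    exact: (maximal_ergodic_on (bfc c)).
  right => B c' cc' mB B_inv; rewrite -subr_ge0 -bus//.
  apply: maximal_ergodic_on => //.
  have mU g : bmeas g -> measurable (unbounded_sums g).
    by move=> [mg _]; exact: measurable_unbounded_sums.
  apply: null_subset U0; [exact: measurableC (mU _ (bcf c'))|exact: mU (bfc c)|].
  (* If the sums of $f-c$ stay below $K'$, then those of $c'-f$ exceed $n(c'-c)-K'$ and are
     unbounded above. *)
  move=> z nU; apply: contrapT => nU'; apply: nU => K.
  have [K' K'z] : exists K' : nat, forall n, bsum (fun z => f z - c) n z < K'%:R.
    apply: contrapT => h; apply: nU' => K'; apply: contrapT => h'.
    apply: h; exists K' => n; rewrite ltNge; apply/negP => h''.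
    by apply: h'; exists n.
  have sumE n : bsum (fun z => c' - f z) n z = (c' - c) *+ n - bsum (fun z =>
    f z - c) n z.
    rewrite /bsum -[X in _ *+ X](card_ord n) -sumr_const -sumrB.
    by apply: eq_bigr => j _; ring.
  have [n nK] : exists n : nat, (K + K')%:R / (c' - c) <= n%:R.
    exists (Num.truncn ((K + K')%:R / (c' - c))).+1; exact/ltW/truncnS_gt.
  exists n; rewrite sumE lerBrDr; move: nK; rewrite ler_pdivrMr ?subr_gt0//.
  rewrite natrD mulr_natl; apply: le_trans; rewrite lerD2l; exact/ltW.
(* The second alternative fails for $c<m$: with $B$ the whole space it would give $m\le c'$ for some
   $c'<m$. *)
have lowA c : c < m -> c * fine (Q A) <= \int[Q]_z (f z * \1_A z).
  move=> cm; have [|h] := alt c; first exact.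
  have [c' /andP[h1 h2]] : exists c', c < c' < m.
    by exists ((c + m) / 2); rewrite midf_lt ?midf_lt//=.
  have := h setT c' h1 measurableT (preimage_setT _); rewrite I1 QT mulr1.
  by rewrite leNgt h2.
have uppA c : m < c -> \int[Q]_z (f z * \1_A z) <= c * fine (Q A).
  move=> mc; have [c' /andP[h1 h2]] : exists c', m < c' < c.
    by exists ((m + c) / 2); rewrite midf_lt ?midf_lt//=.
  have [h|h] := alt c'; last exact: h.
  have := h setT measurableT (preimage_setT _); rewrite I1 QT mulr1.
  by rewrite leNgt h1.
have q0 : 0 <= fine (Q A) by exact: fine_ge0.
have q1 : fine (Q A) <= 1.
  by rewrite -lee_fin fineK ?fin_num_measure//; exact: probability_le1.
apply/eqP; rewrite eq_le; apply/andP; split; apply/ler_addgt0Pr => e e0.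
  have := uppA (m + e); rewrite ltrDl => /(_ e0) /le_trans; apply.
  by rewrite mulrDl lerD2l ler_piMr// ltW.
have := lowA (m - e); rewrite ltrBlDr ltrDl => /(_ e0); rewrite mulrBl lerBlDr =>
  /le_trans; apply.
by rewrite lerD2l ler_piMr// ltW.
Qed.

(** * Birkhoff's theorem for an ergodic map *)

Hypothesis ergodic : forall A, measurable A -> theta @^-1` A = A ->
  Q A = 0%E \/ Q (~` A) = 0%E.

Definition birkhoff_cvg (f : T -> R) (c : R) : set T :=
  [set z | bsum f n z / n%:R @[n --> \oo] --> c].

(** Otherwise, by ergodicity, the sums are almost surely unbounded above, and the maximal ergodic
    theorem makes the integral nonnegative. *)
Lemma unbounded_sums_null f : bmeas f -> \int[Q]_z f z < 0 -> Q (unbounded_sums f) = 0%E.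
Proof.
move=> bf f0; have mU := measurable_unbounded_sums bf.1.
have [//|U1] := ergodic mU (unbounded_sums_theta f).
have := maximal_ergodic_on bf measurableT (preimage_setT _) U1.
rewrite leNgt => /negP[]; rewrite (_ : \int[Q]_z _ = \int[Q]_z f z)//.
by apply: eq_Rintegral => z _; rewrite indicT mulr1.
Qed.

Lemma birkhoff_sumD f g n z : bsum (fun z => f z + g z) n z = bsum f n z + bsum g n z.
Proof. by rewrite /bsum big_split. Qed.

Lemma birkhoff_sum_cst (c : R) n z : bsum (fun=> c) n z = n%:R * c.
Proof. by rewrite /bsum sumr_const card_ord mulr_natl. Qed.

Lemma birkhoff_sumN f n z : bsum (fun z => - f z) n z = - bsum f n z.
Proof. by rewrite /bsum sumrN. Qed.

Lemma Rintegral_prob_cst c : \int[Q]_z c = c.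
Proof. by rewrite Rintegral_cst//= probability_setT mulr1. Qed.

Lemma measurable_birkhoff_cvg f c : measurable_fun setT f -> measurable
  (birkhoff_cvg f c).
Proof.
move=> mf; apply: (measurable_cvg_set (u := fun n z => bsum f n z / n%:R)) => n.
by apply: measurable_funM => //; exact: measurable_birkhoff_sum.
Qed.

(** For every $k$, both $f-b-1/(k+1)$ and $b-1/(k+1)-f$ have negative mean, so their sums are almost
    surely bounded above. This confines $S_n-nb$ to within $n/(k+1)$ plus a constant. *)
Lemma birkhoff_ergodic f : bmeas f -> Q (~` birkhoff_cvg f (\int[Q]_z f z)) = 0%E.
Proof.
move=> bf; set b := \int[Q]_z f z.
pose up k := unbounded_sums (fun z => f z - (b + k.+1%:R^-1)).
pose dn k := unbounded_sums (fun z => (b - k.+1%:R^-1) - f z).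
have bup k : bmeas (fun z => f z - (b + k.+1%:R^-1)) by apply: bmeasB => //;
  exact: bmeas_cst.
have bdn k : bmeas (fun z => (b - k.+1%:R^-1) - f z) by apply: bmeasB => //;
  exact: bmeas_cst.
have mup k : measurable (up k) by apply: measurable_unbounded_sums; case: (bup k).
have mdn k : measurable (dn k) by apply: measurable_unbounded_sums; case: (bdn k).
have pk k : 0 < k.+1%:R^-1 :> R by rewrite invr_gt0.
have up0 k : Q (up k) = 0%E.
  apply: unbounded_sums_null => //; rewrite RintegralB//;
    [|exact: bmeas_integrable|exact: bmeas_integrable (bmeas_cst _)].
  by rewrite Rintegral_prob_cst -/b opprD addrA subrr add0r oppr_lt0.
have dn0 k : Q (dn k) = 0%E.
  apply: unbounded_sums_null => //; rewrite RintegralB//; [|exact: bmeas_integrable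
    (bmeas_cst _)|exact: bmeas_integrable].
  by rewrite Rintegral_prob_cst -/b addrAC subrr add0r oppr_lt0.
have mUD : measurable (\bigcup_k (up k `|` dn k)).
  by apply: bigcupT_measurable => k; exact: measurableU.
have N0 : Q (\bigcup_k (up k `|` dn k)) = 0%E.
  by apply: null_bigcup => k; [exact: measurableU|exact: (measure_eq0U (mup k) (mdn k)
    (up0 k) (dn0 k))].
have mC : measurable (birkhoff_cvg f b) by apply: measurable_birkhoff_cvg; case: bf.
apply: null_subset N0 => //; first exact: measurableC.
move=> z nz; apply: contrapT => nUD; apply: nz.
have bnd g : ~ unbounded_sums g z -> exists K : nat, forall n, bsum g n z <= K%:R.
  move=> nU; apply: contrapT => h; apply: nU => K; apply: contrapT => h'.
  apply: h; exists K => n; apply: contrapT => /negP; rewrite -ltNge => h''.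
  by apply: h'; exists n; exact: ltW.
apply/cvgrPdist_le => e e0.
have e2 : 0 < e / 2 by rewrite divr_gt0.
have [k ke] : exists k : nat, k.+1%:R^-1 <= e / 2.
  exists (Num.truncn (e / 2)^-1); rewrite invf_ple ?posrE//; exact/ltW/truncnS_gt.
have [K1 K1P] : exists K : nat, forall n, bsum (fun z => f z -
  (b + k.+1%:R^-1)) n z <= K%:R.
  by apply: bnd => h; apply: nUD; exists k => //; left.
have [K2 K2P] : exists K : nat, forall n, bsum (fun z =>
  (b - k.+1%:R^-1) - f z) n z <= K%:R.
  by apply: bnd => h; apply: nUD; exists k => //; right.
(* From this index on $K_1+K_2\le n\varepsilon/2$; the other half of $\varepsilon$ covers
   $1/(k+1)$. *)
exists (Num.truncn ((K1 + K2)%:R / (e / 2))).+1 => // n /= nN.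
have n0 : 0 < n%:R :> R by rewrite ltr0n (leq_trans _ nN).
have nK : (K1 + K2)%:R <= (e / 2) * n%:R.
  rewrite mulrC -ler_pdivrMr//; apply: (le_trans (ltW (truncnS_gt _))).
  by rewrite ler_nat.
have E1 := K1P n; have E2 := K2P n.
rewrite birkhoff_sumD birkhoff_sum_cst in E1.
rewrite birkhoff_sumD birkhoff_sumN birkhoff_sum_cst in E2.
have kn : n%:R * k.+1%:R^-1 <= n%:R * (e / 2) by rewrite ler_pM2l.
have K10 : 0 <= K1%:R :> R by []. have K20 : 0 <= K2%:R :> R by [].
rewrite natrD in nK.
rewrite -[X in `|X - _|](mulfK (lt0r_neq0 n0)) -mulrBl normrM.
rewrite [X in _ * X]ger0_norm ?invr_ge0//.
rewrite ler_pdivrMr// ler_norml.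
move: (bsum _ _ _) (k.+1%:R^-1) E1 E2 kn => s p E1 E2 kn.
apply/andP; split; nra.
Qed.

End ergodic_theory.

(** * Events seen from above a level *)

Section locality.
Context {R : realType} {d : nat}.
Local Notation site := (site d).
Local Notation path := (traj site).
Local Notation env := (env R d).
Variable l : 'rV[R]_d.
Local Notation height := (height l).
Local Notation above := (above l).

Lemma heightD (x y : site) : height (x + y) = height x + height y.
Proof.
rewrite /height /dot -big_split; apply: eq_bigr => k _ /=.
by rewrite -mulrDl !mxE intrD.
Qed.

Lemma heightN (x : site) : height (- x) = - height x.
Proof.
rewrite /height /dot -sumrN; apply: eq_bigr => k _ /=.
by rewrite -mulNr !mxE intrN.
Qed.

Lemma height0 : height 0 = 0.
Proof. by rewrite -[0]subr0 heightD heightN subrr. Qed.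

Section cut.
Variables (t : R) (w : env).

Let cut_prob (x j : site) : R := if - t <= height x then w x j else (point : env) x j.

Let cut_ge0 i j : 0 <= cut_prob i j.
Proof. by rewrite /cut_prob; case: ifP => _; exact: env_ge0. Qed.

Let cut_le1 i j : cut_prob i j <= 1.
Proof. by rewrite /cut_prob; case: ifP => _; exact: env_le1. Qed.

Let cut_sum1 i : (\esum_(j in [set: site]) (cut_prob i j)%:E = 1)%E.
Proof.
rewrite -(env_sum1 (if - t <= height i then w else point) i).
by apply: eq_esum => j _; rewrite /cut_prob; case: ifP.
Qed.

(* The rows below level [-t] are replaced by those of a fixed environment, so
   that being measurable with respect to the rows above level [-t] amounts to
   being measurable and invariant under [cut_env t]. *)
Definition cut_env : env := Env cut_ge0 cut_le1 cut_sum1.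

Lemma cutE x j : cut_env x j = if - t <= height x then w x j else (point : env) x j.
Proof. by []. Qed.

End cut.

Lemma agree_cut t T w : t <= T -> agree_above l t w (cut_env T w).
Proof.
move=> tT x tx j; have Tx : - T <= height x by apply: le_trans tx; rewrite lerN2.
by rewrite cutE Tx.
Qed.

(** The rows above level $-t$ seen from a site of height at least $-s$ are among the rows above
    level $-(t+s)$ seen from the origin. *)
Lemma cut_shift_cut t s T x w : t + s <= T -> - s <= height x ->
  cut_env t (shift x (cut_env T w)) = cut_env t (shift x w).
Proof.
move=> tsT sx; apply: env_eq => i j; rewrite !cutE; case: ifP => // ti /=.
have Txi : - T <= height (x + i).
  by rewrite heightD (le_trans (_ : _ <= - (t + s))) ?lerN2// opprD addrC lerD.
by rewrite Txi.
Qed.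

Lemma cut_cut t T w : t <= T -> cut_env t (cut_env T w) = cut_env t w.
Proof.
move=> tT; have := @cut_shift_cut t 0 T 0 w; rewrite !env_shift0; apply.
  by rewrite addr0.
by rewrite oppr0 height0.
Qed.

Definition sigma_rows t : set (set env) :=
  <<s @env_cylinders R d [set x | - t <= height x] >>.

(** Invariance under [cut_env t] holds for the generators and is stable under the operations of a
    sigma-field. Conversely [cut_env t] is measurable from [sigma_rows t], and an invariant set is
    its own preimage under it. *)
Lemma sigma_rowsP t (A : set env) : sigma_rows t A <-> measurable A /\ cut_env t @^-1`
  A = A.
Proof.
split=> [tA|[mA <-]].
  split.
    move: tA; apply: smallest_sub; first exact: sigma_algebra_measurable.
    by move=> _ [i [j [B [_ mB ->]]]]; apply: sub_sigma_algebra; exists i, j, B.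
  pose C := [set A : set env | cut_env t @^-1` A = A].
  suff : sigma_rows t `<=` C by apply.
  apply: smallest_sub.
    split; first by rewrite /C /= preimage_set0.
    - by move=> B CB; rewrite /C /= setTD preimage_setC; congr (~` _); exact: CB.
    - by move=> F CF; rewrite /C /= preimage_bigcup; apply: eq_bigcupr => n _; exact: CF.
  move=> _ [i [j [B [/= ti mB ->]]]]; apply/seteqP; split=> w; rewrite /= ti//.
pose G := @env_cylinders R d [set x | - t <= height x].
have mc : measurable_fun setT (cut_env t : g_sigma_algebraType G -> env).
  apply: (@measurability _ _ (g_sigma_algebraType G) env setT _
    (env_cylinders setT)) => //.
  move=> _ [_ [i [j [B [_ mB ->]]]] <-]; rewrite setTI.
  have [ti|ti] := boolP (- t <= height i).
    apply: sub_sigma_algebra; exists i, j, B; split => //.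
    by apply/seteqP; split=> w; rewrite /= ti.
  have [Bx|nBx] := pselect (B ((point : env) i j)).
    rewrite (_ : _ @^-1` _ = setT); first exact: measurableT.
    by apply/seteqP; split=> w; rewrite /= (negbTE ti).
  rewrite (_ : _ @^-1` _ = set0); first exact: measurable0.
  by apply/seteqP; split=> w; rewrite /= (negbTE ti).
by rewrite -[X in sigma_rows t X]setTI; exact: mc.
Qed.

Lemma sigma_rows_above (k : nat) : sigma_rows k%:R = sigma_above l (- k%:Z).
Proof. by rewrite /sigma_rows /sigma_above intrN. Qed.

Definition level_event (m : nat) : set (env * path) := [set z | above m%:R z.2].

Lemma measurable_level_event m : measurable (level_event m).
Proof. exact: (measurable_preimage (f := @snd env path) measurable_snd
  (measurable_above l m%:R)). Qed.

Lemma above_le s t (X : path) : s <= t -> above s X -> above t X.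
Proof. by move=> st [X0 h]; split=> // n; apply: le_trans (h n); rewrite lerN2. Qed.

(* On the paths that do not go below level [-m], membership only depends on the
   rows above some level: such events are seen by the restrictions of the
   environment measures to the sigma-fields [sigma_rows]. *)
Definition local_event (E : set (env * path)) := forall m : nat, exists k : nat,
  forall K : nat, (k <= K)%N ->
  forall w X, above m%:R X -> E (w, X) <-> E (cut_env K%:R w, X).

Lemma local_eventC E : local_event E -> local_event (~` E).
Proof.
move=> lE m; have [k kP] := lE m; exists k => K kK w X Xm.
by split=> nE EX; apply: nE; apply/(kP K kK w X Xm).
Qed.

(** Two depths must be exceeded: [k] for membership in [E], and [m] for the quenched law of the
    paths above level $-m$. *)
Lemma qsec_level_cut E (m : nat) : measurable E -> local_event E ->
  exists k : nat, forall K : nat, (k <= K)%N -> forall w,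
    qsec (E `&` level_event m) (cut_env K%:R w) = qsec (E `&` level_event m) w.
Proof.
move=> mE lE; have [k kP] := lE m; exists (maxn k m) => K; rewrite geq_max =>
  /andP[kK mK] w.
rewrite /qsec.
rewrite (_ : [set X | _] = [set X | E (w, X)] `&` above m%:R); last first.
  by apply/seteqP; split=> X [EX Xm]; split=> //; apply/(kP K kK w X Xm).
rewrite -(@qlaw_eq_above _ _ l m%:R w)//; last exact: measurable_sec.
by apply: agree_cut; rewrite ler_nat.
Qed.

Lemma sigma_rows_qsec E (m : nat) (B : set (\bar R)) : measurable E -> local_event E ->
  measurable B -> exists k : nat, forall K : nat, (k <= K)%N ->
    sigma_rows K%:R [set w | B (qsec (E `&` level_event m) w)].
Proof.
move=> mE lE mB; have [k kP] := qsec_level_cut m mE lE; exists k => K kK.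
apply/sigma_rowsP; split.
  apply: (measurable_preimage _ mB); apply: measurable_qsec.
  by apply: measurableI => //; exact: measurable_level_event.
by apply/seteqP; split=> w; rewrite /= kP.
Qed.

(** * Functions of finitely deep rows, and their sums along the walk *)

Definition row_local (k : nat) T (f : env * path -> T) :=
  forall w X, f (cut_env k%:R w, X) = f (w, X).

(** While the path is above level $-m$, looking at depth [k] from its position stays within depth
    [k + m] from the origin. *)
Lemma row_local_iter k T (f : env * path -> T) (m K j : nat) w X :
  row_local k f -> (k + m <= K)%N -> above m%:R X ->
  f (iter j theta (cut_env K%:R w, X)) = f (iter j theta (w, X)).
Proof.
move=> fk kmK [X0 Xm]; rewrite !iter_theta /=; set Y := (fun n => _).
rewrite -fk -[RHS]fk (@cut_shift_cut _ m%:R)//; first by rewrite -natrD ler_nat.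
by rewrite X0 subr0.
Qed.

Lemma row_local_birkhoff k (f : env * path -> R) (m K n : nat) w X :
  row_local k f -> (k + m <= K)%N -> above m%:R X ->
  birkhoff_sum theta f n (cut_env K%:R w, X) = birkhoff_sum theta f n (w, X).
Proof.
move=> fk kmK Xm; apply: eq_bigr => j _.
exact: (row_local_iter (nat_of_ord j) w fk kmK Xm).
Qed.

Lemma local_unbounded_sums k (f : env * path -> R) : row_local k f ->
  local_event (unbounded_sums theta f).
Proof.
move=> fk m; exists (k + m)%N => K kmK w X Xm.
by split=> h L; have [n nL] := h L; exists n; move: nL; rewrite
  (row_local_birkhoff _ _ fk kmK).
Qed.

Lemma local_birkhoff_cvg k (f : env * path -> R) c : row_local k f ->
  local_event (birkhoff_cvg theta f c).
Proof.
move=> fk m; exists (k + m)%N => K kmK w X Xm; rewrite /birkhoff_cvg /=.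
by under [X in _ <-> (X @ _ --> _)]eq_fun do rewrite (row_local_birkhoff _ _ fk kmK Xm).
Qed.

End locality.

(** * Almost invariance under unit steps *)

Section unit_steps.
Context {R : realType} {d : nat}.
Local Notation site := (site d).
Local Notation path := (traj site).
Local Notation env := (env R d).
Variable l : 'rV[R]_d.
Local Notation height := (height l).

(** The directions in which weak ellipticity lets the walk step; those orthogonal to [l] are among
    them. *)
Definition good_step (e : site) := 0 <= height e /\ enorm (site_vec e : 'rV[R]_d) = 1.

Lemma enorm_delta (i : 'I_d) : enorm (site_vec (delta_mx 0 i : site) : 'rV[R]_d) = 1.
Proof.
rewrite /enorm /dot (bigD1 i)//= big1 ?addr0.
  by rewrite !mxE !eqxx /= mulr1 sqrtr1.
by move=> j ji; rewrite !mxE (negbTE ji) andbF /= mul0r.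
Qed.

Lemma enormN (x : site) : enorm (site_vec (- x) : 'rV[R]_d) = enorm
  (site_vec x : 'rV[R]_d).
Proof.
by rewrite /enorm; congr Num.sqrt; apply: eq_bigr => j _; rewrite !mxE intrN mulrNN.
Qed.

Lemma good_step_delta (i : 'I_d) :
  good_step (delta_mx 0 i : site) \/ good_step (- (delta_mx 0 i : site)).
Proof.
have [h0|/ltW h0] := leP 0 (height (delta_mx 0 i)); [left|right]; split=> //.
- exact: enorm_delta.
- by rewrite heightN oppr_ge0.
- by rewrite enormN; exact: enorm_delta.
Qed.

Lemma height_delta (i : 'I_d) : height (delta_mx 0 i) = l 0 i.
Proof.
rewrite /height /dot (bigD1 i)//= big1 ?addr0.
  by rewrite !mxE !eqxx /= mul1r.
by move=> j ji; rewrite !mxE (negbTE ji) andbF /= mul0r.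
Qed.

Lemma good_step_up : l != 0 -> exists e, good_step e /\ 0 < height e.
Proof.
move=> l0; have [i li] : exists i, l 0 i != 0.
  apply: contrapT => h; move/eqP: l0; apply; apply/rowP => i; rewrite mxE.
  by apply/eqP; apply: contrapT => /negP li; apply: h; exists i.
have [h0|h0|h0] := ltgtP 0 (height (delta_mx 0 i)).
- exists (delta_mx 0 i); split=> //; split; [exact: ltW|exact: enorm_delta].
- exists (- (delta_mx 0 i)); rewrite heightN oppr_gt0; split=> //.
  split; first by rewrite heightN oppr_ge0 ltW.
  by rewrite enormN; exact: enorm_delta.
- by move: li; rewrite -height_delta -h0 eqxx.
Qed.

(** For each coordinate vector, it or its opposite is a good step, so the good steps generate
    $\mathbb{Z}^d$ as a group. *)
Lemma site_ind (S : set site) : S 0 -> (forall x y, S x -> S y -> S (x + y)) ->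
  (forall x, S x -> S (- x)) -> (forall e, good_step e -> S e) -> forall x, S x.
Proof.
move=> S0 SD SN Sg x; have Sd i : S (delta_mx 0 i).
  by have [/Sg//|/Sg/SN] := good_step_delta i; rewrite opprK.
rewrite (row_sum_delta x).
elim/big_ind: _ => [|u v|i _]; [exact: S0|exact: SD|].
have Sn (n : nat) : S ((n%:Z) *: (delta_mx 0 i : site)).
  elim: n => [|n IH]; first by rewrite scale0r.
  have -> : n.+1%:Z = n%:Z + 1 by rewrite -addn1 PoszD.
  by rewrite scalerDl scale1r; exact: SD.
by case: (x 0 i) => n //; rewrite NegzE scaleNr; exact: SN.
Qed.

Section invariance.
Variable P : probability env R.
Hypothesis P_inv : shift_invariant P.
Hypothesis P_erg : shift_ergodic P.

Lemma measurable_shift_preimage (x : site) (A : set env) :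
  measurable A -> measurable (shift x @^-1` A).
Proof. exact: measurable_preimage (measurable_shift x). Qed.

(** The [x] for which [B] and its preimage under [shift x] agree up to a null set form a group,
    which contains the good steps and hence every site. The intersection of all the preimages is
    strictly invariant and differs from [B] by a null set. *)
Lemma almost_invariant01 B : measurable B ->
  (forall e, good_step e -> P (B `\` shift e @^-1` B) = 0%E) ->
  P B = 0%E \/ P (~` B) = 0%E.
Proof.
move=> mB B_inv.
have msB x := measurable_shift_preimage x mB.
pose S x := P (B `\` shift x @^-1` B) = 0%E /\ P (shift x @^-1` B `\` B) = 0%E.
have SS : forall x, S x.
  apply: site_ind.
  - rewrite /S (_ : shift 0 @^-1` B = B) ?setDv ?measure0//.
    by apply/funext => w; rewrite /preimage /= env_shift0.
  - move=> x y [x1 x2] [y1 y2].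
    have E : shift (x + y) @^-1` B = shift x @^-1` (shift y @^-1` B).
      by apply/funext => w; rewrite /preimage /= env_shiftD.
    split.
      apply: (@null_subset _ _ _ _ _ ((B `\` shift x @^-1` B) `|`
         shift x @^-1` (B `\` shift y @^-1` B))).
      + exact: measurableD.
      + by apply: measurableU; [exact: measurableD|apply: measurable_shift_preimage;
        exact: measurableD].
      + rewrite E => w [Bw nB]; have [xB|xB] := pselect (B (shift x w));
        [right|left] => //.
      + apply: measure_eq0U => //; first exact: measurableD.
          by apply: measurable_shift_preimage; exact: measurableD.
        by rewrite [LHS]P_inv//; exact: measurableD.
    apply: (@null_subset _ _ _ _ _ ((shift x @^-1` B `\` B) `|`
         shift x @^-1` (shift y @^-1` B `\` B))).
    + exact: measurableD.
    + by apply: measurableU; [exact: measurableD|apply: measurable_shift_preimage;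
      exact: measurableD].
    + rewrite E => w [Bw nB]; have [xB|xB] := pselect (B (shift x w)); [left|right] => //.
    + apply: measure_eq0U => //; first exact: measurableD.
        by apply: measurable_shift_preimage; exact: measurableD.
      by rewrite [LHS]P_inv//; exact: measurableD.
  - move=> x [x1 x2].
    have Nx (C : set env) : shift (- x) @^-1` (shift x @^-1` C) = C.
      by apply/funext => w; rewrite /preimage /= env_shiftD addNr env_shift0.
    split.
      rewrite -[X in X `\` _]Nx setDE preimage_setC -preimage_setI -setDE [LHS]P_inv//;
        exact: measurableD.
    by rewrite -[X in _ `\` X]Nx setDE preimage_setC -preimage_setI -setDE
      [LHS]P_inv//; exact: measurableD.
  - move=> e ge; split; first exact: B_inv.
    (* [B] and its preimage have equal measure, so inclusion up to a null set in one direction gives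
       the other. *)
    have BE : P (B `&` shift e @^-1` B) = P B.
      rewrite [RHS](measureDI P mB (msB e)) /= (B_inv e ge) add0e.
      by congr (P _).
    have := measureDI P (msB e) mB; rewrite [X in X = _]P_inv// => h.
    have f : P (shift e @^-1` B `&` B) \is a fin_num by rewrite fin_num_measure//;
      exact: measurableI.
    have -> : P (shift e @^-1` B `\` B) = (P B - P (shift e @^-1` B `&` B))%E.
      by rewrite h addeK.
    by rewrite setIC BE subee// fin_num_measure.
pose B' := \bigcap_(x in [set: site]) shift x @^-1` B.
have mB' : measurable B'.
  rewrite /B' -[\bigcap_(_ in _) _]setCK setC_bigcap; apply: measurableC.
  by apply: countable_bigcupT_measurable => // x; exact: measurableC.
have B'_inv k : shift k @^-1` B' = B'.
  apply/seteqP; split=> w h x _.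
    by have := h (x - k) I; rewrite /= env_shiftD addrC subrK.
  by have := h (k + x) I; rewrite /= env_shiftD.
have B'B : B' `<=` B by move=> w /(_ 0 I); rewrite /= env_shift0.
have mD : measurable (\bigcup_(x in [set: site]) (B `\` shift x @^-1` B)).
  by apply: countable_bigcupT_measurable => // x; exact: measurableD.
have D0 : P (\bigcup_(x in [set: site]) (B `\` shift x @^-1` B)) = 0%E.
  by apply: null_bigcup_count => x; [exact: measurableD|case: (SS x)].
have [B'0|B'1] := P_erg mB' B'_inv.
  left; apply: (null_subset mB (measurableU _ _ mB' mD)); last exact: measure_eq0U.
  move=> w Bw; have [?|nB'] := pselect (B' w); first by left.
  right; apply: contrapT => h; apply: nB' => x _; apply: contrapT => nx.
  by apply: h; exists x.
right; apply: (null_subset (measurableC mB) (measurableC mB')).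
  exact: subsetC.
exact/(probability1P P mB').
Qed.

End invariance.
End unit_steps.

(** * Comparison of the two measures *)

Section comparison.
Context {R : realType} {d : nat}.
Local Notation site := (site d).
Local Notation path := (traj site).
Local Notation env := (env R d).
Variable l : 'rV[R]_d.
Local Notation height := (height l).
Local Notation above := (above l).
Local Notation good_step := (good_step l).
Local Notation sigma_rows := (sigma_rows l).
Local Notation level_event := (level_event l).
Local Notation local_event := (local_event l).

Lemma measurable_env_eq0 (e : site) : measurable [set w : env | w 0 e = 0].
Proof.
exact: (measurable_preimage (measurable_env_prob 0 e) (measurable_set1 0)).
Qed.

Lemma sigma_rows_env_eq0 (e : site) : sigma_rows 0 [set w : env | w 0 e = 0].
Proof.
apply/sigma_rowsP; split; first exact: measurable_env_eq0.
by apply/seteqP; split=> w; rewrite /= height0 oppr0 lexx.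
Qed.

Lemma qsec_levelC (w : env) :
  qsec (~` \bigcup_m level_event m) w = 0%E ->
  forall E, measurable E -> (forall m, qsec (E `&` level_event m) w = 0%E) ->
  qsec E w = 0%E.
Proof.
move=> w0 E mE Em.
have mL m := @measurable_level_event R d l m.
have mEL m : measurable (E `&` level_event m) by exact: measurableI.
have mC : measurable (~` \bigcup_m level_event m).
  by apply: measurableC; exact: bigcupT_measurable.
have mS m : measurable [set X | (E `&` level_event m) (w, X)] := measurable_sec w (mEL m).
have mU : measurable (\bigcup_m [set X | (E `&` level_event m) (w, X)]).
  by apply: bigcupT_measurable.
apply: (null_subset (measurable_sec w mE) (measurableU _ _ mU (measurable_sec w mC)));
  last first.
  by apply: measure_eq0U => //; [exact: measurable_sec|exact: null_bigcup].
move=> X EX; have [[m _ Xm]|nX] := pselect ((\bigcup_m level_event m) (w, X)).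
  by left; exists m.
by right.
Qed.

(** Only the lower bound of the path is retained from divergence along [l]. It is what lets the
    level events exhaust the path space, and a 0-1 law can establish it for [Pinf]. *)
Definition transient_law (mu : probability env R) :=
  annealed_law mu 0 (~` \bigcup_m level_event m) = 0%E.

Lemma annealed_levelC mu (E : set (env * path)) : transient_law mu -> measurable E ->
  (forall m, annealed_law mu 0 (E `&` level_event m) = 0%E) ->
  annealed_law mu 0 E = 0%E.
Proof.
move=> mu_tr mE Em.
have mL m := @measurable_level_event R d l m.
have mU : measurable (\bigcup_m (E `&` level_event m)).
  by apply: bigcupT_measurable => m; exact: measurableI.
have mC : measurable (~` \bigcup_m level_event m).
  by apply: measurableC; exact: bigcupT_measurable.
apply: (null_subset mE (measurableU _ _ mU mC)); last first.
  apply: measure_eq0U => //; apply: null_bigcup => // m; exact: measurableI.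
move=> z Ez; have [[m _ zm]|nz] := pselect ((\bigcup_m level_event m) z); last by right.
by left; exists m.
Qed.

(** Stated for two arbitrary measures because null events are carried both from [P] to [Pinf] and
    back. *)
Lemma local_null_transfer (mu nu : probability env R) (E : set (env * path)) :
  (forall (k : nat) A, sigma_rows k%:R A -> mu A = 0%E -> nu A = 0%E) ->
  transient_law nu -> measurable E -> local_event E ->
  annealed_law mu 0 E = 0%E -> annealed_law nu 0 E = 0%E.
Proof.
move=> ac nu_tr mE lE E0; apply: annealed_levelC => // m.
have mEm : measurable (E `&` level_event m).
  by apply: measurableI => //; exact: measurable_level_event.
apply/(annealed0P _ mEm).
have [k kP] := sigma_rows_qsec m mE lE (@measurable_neq0 R).
apply: (ac k); first exact: kP.
apply/(annealed0P _ mEm); apply: null_subset E0 => //; exact: subIsetl.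
Qed.

Variables P Pinf : probability env R.
Hypothesis P_inv : shift_invariant P.
Hypothesis P_erg : shift_ergodic P.
Hypothesis P_elliptic : forall e, good_step e -> P [set w : env | w 0 e = 0] = 0%E.
Hypothesis P_transient : transient_law P.
Hypothesis Pinf_inv : env_process_invariant Pinf.
Hypothesis Pinf_ac : forall (k : nat) A, sigma_rows k%:R A -> P A = 0%E -> Pinf A = 0%E.

Lemma Pinf_elliptic e : good_step e -> Pinf [set w : env | w 0 e = 0] = 0%E.
Proof. by move=> /P_elliptic; apply: (Pinf_ac (k := 0)); exact: sigma_rows_env_eq0. Qed.

(** By invariance the environment after one step again has law [Pinf], so it almost surely avoids
    [D]. As the step [e] has positive probability, the environment shifted by [e] avoids [D] as
    well. *)
Lemma Pinf_shift_null e D : good_step e -> measurable D -> Pinf D = 0%E ->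
  Pinf (shift e @^-1` D) = 0%E.
Proof.
move=> ge mD D0.
pose E := [set z : env * path | D (env_process z 1%N)].
have mE : measurable E := measurable_preimage (measurable_env_process_at 1) mD.
have Q0 : annealed_law Pinf 0 E = 0%E by rewrite annealed_step.
have mN : measurable [set w | qsec E w != 0%E].
  exact: (measurable_qsec_neq0 mE).
have me := measurable_env_eq0 e.
apply: (null_subset (measurable_shift_preimage e mD) (measurableU _ _ mN me)); last first.
  by apply: measure_eq0U => //; [exact/annealed0P|exact: Pinf_elliptic].
move=> w Dw; have [we|/eqP we] := pselect (w 0 e = 0); [by right|left].
rewrite /= -measure_gt0; apply: (@lt_le_trans _ _ (w 0 e)%:E).
  by rewrite lte_fin lt0r we env_ge0.
rewrite -qlaw_step; apply: le_measure; rewrite ?inE.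
- exact: measurable_path_at 1 [set e].
- exact: measurable_sec.
- by move=> X /= Xe; rewrite /E /= /env_process /= Xe.
Qed.

(* If [A] is [Pinf]-null then so is its orbit [B] under the good steps; by weak
   ellipticity [B] is almost shift-invariant, hence of [P]-measure 0 or 1, and 1
   would force [Pinf B = 1]. *)
Lemma P_ac k A : sigma_rows k A -> 0 <= k ->
  (forall A, sigma_rows k A -> P A = 0%E -> Pinf A = 0%E) -> Pinf A = 0%E -> P A = 0%E.
Proof.
move=> /sigma_rowsP[mA A_cut] k0 ac A0.
pose sh (s : seq site) := \sum_(e <- s) e.
pose good (s : seq site) := forall e, e \in s -> good_step e.
pose F s := if `[< good s >] then shift (sh s) @^-1` A else set0.
have mF s : measurable (F s).
  by rewrite /F; case: ifP => // _; exact: measurable_shift_preimage.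
(* A sum of good steps has nonnegative height, so shifting along it does not leave [sigma_rows k],
   where the two measures can be compared. *)
have F_cut s w : F s (cut_env l k w) <-> F s w.
  rewrite /F; case: asboolP => // gs; rewrite /preimage /= -A_cut /preimage /=.
  rewrite (@cut_shift_cut _ _ _ _ 0) ?addr0// oppr0 /sh.
  elim: s gs => [|e s IH] gs; first by rewrite big_nil height0.
  rewrite big_cons heightD addr_ge0 ?IH//; last by move=> f fs; apply: gs;
    rewrite inE fs orbT.
  by have [] := gs e (mem_head _ _).
have F0 s : Pinf (F s) = 0%E.
  rewrite /F; case: asboolP => [gs|_]; last by rewrite measure0.
  elim: s gs => [|e s IH] gs.
    rewrite (_ : _ @^-1` _ = A)//; apply/funext => w.
    by rewrite /preimage /= /sh big_nil env_shift0.
  rewrite (_ : _ @^-1` _ = shift e @^-1` (shift (sh s) @^-1` A)); last first.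
    by apply/funext => w; rewrite /preimage /= env_shiftD /sh big_cons.
  apply: Pinf_shift_null; [exact: gs (mem_head _ _)|exact: measurable_shift_preimage|].
  by apply: IH => f fs; apply: gs; rewrite inE fs orbT.
pose B := \bigcup_(s in [set: seq site]) F s.
have mB : measurable B by exact: countable_bigcupT_measurable.
have B0 : Pinf B = 0%E by exact: null_bigcup_count.
(* Prepending [e] to a list of good steps shows that [B] contains its preimage under [shift e], so
   this difference is even empty. *)
have B_inv e : good_step e -> P (~` B `\` shift e @^-1` (~` B)) = 0%E.
  move=> ge; rewrite (_ : _ `\` _ = set0) ?measure0//.
  apply/seteqP; split=> // w [nB /= /contrapT[s _ Fs]]; apply: nB.
  exists (e :: s) => //; move: Fs; rewrite /F; case: asboolP => // gs sA.
  rewrite asboolT; last by move=> f; rewrite inE => /predU1P[->//|]; exact: gs.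
  by move: sA; rewrite /preimage /= env_shiftD /sh big_cons.
have AB : A `<=` B.
  move=> w Aw; exists [::] => //; rewrite /F asboolT//.
  by rewrite /preimage /= /sh big_nil env_shift0.
have [nB0|] := almost_invariant01 P_inv P_erg (measurableC mB) B_inv; last first.
  by rewrite setCK => PB0; exact: null_subset PB0.
have sB : sigma_rows k (~` B).
  apply/sigma_rowsP; split; first exact: measurableC.
  apply/seteqP; split=> w nB [s _ Fs]; apply: nB; exists s => //; exact/F_cut.
have := probability_setC Pinf mB; rewrite (ac _ sB nB0) B0 sube0 => /esym/eqP.
by rewrite onee_eq0.
Qed.

Lemma P_ac_nat (k : nat) A : sigma_rows k%:R A -> Pinf A = 0%E -> P A = 0%E.
Proof. by move=> sA; apply: P_ac sA _ _ => // B; exact: Pinf_ac. Qed.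

(** * Lower bounds for the walk and the 0-1 law for local invariant events *)

Hypothesis l_neq0 : l != 0.

Let u t (w : env) := qlaw w (above t).

Let mu_ t : measurable [set w | u t w = 0%E].
Proof.
have mE : measurable [set z : env * path | above t z.2].
  exact: (measurable_preimage (f := @snd env path) measurable_snd (measurable_above l t)).
exact: (measurable_preimage (measurable_qsec mE) (emeasurable_set1 0%E)).
Qed.

(** Seen from the endpoint of the step [e], level $-t$ lies at depth [t + height e]. A path staying
    above that depth becomes, after prepending [e], a path in [above t]. *)
Lemma stay_above_step t e w : good_step e -> 0 <= t -> u t w = 0%E ->
  w 0 e = 0 \/ u (t + height e) (shift e w) = 0%E.
Proof.
move=> ge t0 uw; have [->|/eqP we] := pselect (w 0 e = 0); [by left|right].
have ma := measurable_above l t.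
have : qlaw w (above t `&` [set X : path | X 1%N = e]) = 0%E.
  apply: null_subset uw; [|exact: ma|exact: subIsetl].
  by apply: measurableI => //; exact: measurable_path_at 1 [set e].
rewrite qlaw_first_step// => /eqP; rewrite mule_eq0 eqe (negbTE we) /= => /eqP h.
apply: null_subset h.
- exact: measurable_above.
- exact: measurable_preimage (measurable_prep e) ma.
move=> X [X0 Xa]; split=> // -[|n] /=; first by rewrite height0 oppr_le0.
by have := Xa n; rewrite heightD; lra.
Qed.

(* Stepping up [n] times along [e] first, [P (u 0 = 0) <= P (u (n * height e) = 0)]
   by shift invariance, and the right-hand side tends to 0 by transience. *)
Lemma stay_above_P : P [set w | u 0 w = 0%E] = 0%E.
Proof.
have [e [ge he]] := good_step_up l_neq0.
have h0 := ltW he.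
pose F n := [set w | u (n%:R * height e) w = 0%E].
have PF n : (P (F 0%N) <= P (F n))%E.
  elim: n => [//|n IH]; apply: (le_trans IH).
  have me := measurable_env_eq0 e.
  have mFS : measurable (shift e @^-1` F n.+1) := measurable_shift_preimage e (mu_ _).
  have -> : P (F n.+1) = P (shift e @^-1` F n.+1 `|` [set w : env | w 0 e = 0]).
    by rewrite (measureU0 mFS me (P_elliptic ge)) [RHS]P_inv//; exact: mu_.
  apply: le_measure; rewrite ?inE; [exact: mu_| |].
    by apply: measurableU => //; exact: measurable_shift_preimage.
  move=> w Fw; have [||] := stay_above_step ge _ Fw; rewrite ?mulr_ge0//; first by right.
  by rewrite -[X in _ + X]mul1r -mulrDl natr1; left.
have uW s t w : s <= t -> u t w = 0%E -> u s w = 0%E.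
  move=> st; apply: null_subset; [exact: measurable_above|exact: measurable_above|].
  by move=> X; exact: above_le.
have mL : measurable (~` \bigcup_m level_event m).
  apply: measurableC; apply: bigcupT_measurable => m; exact: measurable_level_event.
(* In such an environment staying above any fixed depth has probability 0, and countably many depths
   cover all paths bounded below. *)
have I0 : P (\bigcap_n F n) = 0%E.
  have := (annealed0P P mL).1 P_transient.
  apply: null_subset => //.
  - by apply: bigcap_measurableType => n _; exact: mu_.
  - exact: (measurable_qsec_neq0 mL).
  move=> w wF /=; apply/eqP => w0.
  have := @qsec_levelC w w0 setT measurableT.
  rewrite /qsec (_ : [set X | setT (w, X)] = setT)// qlawT => h.
  have /eqP : 1%E = 0%E :> \bar R; last by rewrite onee_eq0.
  apply: h => m; rewrite setTI.
  have [n mn] : exists n : nat, m%:R <= n%:R * height e.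
    exists (Num.truncn (m%:R / height e)).+1.
    by rewrite -ler_pdivrMr//; exact/ltW/truncnS_gt.
  exact: (uW _ _ _ mn (wF n I)).
have cF : P \o F @ \oo --> P (\bigcap_n F n).
  apply: nonincreasing_cvg_mu => //.
  - by rewrite ltey_eq fin_num_measure//; exact: mu_.
  - by move=> n; exact: mu_.
  - by apply: bigcap_measurableType => n _; exact: mu_.
  - move=> m n mn; apply/subsetPset => w; apply: uW.
    by rewrite ler_wpM2r// ler_nat.
have <- : F 0%N = [set w | u 0 w = 0%E] by rewrite /F mul0r.
apply/eqP; rewrite -measure_le0 -I0 -(cvg_lim _ cF)//.
apply: lime_ge; first exact: (cvgP _ cF).
by apply: nearW => n; exact: PF.
Qed.

Lemma stay_above_Pinf : Pinf [set w | u 0 w = 0%E] = 0%E.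
Proof.
apply: (Pinf_ac (k := 0)); last exact: stay_above_P.
apply/sigma_rowsP; split; first exact: mu_.
apply/seteqP; split=> w; rewrite /= /u -[above 0]setTI;
  by rewrite -(@qlaw_eq_above _ _ l 0 w (cut_env l 0 w))//; exact: agree_cut.
Qed.

Let bounded_below : set (env * path) :=
  [set z | exists m : nat, forall n, - m%:R <= height (z.2 n - z.2 0%N)].

Let measurable_bounded_below : measurable bounded_below.
Proof.
rewrite (_ : bounded_below = \bigcup_(m in [set: nat]) \bigcap_(n in [set: nat])
    [set z : env * path | - m%:R <= height (z.2 n - z.2 0%N)]).
  apply: bigcupT_measurable => m; apply: bigcap_measurableType => n _.
  apply: (measurable_preimage (f := fun z : env * path => z.2 n - z.2 0%N)
    (B := [set x | - m%:R <= height x])) => //.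
  exact: (measurable_site_comp2 (fun a b => a - b) (measurable_coord n)
    (measurable_coord 0)).
apply/seteqP; split=> z; first by move=> [m h]; exists m => // n _; exact: h.
by move=> [m _ h]; exists m => n; exact: h.
Qed.

Let bounded_below_theta : theta @^-1` bounded_below = bounded_below.
Proof.
have le_abs (x : R) := nat_upper_bound `|x|.
apply/seteqP; split=> -[w X] [m h].
  have [K KP] := le_abs (height (X 1%N - X 0%N)).
  exists (m + K)%N => n; rewrite natrD; case: n => [|n].
    by rewrite subrr height0 oppr_le0 addr_ge0.
  have := h n; rewrite /theta /=; move: KP; rewrite !(heightD, heightN) ler_norml =>
    /andP[h1 h2].
  lra.
have [K KP] := le_abs (height (X 1%N - X 0%N)).
exists (m + K)%N => n; rewrite natrD.
have := h n.+1; rewrite /theta /=; move: KP; rewrite !(heightD, heightN) ler_norml =>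
  /andP[h1 h2].
lra.
Qed.

Lemma Pinf_transient : transient_law Pinf.
Proof.
have mB := measurable_bounded_below.
have mL : measurable (~` \bigcup_m level_event m).
  apply: measurableC; apply: bigcupT_measurable => m; exact: measurable_level_event.
have B0 : annealed_law Pinf 0 (~` bounded_below) = 0%E.
  apply/(annealed0P _ (measurableC mB)).
  have m01 := measurable_qsec_neq01 mB.
  have mN := measurable_qsec_neq0 (measurableC mB).
  apply: (null_subset mN (measurableU _ _ m01 (mu_ 0))); last first.
    apply: measure_eq0U => //; first exact: (qsec01 mB bounded_below_theta Pinf_inv).
    exact: stay_above_Pinf.
  move=> w /= Bw; have [?|uw] := pselect (u 0 w = 0%E); [by right|left; split=> Bw0].
    apply: uw; apply: null_subset Bw0; [exact: measurable_above|exact: measurable_sec|].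
    move=> X [X0 Xa]; exists 0%N => n; rewrite /= oppr0 X0 subr0.
    by have := Xa n; rewrite oppr0.
  by move: Bw; rewrite qsecC// Bw0 subee// eqxx.
have mS := @measurable_start_neq0 R d.
apply: (null_subset mL (measurableU _ _ (measurableC mB) mS)); last first.
  apply: measure_eq0U => //; first exact: measurableC.
  exact: annealed_start.
move=> z nL; have [z0|z0] := pselect (z.2 0%N = 0); last by right.
left => -[m zm]; apply: nL; exists m => //; split=> // n.
by have := zm n; rewrite z0 subr0.
Qed.

(* The quenched probability of [E] is 0 or 1 for [Pinf]-almost every environment.
   This passes to [P] by locality, and there ellipticity and ergodicity decide
   between 0 and 1. *)
Lemma local_invariant01 E : measurable E -> local_event E -> theta @^-1` E = E ->
  annealed_law Pinf 0 E = 0%E \/ annealed_law Pinf 0 (~` E) = 0%E.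
Proof.
move=> mE lE E_inv.
have mL m := @measurable_level_event R d l m.
have mEC := measurableC mE.
have mEm m : measurable (E `&` level_event m) by exact: measurableI.
have mECm m : measurable (~` E `&` level_event m) by exact: measurableI.
have lEC := local_eventC lE.
have mLC : measurable (~` \bigcup_m level_event m).
  by apply: measurableC; exact: bigcupT_measurable.
(* In [D m] both [E] and its complement are possible above level $-m$. The assertion that $h_E$ is 0
   or 1 need not be visible in any [sigma_rows k], whereas [D m] is, and it is null under [Pinf] by
   [qsec01]. *)
pose D m := [set w | qsec (E `&` level_event m) w != 0%E] `&`
            [set w | qsec (~` E `&` level_event m) w != 0%E].
have mD m : measurable (D m).
  apply: measurableI; first exact: (measurable_qsec_neq0 (mEm m)).
  exact: (measurable_qsec_neq0 (mECm m)).
have m01 := measurable_qsec_neq01 mE.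
have sub0 m (F : set (env * path)) w : measurable F -> qsec F w = 0%E ->
    qsec (F `&` level_event m) w = 0%E.
  move=> mF; apply: null_subset; [|exact: measurable_sec|by move=> X []].
  by apply: measurable_sec; exact: measurableI.
have EC w : qsec (~` E) w = (1 - qsec E w)%E by exact: qsecC.
have PD m : P (D m) = 0%E.
  have [k1 k1P] := sigma_rows_qsec m mE lE (@measurable_neq0 R).
  have [k2 k2P] := sigma_rows_qsec m mEC lEC (@measurable_neq0 R).
  apply: (P_ac_nat (k := maxn k1 k2)).
    have /sigma_rowsP[_ c1] := k1P _ (leq_maxl k1 k2).
    have /sigma_rowsP[_ c2] := k2P _ (leq_maxr k1 k2).
    by apply/sigma_rowsP; split => //; rewrite preimage_setI c1 c2.
  apply: null_subset (qsec01 mE E_inv Pinf_inv) => // w [/= w1 w2]; split=> h.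
    by move: w1; rewrite (sub0 m E w mE h) eqxx.
  by move: w2; rewrite (sub0 m _ w mEC) ?eqxx// EC h subee.
have PL := (annealed0P P mLC).1 P_transient.
have mPL : measurable [set w | qsec (~` \bigcup_m level_event m) w != 0%E].
  exact: (measurable_qsec_neq0 mLC).
pose Z0 := [set w | qsec E w = 0%E].
have mZ0 : measurable Z0.
  exact: (measurable_preimage (measurable_qsec mE) (emeasurable_set1 0%E)).
pose N := \bigcup_m D m `|` [set w | qsec (~` \bigcup_m level_event m) w != 0%E].
have mDU : measurable (\bigcup_m D m) by exact: bigcupT_measurable.
have N0 : P N = 0%E by apply: measure_eq0U => //; exact: null_bigcup.
have NP w : ~ N w -> qsec E w = 0%E \/ qsec (~` E) w = 0%E.
  move=> nN; apply: contrapT => /not_orP[E0 EC0].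
  have wL : qsec (~` \bigcup_m level_event m) w = 0%E.
    by apply/eqP; apply: contrapT => h; apply: nN; right; apply/negP.
  have ex F : measurable F -> qsec F w <> 0%E -> exists m, qsec
    (F `&` level_event m) w != 0%E.
    move=> mF F0; apply: contrapT => h; apply: F0; apply: qsec_levelC => // m.
    by apply/eqP; apply: contrapT => h'; apply: h; exists m; apply/negP.
  (* [E] and its complement may become possible at different depths; the larger one serves both. *)
  have mono m m' F : measurable F -> (m <= m')%N -> qsec (F `&` level_event m) w != 0%E ->
      qsec (F `&` level_event m') w != 0%E.
    move=> mF mm'; apply: contra => /eqP h; apply/eqP; apply: null_subset h.
    - by apply: measurable_sec; exact: measurableI.
    - by apply: measurable_sec; exact: measurableI.
    - by move=> X [FX Xm]; split=> //; apply: above_le Xm; rewrite ler_nat.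
  have [m1 h1] := ex _ mE E0; have [m2 h2] := ex _ mEC EC0.
  apply: nN; left; exists (maxn m1 m2) => //; split.
    exact: mono (leq_maxl _ _) h1.
  exact: mono (leq_maxr _ _) h2.
(* By the Markov property, $h_E(w)=0$ forces $h_E$ to vanish after every step of positive
   probability. *)
have step e : good_step e -> P (Z0 `\` shift e @^-1` Z0) = 0%E.
  move=> ge; apply: null_subset (P_elliptic ge).
  - by apply: measurableD => //; exact: measurable_shift_preimage.
  - exact: measurable_env_eq0.
  move=> w [Ew nEw] /=; apply: contrapT => /eqP we; apply: nEw.
  have : qlaw w [set X | E (theta (w, X)) /\ X 1%N = e] = 0%E.
    apply: null_subset Ew; [|exact: measurable_sec|].
      apply: measurableI; last exact: measurable_path_at 1 [set e].
      apply: (measurable_sec (E := theta @^-1` E)).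
      exact: measurable_preimage measurable_theta mE.
    by move=> X [EX _]; rewrite /= -E_inv.
  by rewrite qsec_theta_path// => /eqP; rewrite mule_eq0 eqe (negbTE we) => /eqP.
have [PZ|PZ] := almost_invariant01 P_inv P_erg mZ0 step.
  right; apply: (local_null_transfer Pinf_ac Pinf_transient) => //.
  apply/(annealed0P _ mEC).
  apply: (@null_subset _ _ _ _ _ (N `|` Z0)).
  - exact: (measurable_qsec_neq0 mEC).
  - by apply: measurableU => //; exact: measurableU.
  - move=> w /= /eqP w0; have [|nN] := pselect (N w); [by left|right].
    by have [|] := NP w nN.
  - by apply: measure_eq0U => //; exact: measurableU.
left; apply: (local_null_transfer Pinf_ac Pinf_transient) => //.
apply/(annealed0P _ mE).
by rewrite (_ : [set w | _] = ~` Z0)//; apply/seteqP; split=> w /= /eqP.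
Qed.

End comparison.

(** * Ergodicity and law of large numbers *)

Section ergodicity.
Context {R : realType} {d : nat}.
Local Notation site := (site d).
Local Notation path := (traj site).
Local Notation env := (env R d).
Variable l : 'rV[R]_d.
Local Notation height := (height l).
Local Notation sigma_rows := (sigma_rows l).
Local Notation local_event := (local_event l).
Local Notation row_local := (row_local l).

(** A set is a [Prop]-valued function, so [row_local] applies to it directly. *)
Definition row_local_events : set (set (env * path)) :=
  [set C | measurable C /\ exists k : nat, row_local k C].

Lemma row_local_le (k K : nat) T (f : env * path -> T) :
  (k <= K)%N -> row_local k f -> row_local K f.
Proof.
move=> kK fk w X; rewrite -fk cut_cut; last by rewrite ler_nat.
exact: fk.
Qed.

Lemma row_local_eventsI : setI_closed row_local_events.
Proof.
move=> A B [mA [k kA]] [mB [m mB']]; split; first exact: measurableI.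
exists (maxn k m) => w X; rewrite /setI /mkset.
by rewrite (row_local_le (leq_maxl k m) kA) (row_local_le (leq_maxr k m) mB').
Qed.

(** A generator involves either one entry of the environment, whose row lies above some level, or
    the path alone. *)
Lemma row_local_events_gen : @measurable _ (env * path)%type = <<s row_local_events >>.
Proof.
apply/seteqP; split; last first.
  by apply: smallest_sub; [exact: sigma_algebra_measurable|move=> A []].
set G := row_local_events.
have m1 : measurable_fun setT (fst : g_sigma_algebraType G -> env).
  apply: (@measurability _ _ (g_sigma_algebraType G) env setT _
    (env_cylinders setT)) => //.
  move=> _ [_ [x [j [B [_ mB ->]]]] <-]; rewrite setTI; apply: sub_sigma_algebra.
  split.
    apply: (measurable_preimage (f := @fst env path) measurable_fst).
    by apply: sub_sigma_algebra; exists x, j, B.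
  have [k kx] := nat_upper_bound (- height x); exists k => w X /=.
  by rewrite /preimage /= ifT// lerNl.
have m2 : measurable_fun setT (snd : g_sigma_algebraType G -> path).
  apply: (@measurability _ _ (g_sigma_algebraType G) path setT _
    (traj_cylinders site)) => //.
  move=> _ [_ [n [B [mB ->]]] <-]; rewrite setTI; apply: sub_sigma_algebra.
  split; last by exists 0%N.
  apply: (measurable_preimage (f := @snd env path) measurable_snd).
  exact: measurable_path_at.
have mid : measurable_fun setT (fun z : g_sigma_algebraType G => (z.1, z.2) : env * path).
  exact: measurable_fun_pair.
move=> A mA; have := measurable_preimage mid mA.
by congr (measurable _); apply/seteqP; split=> -[].
Qed.

Variables P Pinf : probability env R.
Hypothesis P_inv : shift_invariant P.
Hypothesis P_erg : shift_ergodic P.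
Hypothesis P_elliptic : forall e, good_step l e -> P [set w : env | w 0 e = 0] = 0%E.
Hypothesis P_transient : transient_law l P.
Hypothesis Pinf_inv : env_process_invariant Pinf.
Hypothesis Pinf_ac : forall (k : nat) A, sigma_rows k%:R A -> P A = 0%E -> Pinf A = 0%E.
Hypothesis l_neq0 : l != 0.
Local Notation Q := (annealed_law Pinf 0).

Lemma local_event01 E : measurable E -> local_event E -> theta @^-1` E = E ->
  Q E = 0%E \/ Q (~` E) = 0%E.
Proof. exact: (local_invariant01 P_inv P_erg P_elliptic P_transient Pinf_inv Pinf_ac).
  Qed.

(** Independence of [A] from the generating pi-system of local events extends to all events, [A]
    included, so $Q(A)=Q(A)^2$. *)
Lemma theta_ergodic A : measurable A -> theta @^-1` A = A ->
  Q A = 0%E \/ Q (~` A) = 0%E.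
Proof.
move=> mA A_inv.
have qA : 0 <= fine (Q A) by exact: fine_ge0.
have indep C : row_local_events C -> fine (Q (C `&` A)) = fine (Q C) * fine (Q A).
  move=> [mC [k kC]].
  have := @zero_one_mean_indep R _ _ Q theta measurable_theta
    (theta_preserving Pinf_inv) (\1_C) (bmeas_indic mC).
  move=> /(_ _ A mA A_inv); rewrite Rintegral_indic// => <-.
    rewrite -Rintegral_indic; last exact: measurableI.
    by apply: eq_Rintegral => z _; rewrite indicI.
  move=> c; have bC : bounded_measurable (fun z => \1_C z - c).
    by apply: bmeasB; [exact: bmeas_indic|exact: bmeas_cst].
  apply: local_event01.
  - by apply: measurable_unbounded_sums; [exact: measurable_theta|case: bC].
  - apply: (@local_unbounded_sums _ _ l k) => w X; congr (_ - c).
    rewrite !indicE; congr (nat_of_bool _)%:R.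
    by apply/idP/idP => /set_mem h; apply/mem_set; move: h; rewrite kC.
  - exact: unbounded_sums_theta.
pose m1 := mrestr Q mA.
pose m2 := mscale (NngNum qA) Q.
have QA : m1 A = m2 A.
  apply: (@measure_unique _ _ _ row_local_events (fun=> setT)) => //.
  - exact: row_local_events_gen.
  - exact: row_local_eventsI.
  - by move=> n; split; [exact: measurableT|exists 0%N].
  - by apply/seteqP; split=> // z _; exists 0%N.
  - move=> C CG; have mC := CG.1; rewrite /m1 /m2 /= /mrestr /mscale /=.
    have mCA : measurable (C `&` A) by exact: measurableI.
    rewrite -(fineK (fin_num_measure Q _ mCA)) indep// EFinM muleC; congr (_ * _)%E.
    by rewrite fineK// fin_num_measure.
  - move=> n; rewrite /m1 /= /mrestr setTI; apply: (@le_lt_trans _ _ 1%E);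
    last exact: ltry.
    exact: probability_le1.
move: QA; rewrite /m1 /m2 /= /mrestr /mscale /= setIid.
have fQ : Q A \is a fin_num by rewrite fin_num_measure.
rewrite -(fineK fQ) -EFinM => -[] /eqP.
rewrite -subr_eq0 -{1}[fine _]mulr1 -mulrBr mulf_eq0 => /orP[/eqP ->|]; first by left.
rewrite subr_eq0 => /eqP q1; right; apply/(probability1P Q mA).
by rewrite /= -(fineK fQ) -q1.
Qed.

Lemma law_of_large_numbers f : bounded_measurable f ->
  local_event (birkhoff_cvg theta f (\int[Q]_z f z)) ->
  annealed_law P 0 (~` birkhoff_cvg theta f (\int[Q]_z f z)) = 0%E.
Proof.
move=> bf lf.
have mL : measurable (birkhoff_cvg theta f (\int[Q]_z f z)).
  by apply: measurable_birkhoff_cvg; [exact: measurable_theta|case: bf].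
apply: (@local_null_transfer _ _ l Pinf P).
- move=> k A; exact: (P_ac_nat P_inv P_erg P_elliptic Pinf_inv Pinf_ac).
- exact: P_transient.
- exact: measurableC.
- exact: local_eventC.
- apply: birkhoff_ergodic => //; [exact: measurable_theta|exact: theta_preserving|].
  exact: theta_ergodic.
Qed.

(** [f \o theta] need not be row local, since the first step of an arbitrary path may go arbitrarily
    far down; on paths above a fixed level its sums are still local. It occurs because the empirical
    measures start at time 1. *)
Lemma local_birkhoff_cvg_theta (k : nat) (f : env * path -> R) c : row_local k f ->
  local_event (birkhoff_cvg theta (f \o theta) c).
Proof.
move=> fk m; exists (k + m)%N => K kmK w X Xm; rewrite /birkhoff_cvg /=.
under [X in _ <-> (X @ _ --> _)]eq_fun => n.
  rewrite (_ : birkhoff_sum _ _ _ _ = birkhoff_sum theta (f \o theta) n (w, X));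
    last first.
    by apply: eq_bigr => j _; exact: (row_local_iter (nat_of_ord j).+1 w fk kmK Xm).
  over.
by [].
Qed.

(** [env_process] intertwines [theta] with the time shift, so shift-invariant events pull back to
    [theta]-invariant ones. *)
Lemma env_process_ergodic : time_shift_ergodic (env_process_law Pinf).
Proof.
move=> A mA A_inv; pose A' := (@env_process R d) @^-1` A.
have mA' : measurable A' := measurable_preimage measurable_env_process mA.
have A'_inv : theta @^-1` A' = A'.
  rewrite /A' -[in RHS]A_inv; apply/funext => z; rewrite /preimage /=; congr (A _).
  by apply/funext => n; exact: env_process_theta.
have [|] := theta_ergodic mA' A'_inv; first by left.
by move=> h; right; apply/(probability1P Q mA').
Qed.

End ergodicity.

(** * Approximation of continuous functions *)

Section boxes.
Context {R : realType} {d : nat}.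
Local Notation site := (site d).
Local Notation env := (env R d).

(** There are countably many codes, so a supremum over boxes is the limit of a sequence; each box
    constrains finitely many rows and is therefore local. *)
Definition box_code : Type := seq ((site * site) * (rat * rat)).
HB.instance Definition _ := Countable.on box_code.

Definition box (s : box_code) : set env :=
  [set w : env | forall e, e \in s -> ratr e.2.1 < w e.1.1 e.1.2 < ratr e.2.2].

Lemma box_cons e s : box (e :: s) =
  [set w : env | ratr e.2.1 < w e.1.1 e.1.2 < ratr e.2.2] `&` box s.
Proof.
apply/seteqP; split=> w h.
  by split; [apply: h; exact: mem_head|move=> f fs; apply: h; rewrite inE fs orbT].
by move=> f; rewrite inE => /predU1P[->|]; [exact: h.1|exact: h.2].
Qed.

Lemma box_cat s t : box (s ++ t) = box s `&` box t.
Proof.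
elim: s => [|e s IH]; last by rewrite /= !box_cons IH setIA.
by rewrite (_ : box [::] = setT) ?setTI//; apply/seteqP; split.
Qed.

Lemma measurable_box s : measurable (box s).
Proof.
elim: s => [|e s IH]; first by rewrite (_ : box [::] = setT)//; apply/seteqP; split.
rewrite box_cons; apply: measurableI => //.
rewrite (_ : [set w | _] = (fun w : env => w e.1.1 e.1.2) @^-1` `]ratr e.2.1,
  ratr e.2.2[%classic).
  exact: (measurable_preimage (measurable_env_prob _ _) (measurable_itv _)).
by apply/seteqP; split=> w; rewrite /= in_itv.
Qed.

Lemma row_local_box (l : 'rV[R]_d) s : exists k : nat, forall K : nat, (k <= K)%N ->
  forall w, box s (cut_env l K%:R w) <-> box s w.
Proof.
have [k kP] : exists k : nat, forall e, e \in s -> - k%:R <= height l e.1.1.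
  elim: s => [|e s [k IH]]; first by exists 0%N.
  have [m hm] := nat_upper_bound (- height l e.1.1); exists (maxn k m) => f.
  rewrite inE => /predU1P[->|/IH]; first by rewrite lerNl
    (le_trans hm)// ler_nat leq_maxr.
  by apply: le_trans; rewrite lerN2 ler_nat leq_maxl.
exists k => K kK w; split=> h e es; have := h e es; rewrite /= ifT//;
  by apply: le_trans (kP e es); rewrite lerN2 ler_nat.
Qed.

(* The sets containing a rational box around [w] form a filter finer than the
   neighbourhoods of [w]. *)
Lemma continuous_box (F : env -> R) (w : env) (v : R) : continuous F -> v < F w ->
  exists s, box s w /\ forall w', box s w' -> v < F w'.
Proof.
move=> cF vF.
pose B : set_system env := filter_from [set s | box s w] box.
have FB : Filter B.
  apply: filter_from_filter; first by exists [::].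
  by move=> s t sw tw; exists (s ++ t); rewrite /= box_cat.
have Bw : B --> w.
  have cvij i j : (fun w' : env => w' i j) @ B --> w i j.
    apply/cvgrPdist_lt => e e0.
    have [a /andP[a1 a2]] : exists a : rat, w i j - e < ratr a < w i j.
      have : w i j - e < w i j by rewrite ltrBlDr ltrDl.
      by move=> /rat_in_itvoo[a]; rewrite in_itv /=; exists a.
    have [b /andP[b1 b2]] : exists b : rat, w i j < ratr b < w i j + e.
      have : w i j < w i j + e by rewrite ltrDl.
      by move=> /rat_in_itvoo[b]; rewrite in_itv /=; exists b.
    exists [:: ((i, j), (a, b))].
      by move=> f; rewrite inE => /eqP -> /=; rewrite a2 b1.
    move=> w' /(_ _ (mem_head _ _)) /= /andP[h1 h2].
    by rewrite ltr_norml; apply/andP; split; lra.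
  have cv : @env_curry R d @ B --> env_curry w.
    apply/cvg_sup => -[i j] U [V] [[W] oW <-] WfN WU.
    apply: (filterS WU); apply: (cvij i j); exact: open_nbhs_nbhs.
  move=> A [_ [[U oU <-] Uw] UA].
  have /cv : nbhs (env_curry w : {ptws site * site -> R}) U by apply: open_nbhs_nbhs.
  by move=> [s sw sU]; exists s => //; apply: subset_trans UA.
have /Bw [s sw sF] : nbhs w [set w' | v < F w'].
  have : nbhs (F w) [set y | v < y] by apply: open_nbhs_nbhs; split; [exact: open_gt|].
  exact: cF.
by exists s.
Qed.

Section approximation.
Variables (F : env -> R).
Hypothesis F_ge0 : forall w, 0 <= F w.

(** Nonnegative rational multiples of box indicators lying below [F], whose supremum is [F] if [F]
    is continuous. The remaining codes get the harmless value 0. *)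
Let tile (sv : box_code * rat) (w : env) : R :=
  if `[< 0 <= ratr sv.2 :> R /\ forall w', box sv.1 w' -> ratr sv.2 <= F w' >]
  then ratr sv.2 * \1_(box sv.1) w else 0.

Let tile_le sv w : tile sv w <= F w.
Proof.
rewrite /tile; case: asboolP => // -[v0 vF]; rewrite indicE.
have [sw|sw] := pselect (box sv.1 w); first by rewrite mem_set// mulr1; exact: vF.
by rewrite memNset// mulr0.
Qed.

Let measurable_tile sv : measurable_fun setT (tile sv).
Proof.
rewrite /tile; case: asboolP => _; last exact: measurable_cst.
by apply: measurable_funM => //; apply: measurable_indic; exact: measurable_box.
Qed.

Fixpoint box_approx (n : nat) (w : env) : R :=
  if n is m.+1 then
    Num.max (box_approx m w) (oapp (tile ^~ w) 0 (@pickle_inv (box_code * rat)%type m))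
  else 0.

Lemma box_approx_ge0 n w : 0 <= box_approx n w.
Proof. by elim: n => [//|n IH] /=; rewrite le_max IH. Qed.

Lemma box_approx_le n w : box_approx n w <= F w.
Proof.
elim: n => [//|n IH] /=; rewrite ge_max IH /=.
by case: pickle_inv => //= sv; exact: tile_le.
Qed.

Lemma box_approx_homo w : {homo box_approx ^~ w : m n / (m <= n)%N >-> m <= n}.
Proof.
apply: homo_leq; [exact: lexx|exact: le_trans|].
by move=> n /=; rewrite le_max lexx.
Qed.

Lemma measurable_box_approx n : measurable_fun setT (box_approx n).
Proof.
elim: n => [|n IH] /=; first exact: measurable_cst.
apply: measurable_maxr => //; case: pickle_inv => [sv|] /=; last exact: measurable_cst.
exact: measurable_tile.
Qed.

Lemma row_local_box_approx l n : exists k : nat, forall K : nat, (k <= K)%N ->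
  forall w, box_approx n (cut_env l K%:R w) = box_approx n w.
Proof.
elim: n => [|n [k IH]]; first by exists 0%N.
case E : (@pickle_inv (box_code * rat)%type n) => [sv|]; last first.
  by exists k => K kK w /=; rewrite E /= IH.
have [m mP] := row_local_box l sv.1; exists (maxn k m) => K.
rewrite geq_max => /andP[kK mK] w /=; rewrite E /= IH//; congr Num.max.
rewrite /tile; case: asboolP => // _; congr (_ * _); rewrite !indicE.
by congr (nat_of_bool _)%:R; apply/idP/idP => /set_mem h; apply/mem_set;
  apply/(mP K mK w).
Qed.

Lemma box_approx_cvg w : continuous F -> box_approx n w @[n --> \oo] --> F w.
Proof.
move=> cF; apply/cvgrPdist_le => e e0.
suff [n0 n0P] : exists n0, F w - e <= box_approx n0 w.
  exists n0 => // n n0n; have h := box_approx_homo w n0n; have h' := box_approx_le n w.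
  by rewrite ler_norml; apply/andP; split; lra.
(* The initial value 0 settles the first case; in the second the rational [v] is positive, as [tile]
   requires. *)
have [neg|nneg] := ltP (F w - e) 0; first by exists 0%N => /=; exact: ltW.
have [v /andP[v1 v2]] : exists v : rat, F w - e < ratr v < F w.
  have : F w - e < F w by rewrite ltrBlDr ltrDl.
  by move=> /rat_in_itvoo[v]; rewrite in_itv /=; exists v.
have [s [sw sF]] := continuous_box cF v2.
exists (pickle (s, v)).+1; rewrite /= pickleK_inv /= le_max; apply/orP; right.
rewrite /tile asboolT/=; last first.
  by split; [exact: le_trans nneg (ltW v1)|move=> w' /sF/ltW].
by rewrite indicE mem_set// mulr1 ltW.
Qed.

End approximation.
End boxes.

(** * Empirical measures *)

Section empirical_measures.
Context {R : realType} {d : nat}.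
Local Notation site := (site d).
Local Notation path := (traj site).
Local Notation env := (env R d).

Section empirical_measure.
Variable P : probability env R.
Local Notation QP := (annealed_law P 0).

Let visit i : {measure set env -> \bar R} := push_measure QP
  (measurable_env_process_at i.+1).

(** The index is shifted by one because [empirical P 0] is zero and not a probability. *)
Definition empirical_measure (n : nat) : set env -> \bar R :=
  mscale (n.+1%:R^-1)%:nng (msum visit n.+1).

HB.instance Definition _ n := Measure.on (empirical_measure n).

Lemma empiricalE n : empirical P n.+1 = empirical_measure n.
Proof.
apply/funext => A; rewrite /empirical /empirical_measure /mscale /msum /=.
by rewrite big_add1 big_mkord.
Qed.

Let empirical_measureT n : empirical_measure n setT = 1%E.
Proof.
rewrite /empirical_measure /mscale /= /msum.
rewrite (eq_bigr (fun=> 1%E)); last first.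
  by move=> i _; rewrite /visit /= /pushforward preimage_setT; exact:
    (probability_setT QP).
by rewrite sumEFin sumr_const card_ord -EFinM mulVf.
Qed.

HB.instance Definition _ n := Measure_isProbability.Build _ _ _
  (empirical_measure n) (empirical_measureT n).

Lemma Rintegral_empirical n (g : env -> R) : bounded_measurable g -> (forall w,
  0 <= g w) ->
  \int[empirical_measure n]_w g w =
  \int[QP]_z (birkhoff_sum theta ((g \o fst) \o theta) n.+1 z / n.+1%:R).
Proof.
move=> [mg [C gC]] g0; congr fine.
have mgE : measurable_fun setT (EFin \o g) by exact/measurable_EFinP.
have mv i : measurable_fun setT (fun z : env * path => g (env_process z i)).
  exact: (measurableT_comp mg (measurable_env_process_at i)).
rewrite ge0_integral_mscale//; last by move=> w _; rewrite lee_fin.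
rewrite ge0_integral_measure_sum//; last by move=> w _; rewrite lee_fin.
transitivity (\int[QP]_z ((n.+1%:R^-1)%:E * \sum_(i < n.+1) (g
  (env_process z i.+1))%:E))%E.
  have mvE (i : 'I_n.+1) : measurable_fun setT (fun z : env * path => (g
    (env_process z i.+1))%:E).
    by apply/measurable_EFinP; exact: mv.
  have mS : measurable_fun setT (fun z : env * path => \sum_(i < n.+1) (g
    (env_process z i.+1))%:E)%E.
    exact: (emeasurable_sum _ mvE).
  rewrite (ge0_integralZl QP measurableT mS); last 2 first.
  - by move=> z _; apply: sume_ge0 => i _; rewrite lee_fin.
  - by rewrite lee_fin.
  congr (_ * _)%E; rewrite (ge0_integral_sum QP measurableT mvE); last first.
    by move=> i z _; rewrite lee_fin.
  apply: eq_bigr => i _.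
  by apply: (ge0_integral_pushforward
    (measurable_env_process_at i.+1) QP measurableT mgE) => w _; rewrite lee_fin.
transitivity (\int[QP]_z (n.+1%:R^-1 * \sum_(i < n.+1) g (env_process z i.+1))%:E)%E.
  by apply: eq_integral => z _; rewrite EFinM -sumEFin.
have bg1 : bounded_measurable (g \o fst : env * path -> R).
  by split; [exact: (measurableT_comp mg measurable_fst)|exists C => z; exact: gC].
have mb : measurable_fun setT (birkhoff_sum theta
  ((g \o fst) \o theta) n.+1 : env * path -> R).
  apply: measurable_birkhoff_sum; first exact: measurable_theta.
  by case: (bmeas_theta measurable_theta bg1).
have mS0 := @measurable_start_neq0 R d.
apply: ae_eq_integral => //.
- by apply/measurable_EFinP; apply: measurable_funM => //; apply: measurable_sum => i;
  exact: mv.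
- by apply/measurable_EFinP; apply: measurable_funM.
(* [theta] shifts by $X_j-X_0$ and [env_process] by $X_j$, so the two averages agree on paths
   started at 0. *)
exists [set z : env * path | z.2 0%N <> 0]; split => //; first exact: annealed_start.
move=> z /= ne z0; apply: ne => _; rewrite mulrC; congr ((_ / _)%:E).
apply: eq_bigr => j _; congr (g _).
by rewrite -(env_process_iter_theta (nat_of_ord j).+1 z0).
Qed.

Lemma integral_empirical n (f : env -> R) : bounded_measurable f ->
  (\int[empirical P n.+1]_w (f w)%:E = (\int[empirical_measure n]_w f w)%:E)%E.
Proof.
move=> bf; rewrite empiricalE fineK//.
exact: (integrable_fin_num measurableT (bmeas_integrable (empirical_measure n) bf)).
Qed.

End empirical_measure.

Lemma birkhoff_sum_bound dT (T : measurableType dT) (theta : T -> T) (f : T -> R) C n z :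
  (forall z, `|f z| <= C) -> `|birkhoff_sum theta f n z| <= n%:R * C.
Proof.
move=> fC; apply: le_trans (ler_norm_sum _ _ _) _.
apply: (@le_trans _ _ (\sum_(j < n) C)); first by apply: ler_sum.
by rewrite sumr_const card_ord mulr_natl.
Qed.

Variables (l : 'rV[R]_d) (P : probability env R).
Hypothesis P_inv : shift_invariant P.
Hypothesis P_erg : shift_ergodic P.
Hypothesis P_elliptic : forall e, good_step l e -> P [set w : env | w 0 e = 0] = 0%E.
Hypothesis P_transient : transient_law l P.
Hypothesis l_neq0 : l != 0.

Definition invariant_ac (Pinf : probability env R) := env_process_invariant Pinf /\
  forall (k : nat) A, sigma_rows l k%:R A -> P A = 0%E -> Pinf A = 0%E.

(** Against the empirical measure, [g] integrates to the annealed mean of a Birkhoff average, which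
    converges almost surely under [P] by locality; bounded convergence concludes. *)
Lemma empirical_cvg_local Pinf (g : env -> R) (k : nat) : invariant_ac Pinf ->
  bounded_measurable g -> (forall w, 0 <= g w) ->
  (forall w, g (cut_env l k%:R w) = g w) ->
  \int[empirical_measure P n]_w g w @[n --> \oo] --> \int[Pinf]_w g w.
Proof.
move=> [Pinf_inv Pinf_ac] bg g0 gk.
have [mg [C gC]] := bg.
pose f : env * path -> R := g \o fst.
have bf : bounded_measurable f.
  by split; [exact: (measurableT_comp mg measurable_fst)|exists C => z; exact: gC].
have bft := bmeas_theta measurable_theta bf.
have cE : \int[annealed_law Pinf 0]_z (f \o theta) z = \int[Pinf]_w g w.
  rewrite (Rintegral_theta measurable_theta (theta_preserving Pinf_inv) bf).
  congr fine; rewrite (annealed_fubini Pinf (f := EFin \o f)).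
  - apply: eq_integral => w _ /=.
    transitivity (\int[qlaw w]_X (cst (g w)%:E X))%E => //.
    by rewrite integral_cst//= qlawT mule1.
  - by apply/measurable_EFinP; case: bf.
  - by move=> z; rewrite lee_fin; exact: g0.
have lf : local_event l (birkhoff_cvg theta (f \o theta) (\int[annealed_law Pinf 0]_z
  (f \o theta) z)).
  by apply: (@local_birkhoff_cvg_theta _ _ l k) => w X; exact: gk.
have N0 := law_of_large_numbers P_inv P_erg P_elliptic P_transient Pinf_inv Pinf_ac
  l_neq0 bft lf.
have mL : measurable (birkhoff_cvg theta (f \o theta) (\int[annealed_law Pinf 0]_z
  (f \o theta) z)).
  by apply: measurable_birkhoff_cvg; [exact: measurable_theta|case: bft].
rewrite cE in N0 mL.
under eq_fun do rewrite Rintegral_empirical//.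
apply: (@Rintegral_bounded_ae_cvg _ _ _ _ _ _ C _ _ _ (measurableC mL) N0).
- move=> n; apply: measurable_funM => //.
  by apply: measurable_birkhoff_sum; [exact: measurable_theta|case: bft].
- move=> n z; rewrite normrM normfV normr_nat ler_pdivrMr// mulrC.
  by apply: birkhoff_sum_bound => z'; exact: gC.
- move=> z /contrapT; rewrite /birkhoff_cvg /= => h.
  by have := h; rewrite -cvg_shiftS.
Qed.

(** On the union of the [sigma_rows k], a generating pi-system, both measures are limits of the same
    empirical measures, which depend on [P] alone. *)
Lemma invariant_ac_unique Pinf Pinf' : invariant_ac Pinf -> invariant_ac Pinf' ->
  forall A, measurable A -> Pinf' A = Pinf A.
Proof.
move=> h h'.
pose G := [set A : set env | exists k : nat, sigma_rows l k%:R A].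
have G_le (k K : nat) A : (k <= K)%N -> sigma_rows l k%:R A -> sigma_rows l K%:R A.
  move=> kK /sigma_rowsP[mA Ak]; apply/sigma_rowsP; split => //.
  rewrite -[in LHS]Ak -[in RHS]Ak; apply/funext => w; rewrite /preimage /=.
  by rewrite cut_cut// ler_nat.
apply: (@measure_unique _ _ _ G (fun=> setT)).
- apply/seteqP; split; last first.
    apply: smallest_sub; first exact: sigma_algebra_measurable.
    by move=> A [k /sigma_rowsP[]].
  apply: smallest_sub; first exact: smallest_sigma_algebra.
  move=> _ [x [j [B [_ mB ->]]]]; apply: sub_sigma_algebra.
  have [k kx] := nat_upper_bound (- height l x); exists k.
  by apply: sub_sigma_algebra; exists x, j, B; split => //=; rewrite lerNl.
- move=> A B [k kA] [m mB]; exists (maxn k m).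
  have /sigma_rowsP[mA Ak] := G_le _ _ _ (leq_maxl k m) kA.
  have /sigma_rowsP[mB' Bm] := G_le _ _ _ (leq_maxr k m) mB.
  by apply/sigma_rowsP; split; [exact: measurableI|rewrite preimage_setI Ak Bm].
- by move=> n; exists 0%N; apply/sigma_rowsP.
- by apply/seteqP; split=> // w _; exists 0%N.
- move=> A [k /sigma_rowsP[mA Ak]].
  have bA : bounded_measurable (\1_A : env -> R) by exact: bmeas_indic.
  have A0 w : 0 <= \1_A w :> R by rewrite indicE.
  have Acut w : \1_A (cut_env l k%:R w) = \1_A w :> R.
    by rewrite -[in RHS]Ak.
  have c := empirical_cvg_local h bA A0 Acut.
  have c' := empirical_cvg_local h' bA A0 Acut.
  have := cvg_unique _ c c'; rewrite !Rintegral_indic// => E.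
  by rewrite -[LHS]fineK ?fin_num_measure// -[RHS]fineK ?fin_num_measure// E.
- by move=> n; apply: (@le_lt_trans _ _ 1%E); [exact: probability_le1|exact: ltry].
Qed.

Let squeeze_lower (a b c x e : R) :
  `|c - x| <= e / 2 -> `|x - a| <= e / 2 -> a <= b -> c - e <= b.
Proof. rewrite !ler_norml => /andP[h1 h2] /andP[h3 h4] h5; lra. Qed.

(** An increasing local approximation yields lower bounds only; the upper bounds come from applying
    this to a constant minus the function. The same approximation also supplies measurability of
    continuous functions. *)
Lemma weak_lower_bound Pinf (F : env -> R) (C e : R) : invariant_ac Pinf ->
  continuous F -> (forall w, 0 <= F w) -> (forall w, F w <= C) -> 0 < e ->
  bounded_measurable F /\
  \forall n \near \oo, \int[Pinf]_w F w - e <= \int[empirical_measure P n]_w F w.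
Proof.
move=> h cF F0 FC e0.
have mF : measurable_fun setT F.
  apply: (measurable_fun_cvg (fun n => measurable_box_approx F n)) => w _.
  exact: box_approx_cvg.
have bF : bounded_measurable F by split=> //; exists C => w; rewrite ger0_norm.
have bA n : bounded_measurable (box_approx F n).
  split; first exact: measurable_box_approx.
  exists C => w; rewrite ger0_norm ?box_approx_ge0//.
  exact: le_trans (box_approx_le F0 _ _) (FC w).
split=> //.
have c1 : \int[Pinf]_w box_approx F n w @[n --> \oo] --> \int[Pinf]_w F w.
  apply: (@Rintegral_bounded_cvg _ _ _ _ _ _ C).
  - by move=> n; exact: measurable_box_approx.
  - move=> n w; rewrite ger0_norm ?box_approx_ge0//.
    exact: le_trans (box_approx_le F0 _ _) (FC w).
  - by move=> w; exact: box_approx_cvg.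
have e2 : 0 < e / 2 by rewrite divr_gt0.
have [n _ /(_ n (leqnn n)) hn] := (cvgrPdist_le _ _).1 c1 _ e2.
have [k kP] := row_local_box_approx F l n.
have c2 := empirical_cvg_local h (bA n) (box_approx_ge0 F n) (kP k (leqnn k)).
have [N _ hN] := (cvgrPdist_le _ _).1 c2 _ e2.
exists N => // m Nm; apply: squeeze_lower hn (hN m Nm) _.
apply: le_Rintegral => //.
- exact: (bmeas_integrable _ (bA n)).
- exact: (bmeas_integrable _ bF).
by move=> w _; exact: box_approx_le.
Qed.

Lemma empirical_cvg_weakly Pinf : invariant_ac Pinf -> cvg_weakly (empirical P) Pinf.
Proof.
move=> h f cf [C fC].
have C0 : 0 <= C by apply: le_trans (fC point); exact: normr_ge0.
have fle w : - C <= f w <= C by rewrite -ler_norml.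
(* Both functions are nonnegative; the lower bounds for [F1] and [F2] are the lower and upper bounds
   for [f]. *)
pose F1 w := C + f w; pose F2 w := C - f w.
have cC (w : env) : (fun _ : env => C) @ nbhs w --> C by exact: (@cvg_cst _ C _
  (nbhs w) (nbhs_filter w)).
have cF1 : continuous F1 by move=> w; exact: (cvgD (cC w) (cf w)).
have cF2 : continuous F2 by move=> w; exact: (cvgB (cC w) (cf w)).
have F10 w : 0 <= F1 w by rewrite /F1; have := fle w; lra.
have F20 w : 0 <= F2 w by rewrite /F2; have := fle w; lra.
have F1C w : F1 w <= C + C by rewrite /F1; have := fle w; lra.
have F2C w : F2 w <= C + C by rewrite /F2; have := fle w; lra.
have [bF1 _] := weak_lower_bound h cF1 F10 F1C ltr01.
have bf : bounded_measurable f.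
  have [mg D] := bmeasB bF1 (bmeas_cst _ C); split; last by exists C.
  by move: mg; congr (measurable_fun _ _); apply/funext => w; rewrite /F1; ring.
have bC := bmeas_cst _ C : bounded_measurable (fun _ : env => C).
have I1 (Q : probability env R) : \int[Q]_w F1 w = C + \int[Q]_w f w.
  rewrite RintegralD//;
    [by rewrite Rintegral_prob_cst|exact: bmeas_integrable|exact: bmeas_integrable].
have I2 (Q : probability env R) : \int[Q]_w F2 w = C - \int[Q]_w f w.
  rewrite RintegralB//;
    [by rewrite Rintegral_prob_cst|exact: bmeas_integrable|exact: bmeas_integrable].
rewrite -cvg_shiftS.
rewrite (_ : (fun n => _) = EFin \o (fun n => \int[empirical_measure P n]_w f w));
  last first.
  by apply/funext => n; exact: integral_empirical.
have -> : (\int[Pinf]_w (f w)%:E = (\int[Pinf]_w f w)%:E)%E.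
  by rewrite fineK//; exact: (integrable_fin_num measurableT (bmeas_integrable Pinf bf)).
apply: cvg_EFin; first exact: nearW.
apply/cvgrPdist_le => e e0.
have [_ [N1 _ h1]] := weak_lower_bound h cF1 F10 F1C e0.
have [_ [N2 _ h2]] := weak_lower_bound h cF2 F20 F2C e0.
exists (maxn N1 N2) => // n /=; rewrite geq_max => /andP[n1 n2].
have := h1 n n1; have := h2 n n2; rewrite !I1 !I2 ler_norml => k1 k2.
by apply/andP; split; lra.
Qed.

End empirical_measures.

(** * Displacement and drift *)

Lemma row_cvg (R : realType) (d : nat) (u : nat -> 'rV[R]_d) (v : 'rV[R]_d) :
  (forall i, u n 0 i @[n --> \oo] --> v 0 i) -> u n @[n --> \oo] --> v.
Proof.
move=> uv A [B vB sBA].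
have : \forall n \near \oo, forall i, B 0 i (u n 0 i).
  by apply: filter_forall => i; exact: (uv i _ (vB 0 i)).
by apply: filterS => n Bn; apply: sBA => j i; rewrite (ord1 j).
Qed.

Section displacement.
Context {R : realType} {d : nat}.
Local Notation site := (site d).
Local Notation path := (traj site).
Local Notation env := (env R d).

Lemma coord_le_enorm (x : site) i : `|(x 0 i)%:~R| <= enorm (site_vec x : 'rV[R]_d).
Proof.
rewrite -(sqrtr_sqr ((x 0 i)%:~R : R)) /enorm; apply: ler_wsqrtr.
rewrite /dot (bigD1 i)//= !mxE expr2 lerDl; apply: sumr_ge0 => j _.
by rewrite -expr2 sqr_ge0.
Qed.

Lemma qlaw_null_step (w : env) n : qlaw w [set X : path | w (X n) (X n.+1) = 0] = 0%E.
Proof.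
pose F (t : seq site) := if `[< w (nth 0 t n) (nth 0 t n.+1) = 0 >]
  then path_cyl n.+1 (nth 0 t) else set0.
have mF t : measurable (F t) by rewrite /F; case: ifP => _ //; exact: measurable_path_cyl.
have F0 t : qlaw w (F t) = 0%E.
  rewrite /F; case: asboolP => [h|_]; last by rewrite measure0.
  by rewrite qlaw_cyl big_ord_recr /= h !mulr0.
have mU : measurable (\bigcup_(t in [set: seq site]) F t).
  exact: countable_bigcupT_measurable.
apply: null_subset (null_bigcup_count mF F0) => //.
  rewrite (_ : [set X | _] = [set X : path | [set t : seq site |
     w (nth 0 t n) (nth 0 t n.+1) = 0] (mkseq X n.+2)]); last first.
    by apply/funext => X; rewrite /mkset !nth_mkseq.
  exact: measurable_mkseq.
move=> X /= wX; exists (mkseq X n.+2) => //.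
rewrite /F asboolT; last by rewrite !nth_mkseq.
by move=> k kn; rewrite nth_mkseq.
Qed.

Definition range_below (M : R) : set env :=
  [set w | forall i j, M < enorm (site_vec (i - j)) -> w i j = 0].

Definition first_step (z : env * path) : site := z.2 1%N - z.2 0%N.

Lemma measurable_first_step : measurable_fun setT first_step.
Proof. exact: (measurable_site_comp2 (fun a b => a - b) (measurable_coord 1)
  (measurable_coord 0)). Qed.

Lemma first_step_iter j (z : env * path) :
  first_step (iter j theta z) = z.2 j.+1 - z.2 j.
Proof.
rewrite iter_theta /first_step /= add1n add0n; move: (z.2 j - z.2 0%N) => t.
by rewrite opprB addrA subrK.
Qed.

Lemma qlaw_first_step_eq (w : env) e : qlaw w [set X | first_step (w, X) = e] =
  (w 0 e)%:E.
Proof.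
rewrite -qlaw_step; apply: qlaw_eq_start.
- exact: (measurable_sec (E := first_step @^-1` [set e]) w
  (measurable_preimage measurable_first_step I)).
- exact: measurable_path_at 1 [set e].
- by move=> X X0; rewrite /first_step /= X0 subr0.
Qed.

Section mean_step.
Variables (phi : site -> R) (C : R).
Hypothesis phi_ge0 : forall e, 0 <= phi e.
Hypothesis phi_le : forall e, phi e <= C.

(** Restricted to nonnegative bounded [phi], where the sum always makes sense; signed steps are
    treated as differences of two such means. *)
Definition mean_step (w : env) : \bar R := \esum_(e in [set: site]) (w 0 e * phi e)%:E.

Lemma mean_stepE w : (\int[qlaw w]_X (phi (first_step (w, X)))%:E = mean_step w)%E.
Proof.
have mfib (e : site) : measurable ((fun X => first_step (w, X)) @^-1` [set e]).
  exact: (measurable_sec (E := first_step @^-1` [set e]) w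
    (measurable_preimage measurable_first_step I)).
rewrite (integral_comp_fibers (qlaw w) mfib (f := fun e => (phi e)%:E)); last first.
  by move=> e; rewrite lee_fin.
by apply: eq_esum => e _; rewrite EFinM; congr (_ * _)%E; exact: qlaw_first_step_eq.
Qed.

Lemma mean_step_ge0 w : (0 <= mean_step w)%E.
Proof. by apply: esum_ge0 => e _; rewrite lee_fin mulr_ge0// env_ge0. Qed.

Lemma measurable_phi_step : measurable_fun setT (fun z : env * path => phi
  (first_step z)).
Proof.
apply: (measurable_comp_fibers (g := first_step)) => e.
exact: (measurable_preimage measurable_first_step).
Qed.

Lemma mean_step_le w : (mean_step w <= C%:E)%E.
Proof.
rewrite -mean_stepE; apply: (@le_trans _ _ (\int[qlaw w]_X (cst C%:E X))%E); last first.
  by rewrite integral_cst//= qlawT mule1.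
apply: ge0_le_integral => //.
- by move=> X _; rewrite lee_fin.
- apply/measurable_EFinP; apply: (measurableT_comp measurable_phi_step).
  by apply: measurable_fun_pair => //; exact: measurable_cst.
- by move=> X _; rewrite lee_fin.
Qed.

Lemma mean_step_fin w : mean_step w \is a fin_num.
Proof.
by rewrite ge0_fin_numE ?mean_step_ge0// (le_lt_trans (mean_step_le w))// ltry.
Qed.

Lemma measurable_mean_step : measurable_fun setT mean_step.
Proof.
rewrite (_ : mean_step = fun w => \sum_(n <oo)
    oapp (fun e : site => (w 0%R e * phi e)%:E) 0 (@pickle_inv site n))%E; last first.
  apply/funext => w; rewrite /mean_step esum_pickle// => e.
  by rewrite lee_fin mulr_ge0// env_ge0.
apply: ge0_emeasurable_sum => [n w _ _|n _]; case: pickle_inv => [e|] //=.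
  by rewrite lee_fin mulr_ge0// env_ge0.
apply/measurable_EFinP; apply: measurable_funM => //; exact: measurable_env_prob.
Qed.

Lemma bmeas_mean_step : bounded_measurable (fine \o mean_step).
Proof.
split; first exact: (measurableT_comp (fine_measurable measurableT) measurable_mean_step).
exists C => w; rewrite /= ger0_norm; last exact/fine_ge0/mean_step_ge0.
by rewrite -lee_fin fineK ?mean_step_fin//; exact: mean_step_le.
Qed.

Lemma bmeas_phi_step : bounded_measurable (fun z : env * path => phi (first_step z)).
Proof.
by split; [exact: measurable_phi_step|exists C => z; rewrite ger0_norm].
Qed.

Lemma Rintegral_first_step (mu : probability env R) :
  \int[annealed_law mu 0]_z phi (first_step z) = \int[mu]_w fine (mean_step w).
Proof.
congr fine; rewrite (annealed_fubini mu (f := fun z => (phi (first_step z))%:E)).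
- by apply: eq_integral => w _; rewrite mean_stepE fineK// mean_step_fin.
- by apply/measurable_EFinP; exact: measurable_phi_step.
- by move=> z; rewrite lee_fin.
Qed.

End mean_step.

(** Almost everywhere arguments ask for measurability on all environments, also on those where the
    sum defining the drift does not converge absolutely. *)
Lemma measurable_drift (i : 'I_d) : measurable_fun setT (fun w : env => drift w 0 i).
Proof.
rewrite (_ : (fun w => _) = fun w : env =>
  site_sum (fun e : site => (e 0 i)%:~R * w 0 e)); last by apply/funext => w; rewrite mxE.
apply: (measurableT_comp (fine_measurable measurableT)).
have mg (e : site) : measurable_fun setT (fun w : env => ((e 0 i)%:~R * w 0 e)%:E).
  apply/measurable_EFinP; apply: measurable_funM => //; exact: measurable_env_prob.
have mesum (h : site -> env -> \bar R) : (forall e, measurable_fun setT (h e)) ->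
    (forall e w, 0 <= h e w)%E ->
    measurable_fun setT (fun w => \esum_(e in [set: site]) h e w).
  move=> mh h0; rewrite (_ : (fun w => _) = fun w => (\sum_(n <oo)
      oapp (fun e : site => h e w) 0 (@pickle_inv site n)))%E; last first.
    by apply/funext => w; rewrite esum_pickle.
  by apply: ge0_emeasurable_sum => [n w _ _|n _]; case: pickle_inv => [e|] //=.
apply: emeasurable_funB; apply: mesum.
- move=> e; have := measurable_funepos (mg e); congr (measurable_fun _ _).
  by apply/funext => w; rewrite !funeposE.
- by move=> e w; exact: funepos_ge0.
- move=> e; have := measurable_funeneg (mg e); congr (measurable_fun _ _).
  by apply/funext => w; rewrite !funenegE.
- by move=> e w; exact: funeneg_ge0.
Qed.

End displacement.

Lemma row_coord_cvg (R : realType) (d : nat) (u : nat -> 'rV[R]_d) (v : 'rV[R]_d) i :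
  u n @[n --> \oo] --> v -> u n 0 i @[n --> \oo] --> v 0 i.
Proof.
move=> uv B vB; apply: (uv [set N : 'rV[R]_d | B (N 0 i)]).
exists (fun _ j => if j == i then B else setT).
  by move=> j k; rewrite (ord1 j); case: eqP => [->|_] //; exact: filterT.
by move=> N /(_ 0 i); rewrite eqxx.
Qed.

Section position.
Context {R : realType} {d : nat}.
Local Notation site := (site d).
Local Notation path := (traj site).
Local Notation env := (env R d).
Variables (M : R) (M_ge0 : 0 <= M).

(** Finite range holds only almost surely, whereas the ergodic theorem is used for functions bounded
    everywhere. Clipping is invisible on steps of length at most [M]. *)
Definition clipped_coord (i : 'I_d) (e : site) : R :=
  if enorm (site_vec e : 'rV[R]_d) <= M then (e 0 i)%:~R else 0.

Lemma clipped_coord_le i e : `|clipped_coord i e| <= M.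
Proof.
rewrite /clipped_coord; case: ifP => [eM|_]; last by rewrite normr0.
exact: le_trans (coord_le_enorm e i) eM.
Qed.

Let pos i e := Num.max (clipped_coord i e) 0.
Let neg i e := Num.max (- clipped_coord i e) 0.

Let pos_ge0 i e : 0 <= pos i e. Proof. by rewrite le_max lexx orbT. Qed.
Let neg_ge0 i e : 0 <= neg i e. Proof. by rewrite le_max lexx orbT. Qed.

Let pos_le i e : pos i e <= M.
Proof. by rewrite ge_max M_ge0 andbT (le_trans (ler_norm _))// clipped_coord_le. Qed.

Let neg_le i e : neg i e <= M.
Proof.
by rewrite ge_max M_ge0 andbT (le_trans (ler_norm _))// normrN clipped_coord_le.
Qed.

Let clipE i e : clipped_coord i e = pos i e - neg i e.
Proof.
rewrite /pos /neg; move: (clipped_coord i e) => x.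
by case: (leP x 0) => h1; case: (leP (- x) 0) => h2; lra.
Qed.

(** The finite range condition on the row of the origin alone. It lies in [sigma_rows l 0], so it
    passes from [P] to [Pinf], and this row determines the drift. *)
Definition range_below0 : set env :=
  [set w | forall j, M < enorm (site_vec (0 - j) : 'rV[R]_d) -> w 0 j = 0].

Lemma sigma_rows_range_below0 l : sigma_rows l 0 range_below0.
Proof.
apply/sigma_rowsP; split.
  rewrite (_ : range_below0 = \bigcap_(j in [set: site])
    (if M < enorm (site_vec
      (0 - j) : 'rV[R]_d) then [set w : env | w 0 j = 0] else setT)).
    rewrite -[\bigcap_(_ in _) _]setCK setC_bigcap; apply: measurableC.
    apply: countable_bigcupT_measurable => // j; apply: measurableC.
    by case: ifP => // _; exact: measurable_env_eq0.
  apply/seteqP; split=> w h j.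
    by move=> _; case: ifP => // jM; exact: h.
  by move=> jM; have := h j I; rewrite jM.
by apply/seteqP; split=> w h j jM; have := h j jM; rewrite /= height0 oppr0 lexx.
Qed.

Lemma drift_mean_step i (w : env) : range_below0 w ->
  drift w 0 i = fine (mean_step (pos i) w) - fine (mean_step (neg i) w).
Proof.
move=> w0; rewrite mxE /site_sum -fineB; last 2 first.
- exact: (mean_step_fin (pos_ge0 i) (pos_le i)).
- exact: (mean_step_fin (neg_ge0 i) (neg_le i)).
have clip (e : site) : (e 0 i)%:~R * w 0 e = w 0 e * clipped_coord i e.
  rewrite mulrC /clipped_coord; case: leP => // eM.
  by rewrite w0 ?mul0r// sub0r enormN.
congr (fine (_ - _)); apply: eq_esum => e _.
  rewrite funeposE /= clip -EFin_max; congr (_%:E).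
  by rewrite maxr_pMr ?env_ge0// mulr0.
rewrite funenegE /= clip -EFin_max; congr (_%:E).
by rewrite -mulrN maxr_pMr ?env_ge0// mulr0.
Qed.

Lemma bmeas_clipped_step i : bounded_measurable (fun z : env * path => clipped_coord i
  (first_step z)).
Proof.
have := bmeasB (bmeas_phi_step (pos_ge0 i) (pos_le i)) (bmeas_phi_step (neg_ge0 i)
  (neg_le i)).
by congr bounded_measurable; apply/funext => z; rewrite clipE.
Qed.

(** Given an environment in [range_below0], the first step has mean equal to the drift. *)
Lemma Rintegral_clipped_step (mu : probability env R) i :
  mu (~` range_below0) = 0%E ->
  \int[annealed_law mu 0]_z clipped_coord i (first_step z) =
  fine ('E_mu[fun w => drift w 0 i]).
Proof.
move=> r0.
have bp := bmeas_phi_step (pos_ge0 i) (pos_le i).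
have bn := bmeas_phi_step (neg_ge0 i) (neg_le i).
have bmp := bmeas_mean_step (pos_ge0 i) (pos_le i).
have bmn := bmeas_mean_step (neg_ge0 i) (neg_le i).
have /sigma_rowsP[mR _] := @sigma_rows_range_below0 0.
transitivity (\int[annealed_law mu 0]_z (pos i (first_step z) - neg i (first_step z))).
  by apply: eq_Rintegral => z _; rewrite clipE.
rewrite (RintegralB measurableT (bmeas_integrable _ bp) (bmeas_integrable _ bn)).
rewrite (Rintegral_first_step (pos_ge0 i) (pos_le i)) (Rintegral_first_step
  (neg_ge0 i) (neg_le i)).
rewrite -(RintegralB measurableT (bmeas_integrable _ bmp) (bmeas_integrable _ bmn)).
rewrite unlock; congr fine; apply: ae_eq_integral => //.
- by apply/measurable_EFinP; case: (bmeasB bmp bmn).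
- by apply/measurable_EFinP; exact: measurable_drift.
exists (~` range_below0); split => //; first exact: measurableC.
by move=> w /= ne wr; apply: ne => _; rewrite drift_mean_step.
Qed.

Lemma row_local_clipped_step l i :
  row_local l 0 (fun z : env * path => clipped_coord i (first_step z)).
Proof. by []. Qed.

Lemma birkhoff_sum_clipped_step i n (z : env * path) : z.2 0%N = 0 ->
  (forall k, enorm (site_vec (z.2 k.+1 - z.2 k) : 'rV[R]_d) <= M) ->
  birkhoff_sum theta (fun z => clipped_coord i (first_step z)) n z = (z.2 n 0 i)%:~R.
Proof.
move=> z0 zM; transitivity (\sum_(j < n) ((z.2 j.+1 - z.2 j) 0 i)%:~R : R).
  by apply: eq_bigr => j _; rewrite first_step_iter /clipped_coord zM.
elim: n => [|n IH]; first by rewrite big_ord0 z0 mxE.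
by rewrite big_ord_recr /= IH !mxE intrD intrN addrCA subrr addr0.
Qed.

Lemma measurable_range_below : measurable (range_below M : set env).
Proof.
rewrite (_ : range_below M = \bigcap_(ij in [set: site * site])
  (if M < enorm (site_vec
    (ij.1 - ij.2) : 'rV[R]_d) then [set w : env | w ij.1 ij.2 = 0] else setT)).
  rewrite -[\bigcap_(_ in _) _]setCK setC_bigcap; apply: measurableC.
  apply: countable_bigcupT_measurable => // ij; apply: measurableC.
  case: ifP => // _.
  exact: (measurable_preimage (measurable_env_prob _ _) (measurable_set1 0)).
apply/seteqP; split=> w h.
  by move=> [i j] _ /=; case: ifP => // ijM; exact: h.
by move=> i j ijM; have := h (i, j) I; rewrite /= ijM.
Qed.

Lemma range_below_steps (mu : probability env R) :
  mu (range_below M) = 1%E ->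
  annealed_law mu 0 (\bigcup_k [set z : env * path |
    M < enorm (site_vec (z.2 k.+1 - z.2 k) : 'rV[R]_d)]) = 0%E.
Proof.
move=> mu1.
have mE k : measurable [set z : env * path | M < enorm (site_vec
  (z.2 k.+1 - z.2 k) : 'rV[R]_d)].
  apply: (measurable_preimage (f := fun z : env * path => z.2 k.+1 - z.2 k)
    (B := [set x | M < enorm (site_vec x : 'rV[R]_d)])) => //.
  exact: (measurable_site_comp2 (fun a b => a - b) (measurable_coord k.+1)
    (measurable_coord k)).
have mR := measurable_range_below.
apply: null_bigcup => // k; apply/(annealed0P _ (mE k)).
apply: null_subset ((probability1P mu mR).1 mu1).
- exact: (measurable_qsec_neq0 (mE k)).
- exact: measurableC.
move=> w /= /eqP qw wR; apply: qw; apply: null_subset (qlaw_null_step w k).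
- exact: measurable_sec.
- rewrite (_ : [set X | _] = [set X : path | [set t : seq site |
     w (nth 0 t k) (nth 0 t k.+1) = 0] (mkseq X k.+2)]); last first.
    by apply/funext => X; rewrite /mkset !nth_mkseq.
  exact: measurable_mkseq.
by move=> X XM; apply: wR; rewrite -opprB enormN.
Qed.

End position.

(** Outside a null set each coordinate of $X_n$ is a telescoping Birkhoff sum of the clipped first
    step, a bounded function depending on the path alone. *)
Lemma annealed_rescale_cvg (R : realType) (d : nat) (l : 'rV[R]_d) (M : R)
  (P Pinf : probability (env R d) R) :
  shift_invariant P -> shift_ergodic P -> 0 <= M ->
  P (range_below M) = 1%E ->
  (forall e, good_step l e -> P [set w : env R d | w 0 e = 0] = 0%E) ->
  transient_law l P -> l != 0 -> invariant_ac l P Pinf ->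
  annealed_law P 0 [set wX |
    (n%:R^-1 *: site_vec (wX.2 n)) @[n --> \oo] -->
    \row_k fine ('E_Pinf[fun w => drift w 0 k])] = 1%E.
Proof.
move=> P_inv P_erg M0 P_range P_ell P_tr l0 [Pinf_inv Pinf_ac].
pose c k := fine ('E_Pinf[fun w => drift w 0 k]).
pose u k n (z : env R d * traj (site d)) : R := (n%:R^-1 *: site_vec
  (z.2 n) : 'rV[R]_d) 0 k.
have mu k n : measurable_fun setT (u k n).
  apply: (measurable_comp_fibers (g := fun z : env R d * traj (site d) => z.2 n)
    _ (fun x : site d => (n%:R^-1 *: site_vec x : 'rV[R]_d) 0 k)) => x.
  exact: (measurable_preimage (measurable_coord n)).
set S : set (env R d * traj (site d)) := [set wX | _].
have SE : S = \bigcap_(k in [set: 'I_d]) [set z | u k n z @[n --> \oo] --> c k].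
  apply/seteqP; split=> z.
    by move=> h k _; have := @row_coord_cvg _ _ _ _ k h; rewrite mxE.
  by move=> h; apply: row_cvg => k; rewrite mxE; exact: (h k I).
have mS : measurable S.
  rewrite SE -[\bigcap_(_ in _) _]setCK setC_bigcap; apply: measurableC.
  apply: countable_bigcupT_measurable => // k; apply: measurableC.
  exact: measurable_cvg_set (mu k).
apply/(probability1P (annealed_law P 0) mS).
pose f k (z : env R d * traj (site d)) := clipped_coord M k (first_step z).
have bf k : bounded_measurable (f k) by exact: bmeas_clipped_step.
pose m k := \int[annealed_law Pinf 0]_z f k z.
have mE k : m k = c k.
  apply: Rintegral_clipped_step => //.
  have sR := @sigma_rows_range_below0 R d M l.
  have sRC : sigma_rows l 0 (~` range_below0 M).
    have /sigma_rowsP[mR Rc] := sR; apply/sigma_rowsP; split; first exact: measurableC.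
    by rewrite -preimage_setC Rc.
  apply: (Pinf_ac 0%N) => //; have /sigma_rowsP[mR _] := sR.
  apply/(probability1P P mR); apply/eqP; rewrite eq_le probability_le1//= -P_range.
  apply: le_measure; rewrite ?inE//; first exact: measurable_range_below.
  by move=> w h j; exact: h.
have lf k : local_event l (birkhoff_cvg theta (f k) (m k)).
  exact: (local_birkhoff_cvg (m k) (row_local_clipped_step M l k)).
have mL k : measurable (~` birkhoff_cvg theta (f k) (m k)).
  apply/measurableC/measurable_birkhoff_cvg; first exact: measurable_theta.
  by case: (bf k).
have L0 k : annealed_law P 0 (~` birkhoff_cvg theta (f k) (m k)) = 0%E.
  exact: (law_of_large_numbers P_inv P_erg P_ell P_tr Pinf_inv Pinf_ac l0 (bf k) (lf k)).
pose N1 := \bigcup_(k in [set: 'I_d]) ~` birkhoff_cvg theta (f k) (m k).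
pose N2 := \bigcup_k [set z : env R d * traj (site d) |
    M < enorm (site_vec (z.2 k.+1 - z.2 k) : 'rV[R]_d)].
pose N3 := [set z : env R d * traj (site d) | z.2 0%N <> 0].
have mN1 : measurable N1 by exact: countable_bigcupT_measurable.
have mN2 : measurable N2.
  apply: bigcupT_measurable => k.
  apply: (measurable_preimage (f := fun z : env R d * traj (site d) => z.2 k.+1 - z.2 k)
    (B := [set x | M < enorm (site_vec x : 'rV[R]_d)])) => //.
  exact: (measurable_site_comp2 (fun a b => a - b) (measurable_coord k.+1)
    (measurable_coord k)).
have mN3 : measurable N3 := @measurable_start_neq0 R d.
apply: (null_subset (measurableC mS) (measurableU _ _ mN1 (measurableU _ _ mN2 mN3))).
  move=> z nS; apply: contrapT => nN; apply: nS.
  have z0 : z.2 0%N = 0.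
    by apply: contrapT => h; apply: nN; right; right.
  have zM k : enorm (site_vec (z.2 k.+1 - z.2 k) : 'rV[R]_d) <= M.
    by rewrite leNgt; apply/negP => h; apply: nN; right; left; exists k.
  rewrite SE => k _; have : birkhoff_cvg theta (f k) (m k) z.
    by apply: contrapT => h; apply: nN; left; exists k.
  have uE n : birkhoff_sum theta (f k) n z / n%:R = u k n z.
    by rewrite (birkhoff_sum_clipped_step k n z0 zM) /u !mxE mulrC.
  by rewrite /birkhoff_cvg /= mE; under eq_fun do rewrite uE.
apply: measure_eq0U => //; first exact: measurableU.
  by apply: null_bigcup_count => k; [exact: mL|exact: L0].
apply: measure_eq0U => //; last exact: annealed_start.
exact: range_below_steps.
Qed.

Theorem theorem2 (R : realType) (d : nat) (d_ge1 : (1 <= d)%N)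
  (P : probability (env R d) R) (M : R) (l : 'rV[R]_d)
  (P_inv : shift_invariant P) (P_erg : shift_ergodic P)
  (M_ge1 : 1 <= M) (P_range : finite_range M P)
  (l_neq0 : l != 0)
  (P_elliptic : P [set w : env R d | forall j : site d,
     0 <= dot (site_vec j) l -> enorm (site_vec j : 'rV[R]_d) = 1 ->
     0 < w 0 j] = 1%E)
  (P_transient : annealed_law P 0 [set wX |
     (dot (site_vec (wX.2 n)) l) @[n --> \oo] --> +oo] = 1%E)
  (Pinf : probability (env R d) R)
  (Pinf_inv : env_process_invariant Pinf)
  (Pinf_ac : forall k : int, k <= 0 -> ac_on (sigma_above l k) Pinf P) :
  [/\ forall k : int, k <= 0 -> ac_on (sigma_above l k) P Pinf /\ ac_on (sigma_above l k) Pinf P,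
      time_shift_ergodic (env_process_law Pinf),
      (forall Q : probability (env R d) R,
         env_process_invariant Q ->
         (forall k : int, k <= 0 -> ac_on (sigma_above l k) Q P) ->
         forall A, measurable A -> Q A = Pinf A) /\
      cvg_weakly (empirical P) Pinf
    & annealed_law P 0 [set wX |
        (n%:R^-1 *: site_vec (wX.2 n)) @[n --> \oo] -->
        \row_k fine ('E_Pinf[fun w => drift w 0 k])] = 1%E].
Proof.
have P_ell e : good_step l e -> P [set w : env R d | w 0 e = 0] = 0%E.
  move=> [e0 e1].
  set S := [set w | _] in P_elliptic.
  have mS : measurable S.
    rewrite (_ : S = \bigcap_(j in [set: site d])
      (if `[< 0 <= dot (site_vec j) l /\ enorm (site_vec j : 'rV[R]_d) = 1 >]
       then ~` [set w : env R d | w 0 j = 0] else setT)).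
      rewrite -[\bigcap_(_ in _) _]setCK setC_bigcap; apply: measurableC.
      apply: countable_bigcupT_measurable => // j; apply: measurableC.
      by case: ifP => // _; apply: measurableC; exact: measurable_env_eq0.
    apply/seteqP; split=> w h j.
      move=> _; case: asboolP => // -[j0 j1] /= wj.
      by have := h j j0 j1; rewrite wj ltxx.
    move=> j0 j1; have := h j I; rewrite asboolT//= => /eqP wj.
    by rewrite lt0r wj env_ge0.
  apply: null_subset ((probability1P P mS).1 P_elliptic).
  - exact: measurable_env_eq0.
  - exact: measurableC.
  - by move=> w we Sw; have := Sw e e0 e1; rewrite we ltxx.
have P_tr : transient_law l P.
  have mu n : measurable_fun setT (fun z : env R d * traj (site d) => dot (site_vec (z.2 n)) l).
    apply: (measurable_comp_fibers (g := fun z : env R d * traj (site d) => z.2 n)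
      _ (fun x : site d => dot (site_vec x) l)) => x.
    exact: (measurable_preimage (measurable_coord n)).
  have mS := measurable_cvgy_set mu.
  have S0 := (probability1P (annealed_law P 0) mS).1 P_transient.
  have mN3 := @measurable_start_neq0 R d.
  have mL : measurable (~` \bigcup_m @level_event R d l m).
    apply: measurableC; apply: bigcupT_measurable => m; exact: measurable_level_event.
  apply: (null_subset mL (measurableU _ _ (measurableC mS) mN3)); last first.
    by apply: measure_eq0U => //; [exact: measurableC|exact: annealed_start].
  move=> z nL; apply: contrapT => nN; apply: nL.
  have z0 : z.2 0%N = 0 by apply: contrapT => h; apply: nN; right.
  have zS : (dot (site_vec (z.2 n)) l) @[n --> \oo] --> +oo.
    by apply: contrapT => h; apply: nN; left.
  (* The heights are nonnegative from time [N] on, and [K] bounds the finitely many earlier ones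
     from below. *)
  have [N _ hN] := (cvgryPge _).1 zS 0.
  have [K KP] : exists K : nat, forall n, (n < N)%N -> - K%:R <= height l (z.2 n).
    elim: N {hN} => [|N [K IH]]; first by exists 0%N.
    have [k hk] := nat_upper_bound (- height l (z.2 N)); exists (maxn K k) => n.
    rewrite ltnS leq_eqVlt => /predU1P[->|/IH].
      by rewrite lerNl (le_trans hk)// ler_nat leq_maxr.
    by apply: le_trans; rewrite lerN2 ler_nat leq_maxl.
  exists K => //; split=> // n; have [/KP//|Nn] := ltnP n N.
  by apply: le_trans (hN n Nn); rewrite oppr_le0.
have neg_int (k : int) : k <= 0 -> exists m : nat, k = - m%:Z.
  by move=> k0; exists `|k|%N; rewrite abszE ler0_norm ?opprK.
have iac (Q : probability (env R d) R) : env_process_invariant Q ->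
    (forall k : int, k <= 0 -> ac_on (sigma_above l k) Q P) -> invariant_ac l P Q.
  move=> Q_inv Q_ac; split=> // k A; rewrite sigma_rows_above => kA.
  by apply: (Q_ac _ _ _ kA); rewrite oppr_le0.
have [_ Pinf_ac'] := iac _ Pinf_inv Pinf_ac.
split.
- move=> k k0; split; last exact: Pinf_ac.
  have [m ->] := neg_int _ k0; move=> A; rewrite -sigma_rows_above.
  exact: (P_ac_nat P_inv P_erg P_ell Pinf_inv Pinf_ac').
- exact: (env_process_ergodic P_inv P_erg P_ell P_tr Pinf_inv Pinf_ac' l_neq0).
- split; last exact: (empirical_cvg_weakly P_inv P_erg P_ell P_tr l_neq0 (iac _ Pinf_inv Pinf_ac)).
  move=> Q Q_inv Q_ac.
  exact: (invariant_ac_unique P_inv P_erg P_ell P_tr l_neq0 (iac _ Pinf_inv Pinf_ac) (iac _ Q_inv Q_ac)).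
- apply: (annealed_rescale_cvg P_inv P_erg _ P_range P_ell P_tr l_neq0 (iac _ Pinf_inv Pinf_ac)).
  exact: le_trans ler01 M_ge1.
Qed.
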